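(* There is an effective procedure (algorithm) which, given two polynomials $p,q\in\mathbb{C}[x,y]$ such that the fibers $\{p(x,y)=0\}$ and $\{q(x,y)=0\}$ both admit one-variable polynomial parametrizations, decides whether or not there is an automorphism of $\mathbb{C}[x,y]$ that takes $p$ to $q$. The input of the procedure consists only of $p$ and $q$; the parametrizations need not be known.
   Context: For $p\in\mathbb{C}[x,y]$, the fiber $\{p(x,y)=0\}$ is the zero set of $p$ in $\mathbb{C}^2$. It is said to admit a one-variable polynomial parametrization if there are polynomials $u(t),v(t)\in\mathbb{C}[t]$ such that $\{p=0\}=\{(u(t),v(t)) : t\in\mathbb{C}\}$. Automorphisms of $\mathbb{C}[x,y]$ are $\mathbb{C}$-algebra automorphisms. ''Effective'' is understood in terms of the coefficients of $p$ and $q$, with exact arithmetic on complex numbers (field operations, equality tests, extraction of roots of polynomials) regarded as effective operations. *)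

(* Defs.v *)
From HB Require Import structures.
From mathcomp Require Import all_boot all_order all_algebra.
From mathcomp Require Import reals complex mpoly.

Set Implicit Arguments.
Unset Strict Implicit.
Unset Printing Implicit Defensive.

Import GRing.Theory.
Local Open Scope ring_scope.

(** * Exact computation over a field

    The model of computation is Jones' WHILE language on binary trees
    (LISP-like S-expressions), in which an atom of a tree is an element of the
    field [K].  This is Turing-complete on the discrete part of the data, and
    the only access a program has to the elements of [K] is through the field
    operations, the equality test and the extraction of the roots of a
    polynomial.  The only constants available are [0] and [1], so that the
    text of a program carries no information about [K].  *)

Inductive data (K : Type) : Type :=
| Leaf
| Atom of K
| Node of data K & data K.
Arguments Leaf {K}.

Inductive primitive : Type :=
| PId | PLeaf | PHead | PTail | PIsLeaf | PIsAtom
| PZero | POne | PAdd | POpp | PMul | PInv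
| PEqAtom
| PRoots.

Inductive program : Type :=
| Prim of primitive
| Seq of program & program             (* first, then second *)
| Pair of program & program            (* both on the same input *)
| If of program & program & program    (* test, then, else *)
| While of program & program.          (* test, body *)

Section Semantics.
Variable K : fieldType.
Implicit Types (d e : data K) (roots : {poly K} -> seq K).

(* Destructors are total, with default values on data of the wrong shape. *)
Definition dhead d := if d is Node e _ then e else Leaf.
Definition dtail d := if d is Node _ e then e else Leaf.
Definition dnum d : K := if d is Atom z then z else 0.

Fixpoint data_of_seq (s : seq (data K)) : data K :=
  if s is d :: s' then Node d (data_of_seq s') else Leaf.

Fixpoint seq_of_data d : seq (data K) :=
  if d is Node e d' then e :: seq_of_data d' else [::].

Definition data_of_atoms (s : seq K) : data K :=
  data_of_seq [seq Atom z | z <- s].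

Definition atoms_of_data d : seq K := [seq dnum e | e <- seq_of_data d].

(* [Leaf] is false; as a test, every other value is true. *)
Definition data_of_bool (b : bool) : data K := if b then Atom 1 else Leaf.
Definition truth d : bool := if d is Leaf then false else true.

(* [roots f] lists the roots of every nonzero [f], with multiplicities and in
   an unspecified order. *)
Definition root_extraction roots : Prop :=
  forall f : {poly K}, f != 0 ->
    f = lead_coef f *: \prod_(z <- roots f) ('X - z%:P).

(* A binary operation acts on the data [Node (Atom x) (Atom y)].  [PRoots] takes
   the list of the coefficients of a polynomial, constant term first, and
   [PInv] sends 0 to 0. *)
Definition run_primitive roots (o : primitive) d : data K :=
  match o with
  | PId => d
  | PLeaf => Leaf
  | PHead => dhead d
  | PTail => dtail d
  | PIsLeaf => data_of_bool (if d is Leaf then true else false)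
  | PIsAtom => data_of_bool (if d is Atom _ then true else false)
  | PZero => Atom 0
  | POne => Atom 1
  | PAdd => Atom (dnum (dhead d) + dnum (dtail d))
  | POpp => Atom (- dnum d)
  | PMul => Atom (dnum (dhead d) * dnum (dtail d))
  | PInv => Atom (dnum d)^-1
  | PEqAtom => data_of_bool (dnum (dhead d) == dnum (dtail d))
  | PRoots => data_of_atoms (roots (Poly (atoms_of_data d)))
  end.

(* [eval roots P d e]: started on [d], the program [P] halts with result [e]. *)
Inductive eval roots : program -> data K -> data K -> Prop :=
| EvalPrim o d : eval roots (Prim o) d (run_primitive roots o d)
| EvalSeq P Q d e f :
    eval roots P d e -> eval roots Q e f -> eval roots (Seq P Q) d f
| EvalPair P Q d e f :
    eval roots P d e -> eval roots Q d f ->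
    eval roots (Pair P Q) d (Node e f)
| EvalIfTrue T P Q d t e :
    eval roots T d t -> truth t -> eval roots P d e ->
    eval roots (If T P Q) d e
| EvalIfFalse T P Q d t e :
    eval roots T d t -> ~~ truth t -> eval roots Q d e ->
    eval roots (If T P Q) d e
| EvalWhileTrue T P d t e f :
    eval roots T d t -> truth t -> eval roots P d e ->
    eval roots (While T P) e f -> eval roots (While T P) d f
| EvalWhileFalse T P d t :
    eval roots T d t -> ~~ truth t -> eval roots (While T P) d d.

Lemma eval_functional roots P d e1 e2 :
  eval roots P d e1 -> eval roots P d e2 -> e1 = e2.
Proof.
move=> H; elim: H e2 => {P d e1}; intros;
match goal with E : eval _ _ _ ?x |- _ = ?x => inversion E; clear E; subst end;
repeat match goal with
| IH : forall e, eval ?r ?P ?d e -> _ = e, E : eval ?r ?P ?d _ |- _ =>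
    apply IH in E; subst
end; by [| match goal with N : is_true (~~ truth ?t), T : is_true (truth ?t) |- _ =>
       by rewrite T in N end].
Qed.

End Semantics.

Lemma root_extraction_exists (K : closedFieldType) :
  exists roots : {poly K} -> seq K, root_extraction roots.
Proof.
exists (fun f => sval (closed_field_poly_normal f)) => f _.
by case: (closed_field_poly_normal f).
Qed.

(** * Polynomials in two variables *)

(* A polynomial is given to a program as the square table of the coefficients
   of the monomials [x^i y^j] with [i, j] at most its total degree. *)
Definition data_of_poly (K : fieldType) (p : {mpoly K[2]}) : data K :=
  data_of_seq
    [seq data_of_atoms [seq p@_[multinom nth 0%N [:: i; j] k | k < 2]
                      | j <- iota 0 (msize p)]
    | i <- iota 0 (msize p)].

Definition polynomially_parametrized (K : fieldType) (p : {mpoly K[2]}) : Prop :=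
  exists u v : {poly K}, forall a b : K,
    p.@[tnth [tuple a; b]] = 0 <-> exists t : K, a = u.[t] /\ b = v.[t].

Definition automorphic (K : fieldType) (p q : {mpoly K[2]}) : Prop :=
  exists phi : {lrmorphism {mpoly K[2]} -> {mpoly K[2]}},
    bijective phi /\ phi p = q.

(* Main.v *)
Require Import Defs.
From HB Require Import structures.
From mathcomp Require Import all_boot all_order all_algebra perm.
From mathcomp Require Import polyXY ring zify.
From mathcomp Require Import reals complex mpoly.

(** A parametrized fiber can be singular or multiple, as for [(x^2 - y^3)^l], so that straightening
    it to a line is not always possible and normal forms with both exponents at least 2 remain. The
    edge has a single root because [u^A - c v^B] drops in degree: its integral equation over [K[v]]
    yields a polynomial that vanishes on the fiber and whose weighted leading form is a power of the
    binomial. The shifts are computed from the coefficients of the polynomial alone. As a normalized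
    polynomial is merely swapped by further steps, a number of steps bounded by the size of the
    input replaces a termination test. Monomials are compared by degree and then with [y] below [x].
    Hence a polynomial with leading monomial [y] is affine in [y], which turns the equality case of
    the degree bound into the shape of [F]. The obstacle in that bound is cancellation: the edge of
    [f] may vanish at the leading coefficients of [F] and [G]. An [l]-th derivative in [y] removes
    the vanishing, and the constant Jacobian limits what the derivative costs. *)

(** The Newton polygon of a polynomial whose fiber is parametrized by [(u, v)], with
    [u] and [v] nonconstant, is a triangle whose slanted edge carries
    [e (x^A - c y^B)^l], with [A] and [B] coprime.  Alternating Tschirnhaus
    substitutions [x -> x + s(y)] and [y -> y + s(x)], each killing a subleading
    coefficient, terminates with a polynomial [f] for which neither of [A] and [B]
    is [1], or which is a monomial in one variable.

    For such normalized [f] and [g], an automorphism taking [f] to [g] is, up to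
    exchanging [x] and [y], a scaling of the variables.  Let [f] have its longer leg
    along [y], and let the automorphism be [(x, y) -> (G, F)].  The Jacobian of [F]
    and [G] is constant, and this forces the leading monomial of [f(G, F)] to be at
    least that of [f]; by symmetry the two are equal, which forces [F] to be affine
    in [y], hence [G = be x + h(y)].  The vanishing of the subleading coefficients
    then kills [h] and the constant term of [F].

    The factors of the scaling are roots of explicit binomial equations, so that
    finitely many candidates have to be tested. *)

Set Implicit Arguments.
Unset Strict Implicit.
Unset Printing Implicit Defensive.
Import Order.TTheory GRing.Theory Num.Theory.

Local Open Scope ring_scope.

(** * Jacobian mates and leading monomials *)

Notation i0 := (ord0 : 'I_2).
Notation i1 := (ord_max : 'I_2).

Lemma big_ord2 (T : Type) (idx : T) (op : Monoid.law idx) (F : 'I_2 -> T) :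
  \big[op/idx]_(i < 2) F i = op (F i0) (F i1).
Proof.
rewrite big_ord_recl big_ord1; congr (op _ (F _)); exact/val_inj.
Qed.

Lemma ord2P (P : 'I_2 -> Prop) : P i0 -> P i1 -> forall i, P i.
Proof.
move=> P0 P1 [[|[|//]] Hi].
  by rewrite (_ : Ordinal Hi = i0) //; apply: val_inj.
by rewrite (_ : Ordinal Hi = i1) //; apply: val_inj.
Qed.

Lemma mdeg2 (m : 'X_{1..2}) : mdeg m = (m i0 + m i1)%N.
Proof. by rewrite mdegE big_ord2. Qed.

(** Ties of degree are broken by the first differing exponent, so ['X_i1] is the smaller
    variable. *)
Lemma lemc_fst (m1 m2 : 'X_{1..2}) :
  mdeg m1 = mdeg m2 -> (m1 <= m2)%O -> (m1 i0 <= m2 i0)%N.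
Proof.
move=> e; rewrite le_eqVlt => /predU1P[->//|lt12]; case: (ltmcP e lt12) => i.
by elim/ord2P: i => [_ /ltnW //|/(_ i0 isT) -> ].
Qed.

Lemma mderivXU (R : nzRingType) n (i j : 'I_n) :
  ('X_j : {mpoly R[n]})^`M(i) = (j == i)%:R.
Proof.
rewrite mderivX mnm1E; case: eqP => [->|_]; last by rewrite scale0r.
rewrite scale1r (_ : (_ - _)%MM = 0%MM) ?mpolyX0 //.
by apply/mnmP => k; rewrite mnmBE subnn mnm0E.
Qed.

Lemma mpoly_ring_ind n (R : comNzRingType) (E : {mpoly R[n]} -> Prop) :
    (forall c, E c%:MP) -> (forall i, E 'X_i) ->
    (forall p q, E p -> E q -> E (p + q)) -> (forall p q, E p -> E q -> E (p * q)) ->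
  forall p, E p.
Proof.
move=> EC EX ED EM; elim/mpolyind => [|c m p _ _ IH]; first exact: (EC 0).
apply: (ED) IH; rewrite -mul_mpolyC; apply: (EM) (EC c) _.
have E1 : E 1 by rewrite -mpolyC1; apply: EC.
rewrite mpolyXE_id; apply: (big_ind E) => // i _.
by elim: (m i) => [|k IHk]; rewrite ?expr0 // exprS; apply: (EM).
Qed.

Section Bracket.
Variable K : comNzRingType.
Implicit Types f g h P : {mpoly K[2]}.

(** The Jacobian determinant, with the sign that gives [bracket 'X_i1 'X_i0 = 1]. *)
Definition bracket f g := f^`M(i1) * g^`M(i0) - f^`M(i0) * g^`M(i1).

Lemma bracketM f g h : bracket (f * g) h = f * bracket g h + bracket f h * g.
Proof. by rewrite /bracket !mderivM; ring. Qed.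

Lemma bracketC f g : bracket g f = - bracket f g.
Proof. by rewrite /bracket; ring. Qed.

Lemma bracketff f : bracket f f = 0.
Proof. by rewrite /bracket; ring. Qed.

Lemma bracketD f g h : bracket (f + g) h = bracket f h + bracket g h.
Proof. by rewrite /bracket !mderivD; ring. Qed.

(** The chain rule: both sides are derivations in [P] along the substitution, so that constants and
    variables suffice. *)
Lemma bracket_comp P (G F H : {mpoly K[2]}) (t := [tuple G; F]) :
  bracket (P \mPo t) H = (P^`M(i1) \mPo t) * bracket F H + (P^`M(i0) \mPo t) * bracket G H.
Proof.
elim/mpoly_ring_ind: P => [c|i|P Q EP EQ|P Q EP EQ].
- by rewrite !mderivC comp_mpolyC /bracket !mderivC comp_mpoly0; ring.
- by rewrite comp_mpolyXU !mderivXU; elim/ord2P: i; rewrite /= ?rmorph1 ?rmorph0; ring.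
- by rewrite !linearD /= bracketD EP EQ; ring.
- by rewrite !rmorphM /= bracketM EP EQ !mderivM !rmorphD !rmorphM /=; ring.
Qed.
End Bracket.

Lemma coef_neq0_le_mlead n (R : nzRingType) (p : {mpoly R[n]}) m :
  p@_m != 0 -> (m <= mlead p)%O.
Proof. by rewrite -mcoeff_msupp; apply: msupp_le_mlead. Qed.

Lemma lemc_mul2r n (k : nat) (m1 m2 : 'X_{1..n}) :
  (m1 <= m2)%O -> ((m1 *+ k)%MM <= (m2 *+ k)%MM)%O.
Proof. by move=> h; elim: k => [|k IH]; rewrite ?mulm0n // !mulmS lem_add. Qed.

Lemma ltmc_mul2r n (k : nat) (m1 m2 : 'X_{1..n}) :
  (0 < k)%N -> (m1 < m2)%O -> ((m1 *+ k)%MM < (m2 *+ k)%MM)%O.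
Proof.
by case: k => // k _ h; rewrite !mulmS; apply: ltmc_le_add => //; apply/lemc_mul2r/ltW.
Qed.

Lemma lemc_mul2rE n (k : nat) (m1 m2 : 'X_{1..n}) : (0 < k)%N ->
  ((m1 *+ k)%MM <= (m2 *+ k)%MM)%O = (m1 <= m2)%O.
Proof.
move=> k0; case: (leP m1 m2) => [/lemc_mul2r->//|/(ltmc_mul2r k0)].
by rewrite ltNge => /negbTE.
Qed.

Lemma mulmnDr n (m : 'X_{1..n}) j k : (m *+ (j + k) = m *+ j + m *+ k)%MM.
Proof. by apply/mnmP => i; rewrite mnmDE !mulmnE mulnDr. Qed.

Lemma mulmnA n (m : 'X_{1..n}) j k : (m *+ (j * k) = m *+ j *+ k)%MM.
Proof. by apply/mnmP => i; rewrite !mulmnE mulnA. Qed.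

Lemma mulmnDl n (m1 m2 : 'X_{1..n}) k : ((m1 + m2) *+ k = m1 *+ k + m2 *+ k)%MM.
Proof. by apply/mnmP => i; rewrite !(mnmDE, mulmnE) mulnDl. Qed.

Lemma mcoeffXW n (R : idomainType) (f : {mpoly R[n]}) m k :
  (mlead f <= m)%O -> (f ^+ k)@_(m *+ k) = f@_m ^+ k.
Proof.
move=> h; elim: k => [|k IH]; first by rewrite mulm0n mcoeff1 eqxx.
rewrite !exprS mulmS mleadcMW ?IH //.
exact: le_trans (mleadX_le _ _) (lemc_mul2r _ h).
Qed.

(** The Euler operator is diagonal on monomials, hence cannot enlarge the support. *)
Lemma mcoeff_euler n (R : comNzRingType) (p : {mpoly R[n]}) i m :
  ('X_i * p^`M(i))@_m = p@_m *+ m i.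
Proof.
elim/mpolyind: p => [|c k p _ _ IH]; first by rewrite linear0 mulr0 mcoeff0 mul0rn.
rewrite linearP /= mulrDr !mcoeffD IH mulrnDl; congr (_ + _).
rewrite mderivX -!scalerAr -mpolyXD !mcoeffZ !mcoeffX -mulrnAr; congr (_ * _).
have [k0|k0] := eqVneq (k i) 0%N.
  by rewrite k0 mul0r; case: eqP => [<-|_]; rewrite ?k0 // mul0rn.
rewrite addmC submK ?lep1mP //.
by case: eqP => [->|_]; rewrite ?mulr1 // mulr0 mul0rn.
Qed.

Section Comp.
Variable K : idomainType.
Implicit Types f g P : {mpoly K[2]}.

(** Multiplication by [x y] turns each derivative in the bracket into an Euler operator, which does
    not raise a leading monomial. *)
Lemma bracket_lead f g : bracket f g != 0 ->
  ((mlead (bracket f g) + (U_(i0) + U_(i1)))%MM <= (mlead f + mlead g)%MM)%O.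
Proof.
move=> nz; pose E i (p : {mpoly K[2]}) := 'X_i * p^`M(i).
have lE i p : (mlead (E i p) <= mlead p)%O.
  have [->|nzE] := eqVneq (E i p) 0; first by rewrite mlead0 le0x.
  apply: coef_neq0_le_mlead; apply: contraNneq nzE => p0.
  by rewrite -mleadc_eq0 mcoeff_euler p0 mul0rn.
have -> : (mlead (bracket f g) + (U_(i0) + U_(i1)) = mlead ('X_[U_(i0) + U_(i1)] * bracket f g))%MM.
  rewrite mleadM ?mleadXm 1?addmC //.
  by rewrite -msupp_eq0 msuppX.
have -> : 'X_[U_(i0) + U_(i1)] * bracket f g = E i1 f * E i0 g - E i0 f * E i1 g.
  by rewrite mpolyXD /bracket /E; ring.
apply: le_trans (mleadB_le _ _) _; rewrite leUx.
by apply/andP; split; apply: le_trans (mleadM_le _ _) _; apply: lem_add.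
Qed.

Variables F G : {mpoly K[2]}.
Let t := [tuple G; F].

Lemma comp_mpolyX2 m : 'X_[m] \mPo t = F ^+ m i1 * G ^+ m i0.
Proof. by rewrite comp_mpolyX big_ord2 /= mulrC. Qed.

Lemma mcoeff_comp P m :
  (P \mPo t)@_m = \sum_(k <- msupp P) P@_k * (F ^+ k i1 * G ^+ k i0)@_m.
Proof.
rewrite comp_mpolyEX raddf_sum /=; apply: eq_bigr => k _.
by rewrite mcoeffZ comp_mpolyX2.
Qed.

Section Weight.
Variables (d : 'X_{1..2}) (a b : nat).
Hypotheses (hF : (mlead F <= (d *+ b)%MM)%O) (hG : (mlead G <= (d *+ a)%MM)%O).
Let wt (m : 'X_{1..2}) := (b * m i1 + a * m i0)%N.

Lemma lead_weight i j : (mlead (F ^+ i * G ^+ j) <= (d *+ (b * i + a * j))%MM)%O.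
Proof.
apply: le_trans (mleadM_le _ _) _; rewrite mulmnDr !mulmnA.
by apply: lem_add; apply: le_trans (mleadX_le _ _) _; apply: lemc_mul2r.
Qed.

Lemma coef_weight i j :
  (F ^+ i * G ^+ j)@_(d *+ (b * i + a * j)) = F@_(d *+ b) ^+ i * G@_(d *+ a) ^+ j.
Proof.
rewrite mulmnDr !mulmnA mleadcMW ?mcoeffXW //.
- by apply: le_trans (mleadX_le _ _) _; apply: lemc_mul2r.
- by apply: le_trans (mleadX_le _ _) _; apply: lemc_mul2r.
Qed.

Lemma comp_weight_low P V : d != 0%MM ->
  (forall m, P@_m != 0 -> (wt m < V)%N) -> (P \mPo t)@_(d *+ V) = 0.
Proof.
move=> d0 low; rewrite mcoeff_comp big_seq big1 // => m.
rewrite mcoeff_msupp => /low lt; rewrite [X in _ * X]mcoeff_gt_mlead ?mulr0 //.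
apply: le_lt_trans (lead_weight _ _) _.
rewrite -/(wt m) -(subnKC (ltnW lt)) mulmnDr -[X in (X < _)%O](addm0 (d *+ wt m)%MM).
rewrite ltmc_add2r lt_neqAle le0x andbT eq_sym; apply: contraNneq d0 => /(congr1 (@mdeg 2)).
by rewrite mdeg0 mdegMn => /eqP; rewrite muln_eq0 subn_eq0 leqNgt lt orbF mdeg_eq0.
Qed.

(** When [F] and [G] are bounded by multiples of one monomial [d], every term of [P] reaches at most
    [d] times its weight, and only the top coefficients of [F] and [G] contribute there. *)
Lemma comp_weight_hom P V : (forall m, P@_m != 0 -> wt m = V) ->
  (P \mPo t)@_(d *+ V) = P.@[tnth [tuple G@_(d *+ a); F@_(d *+ b)]].
Proof.
move=> hom; rewrite mcoeff_comp mevalE; apply: eq_big_seq => m.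
by rewrite mcoeff_msupp => /hom <-; rewrite coef_weight big_ord2 /= [in LHS](mulrC (_ ^+ _)).
Qed.

End Weight.
End Comp.

Lemma msuppM_ex n (R : nzRingType) (P Q : {mpoly R[n]}) m : (P * Q)@_m != 0 ->
  exists m1 m2, [/\ m = (m1 + m2)%MM, P@_m1 != 0 & Q@_m2 != 0].
Proof.
rewrite -mcoeff_msupp => /msuppM_le /allpairsP[[m1 m2] /= []].
by rewrite !mcoeff_msupp => h1 h2 ->; exists m1, m2.
Qed.

Lemma mcoeff_iter_deriv n (R : nzRingType) (i : 'I_n) k (P : {mpoly R[n]}) m :
  (iter k (mderiv i) P)@_m != 0 -> P@_(m + U_(i) *+ k) != 0.
Proof.
elim: k m => [|k IH] m /=; first by rewrite mulm0n addm0.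
rewrite mcoeff_deriv => h; rewrite mulmS addmA; apply: IH.
by apply: contraNneq h => ->; rewrite mul0rn.
Qed.

Lemma mderiv_exp n (R : comNzRingType) (i : 'I_n) (z : {mpoly R[n]}) k :
  (z ^+ k.+1)^`M(i) = k.+1%:R * z ^+ k * z^`M(i).
Proof.
elim: k => [|k IH]; first by rewrite expr1 expr0 !mul1r.
by rewrite exprS mderivM IH -[k.+2%:R]natr1 [z ^+ k.+1]exprS; ring.
Qed.

(* Modulo [z ^+ (l - k).+1], only the term differentiating [k] distinct factors survives. *)
Lemma iter_mderiv_exp n (R : comNzRingType) (i : 'I_n) (z : {mpoly R[n]}) l k :
  (k <= l)%N -> exists s,
    iter k (mderiv i) (z ^+ l) = z ^+ (l - k) * ((l ^_ k)%:R * z^`M(i) ^+ k + z * s).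
Proof.
elim: k => [|k IH] le_kl.
  by exists 0; rewrite subn0 ffactn0 /= mulr0 addr0 expr0 !mulr1.
have [s /= ->] := IH (ltnW le_kl).
have [r Er] : exists r, (l - k = r.+1)%N by exists (l - k).-1; lia.
have -> : (l - k.+1 = r)%N by lia.
rewrite ffactnSr Er mderivM mderiv_exp mderivD !mderivM.
set D := z^`M(i).
have -> : (l ^_ k)%:R^`M(i) = 0 :> {mpoly R[n]} by rewrite -mpolyC_nat mderivC.
exists (r.+1%:R * D * s + (l ^_ k)%:R * (D ^+ k)^`M(i) + D * s + z * s^`M(i)).
by rewrite natrM !exprS; ring.
Qed.

(** * Lower bound for the leading monomial of a composite with constant Jacobian *)

Section LowerBound.
Variable K : numFieldType.
Variables F G : {mpoly K[2]}.
Let t := [tuple G; F].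
Variable kap : K.
Hypotheses (kap0 : kap != 0) (jac : bracket F G = kap%:MP).

(* [bracket (P(G, F)) G = kap P_y(G, F)], while a bracket with [G] multiplies the
   leading monomial by at most [lead G / (x y)]. *)
Lemma deriv_lead P k m : (iter k (mderiv i1) P \mPo t)@_m != 0 ->
  ((m + (U_(i0) + U_(i1)) *+ k)%MM <= (mlead (P \mPo t) + mlead G *+ k)%MM)%O.
Proof.
elim: k m => [|k IH] m /=; first by rewrite !mulm0n !addm0; apply: coef_neq0_le_mlead.
set Q := iter k _ P in IH *.
have EQ : bracket (Q \mPo t) G = kap *: (Q^`M(i1) \mPo t).
  by rewrite bracket_comp bracketff mulr0 addr0 jac mulrC mul_mpolyC.
move=> nz; have nzQ' : kap *: (Q^`M(i1) \mPo t) != 0.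
  apply: contraNneq nz; rewrite -mul_mpolyC => /eqP; rewrite mulf_eq0 mpolyC_eq0 (negPf kap0).
  by move/eqP->; rewrite mcoeff0.
have := @bracket_lead _ (Q \mPo t) G; rewrite EQ => /(_ nzQ') h1.
have nzQ : Q \mPo t != 0.
  apply: contraNneq nzQ'; rewrite -EQ => ->.
  by rewrite /bracket !linear0 !mul0r subrr.
have := IH (mlead (Q \mPo t)); rewrite mleadc_eq0 => /(_ nzQ) h2.
have h3 : (m <= mlead (kap *: (Q^`M(i1) \mPo t)))%O.
  by apply: coef_neq0_le_mlead; rewrite mcoeffZ mulf_neq0.
set U := (U_(i0) + U_(i1))%MM in h1 h2 *.
have h4 : ((m + U)%MM <= (mlead (Q \mPo t) + mlead G)%MM)%O.
  by apply: le_trans h1; apply: lem_add.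
rewrite !mulmS.
have := lem_add h4 h2.
have -> : (m + U + (mlead (Q \mPo t) + U *+ k) = mlead (Q \mPo t) + (m + (U + U *+ k)))%MM.
  by apply/mnmP => i; rewrite !mnmDE; lia.
have -> : (mlead (Q \mPo t) + mlead G + (mlead (P \mPo t) + mlead G *+ k)
    = mlead (Q \mPo t) + (mlead (P \mPo t) + (mlead G + mlead G *+ k)))%MM.
  by apply/mnmP => i; rewrite !mnmDE; lia.
by rewrite lemc_add2r.
Qed.

Lemma jac_nonconst : (mlead F != 0%MM) && (mlead G != 0%MM).
Proof.
have nz : bracket F G != 0 by rewrite jac mpolyC_eq0.
have C (H : {mpoly K[2]}) : mlead H = 0%MM -> exists c, H = c%:MP.
  move=> H0; exists (H@_0); apply/mpolyP => m; rewrite mcoeffC.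
  case: eqP => [->|/eqP m0]; rewrite ?mulr1 // mulr0.
  by apply: mcoeff_gt_mlead; rewrite H0 lt0x.
by apply/andP; split; apply: contraNneq nz => /C[c ->]; rewrite /bracket !mderivC ?mul0r ?mulr0 subrr.
Qed.

Lemma comp_dominant P k M : P@_k != 0 ->
  (mlead F *+ k i1 + mlead G *+ k i0)%MM = M ->
  (forall k', P@_k' != 0 -> k' != k -> ((mlead F *+ k' i1 + mlead G *+ k' i0)%MM < M)%O) ->
  (P \mPo t)@_M != 0.
Proof.
move=> Pk EM low; rewrite mcoeff_comp (bigD1_seq k) ?msupp_uniq ?mcoeff_msupp //=.
rewrite big_seq_cond big1 ?addr0.
  rewrite -EM mleadcMW ?mleadX_le // !mcoeffXW //.
  have := jac_nonconst; have z0 (H : {mpoly K[2]}) : mlead H != 0%MM -> H@_(mlead H) != 0.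
    by move=> h; rewrite mleadc_eq0; apply: contraNneq h => ->; rewrite mlead0.
  by case/andP=> /z0 f0 /z0 g0; rewrite !mulf_neq0 ?expf_neq0.
move=> k' /andP[]; rewrite mcoeff_msupp => /low h /h lt.
rewrite [X in _ * X]mcoeff_gt_mlead ?mulr0 //; apply: le_lt_trans lt.
by apply: le_trans (mleadM_le _ _) _; apply: lem_add; apply: mleadX_le.
Qed.

End LowerBound.

Lemma lemc_mulmn n (m : 'X_{1..n}) i j : (i <= j)%N -> ((m *+ i)%MM <= (m *+ j)%MM)%O.
Proof. by move=> le; rewrite -(subnKC le) mulmnDr lemc_addr. Qed.

Lemma ltmc_mulmn n (m : 'X_{1..n}) i j :
  m != 0%MM -> (i < j)%N -> ((m *+ i)%MM < (m *+ j)%MM)%O.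
Proof.
move=> m0 lt; rewrite lt_neqAle lemc_mulmn ?(ltnW lt) // andbT.
apply: contraNneq m0 => /(congr1 (@mdeg n)); rewrite !mdegMn -mdeg_eq0; nia.
Qed.

(** After multiplication by [b], each [nu *+ b] can be traded for the larger [mu *+ a], which leaves
    [mu] with multiplicity [b i + a j], at most [l a b]. Strictness comes from a trade if [j] is
    positive, and from [i < l a] otherwise. *)
Lemma weight_dominated n (mu nu : 'X_{1..n}) a b l i j :
    mu != 0%MM -> (0 < b)%N -> ((nu *+ b)%MM < (mu *+ a)%MM)%O ->
    (b * i + a * j <= l * (a * b))%N -> (j == 0%N) ==> (i != l * a)%N ->
  ((mu *+ i + nu *+ j)%MM < (mu *+ (l * a))%MM)%O.
Proof.
move=> mu0 b0 lt le; have [->/= ne|j0 _] := posnP j.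
  by rewrite mulm0n addm0; apply: ltmc_mulmn => //; nia.
rewrite ltNge -(lemc_mul2rE _ _ b0) -ltNge mulmnDl -!mulmnA.
apply: lt_le_trans (lemc_mulmn mu (_ : b * i + a * j <= l * a * b)%N); last by lia.
rewrite mulmnDr [(i * b)%N]mulnC ltmc_add2r [(j * b)%N]mulnC !mulmnA.
exact: ltmc_mul2r.
Qed.

(** With [w = a b - a - b] the hypotheses give [D w + 2 <= a], while [a <= w + 2] because
    [(a - 1)(b - 2)] is nonnegative. As [w] is positive, everything is an equality. *)
Lemma edge_arith a b l D N :
    (1 < b)%N -> (b < a)%N -> (0 < l)%N -> (0 < D)%N ->
    (D * (l * (a * b) - l * b) + (1 + 1) * l <= N + D * a * l)%N -> (N <= l * a)%N ->
  N = (l * a)%N /\ D = 1%N.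
Proof.
move=> b2 lt_ba l0 D0; have [w Ew] : exists w, (a * b = w + a + b)%N.
  by exists (a * b - a - b)%N; nia.
have w0 : (a <= w + 2)%N by nia.
have -> : (l * (a * b) - l * b = l * (w + a))%N by rewrite Ew; nia.
move=> led leN; have le1 : (D * w + 2 <= a)%N by rewrite -(leq_pmul2l l0); nia.
have E1 : D = 1%N by nia.
by split=> //; nia.
Qed.

Lemma edge_arith1 a b l : (1 < b)%N -> (b < a)%N ->
  (1 * (l * a) + 1 * a * l <= 1 * (l * (a * b) - l * b) + (1 + 1) * l)%N.
Proof.
move=> b2 lt_ba; rewrite -mulnBr.
have : (2 * a <= a * b - b + 2)%N by nia.
nia.
Qed.

Lemma edge_arith0 a b l e : (1 < b)%N -> (b < a)%N -> (0 < l)%N ->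
  (e * a * l < e * (l * (a * b) - l * b) + l)%N.
Proof.
move=> b2 lt_ba l0; rewrite -mulnBr.
have : (a <= a * b - b)%N by nia.
nia.
Qed.

Section EdgeLowerBound.
Variable K : numFieldType.
Implicit Types P F G : {mpoly K[2]}.

Section Hom.
Variables a b : nat.
Let wt (m : 'X_{1..2}) := (b * m i1 + a * m i0)%N.

Definition homogeneous V P := forall m, P@_m != 0 -> wt m = V.

Lemma homogeneousM V W P Q : homogeneous V P -> homogeneous W Q -> homogeneous (V + W) (P * Q).
Proof.
move=> hP hQ m /msuppM_ex[m1 [m2 [-> /hP <- /hQ <-]]].
by rewrite /wt !mnmDE; ring.
Qed.

Lemma homogeneousX V P k : homogeneous V P -> homogeneous (k * V) (P ^+ k).
Proof.
move=> hP; elim: k => [|k IH]; last by rewrite exprS mulSn; apply: homogeneousM.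
by move=> m; rewrite mcoeff1; case: (m =P 0%MM) => [-> _|_]; rewrite ?eqxx // /wt !mnm0E !muln0.
Qed.

Lemma homogeneous_binomial c : homogeneous (a * b) ('X_i1 ^+ a - c *: 'X_i0 ^+ b).
Proof.
move=> m; rewrite mcoeffB mcoeffZ !mcoeffXn.
case: (_ =P m) => [<- _|_]; first by rewrite /wt !mulmnE !mnm1E /=; lia.
case: (_ =P m) => [<- _|_]; first by rewrite /wt !mulmnE !mnm1E /=; lia.
by rewrite mulr0 subrr eqxx.
Qed.

End Hom.

Definition edge (a b l : nat) (c e : K) : {mpoly K[2]} :=
  e *: ('X_i1 ^+ a - c *: 'X_i0 ^+ b) ^+ l.

Definition edge_form (a b l : nat) (c e : K) P :=
  forall m, (P - edge a b l c e)@_m != 0 -> (b * m i1 + a * m i0 < l * (a * b))%N.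

Variables (a b l : nat) (c e : K) (p F G : {mpoly K[2]}) (kap : K).
Hypotheses (e0 : e != 0) (b2 : (1 < b)%N) (lt_ba : (b < a)%N).
Hypotheses (l0 : (0 < l)%N) (cop : coprime a b) (pform : edge_form a b l c e p).
Hypothesis c0 : c != 0.
Hypotheses (kap0 : kap != 0) (jac : bracket F G = kap%:MP).
Let t := [tuple G; F].
Let q := p \mPo t.

Lemma edge_hom : homogeneous a b (l * (a * b)) (edge a b l c e).
Proof.
move=> m; rewrite mcoeffZ mulf_eq0 negb_or => /andP[_].
exact: (homogeneousX (@homogeneous_binomial a b c)).
Qed.

Lemma meval_edge v :
  (edge a b l c e).@[v] = e * (v i1 ^+ a - c * v i0 ^+ b) ^+ l.
Proof. by rewrite /edge mevalZ rmorphXn rmorphB /= mevalZ !rmorphXn /= !mevalXU. Qed.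

(** On the curve [y^a = c x^b] only the term that differentiates all [l] factors survives. In
    characteristic 0 its value is nonzero as soon as [v i1] is. *)
Lemma meval_iter_edge v : v i1 ^+ a - c * v i0 ^+ b = 0 ->
  (iter l (mderiv i1) (edge a b l c e)).@[v] = e * (l`!%:R * (a%:R * v i1 ^+ a.-1) ^+ l).
Proof.
move=> v0; have [s Es] := iter_mderiv_exp i1 ('X_i1 ^+ a - c *: 'X_i0 ^+ b) (leqnn l).
rewrite -mderivn_iter linearZ /= mderivn_iter Es subnn expr0 mul1r ffactnn.
rewrite mevalZ mevalD !mevalM -mpolyC_nat mevalC rmorphXn /=.
rewrite [(_ - _).@[v]]rmorphB /= mevalZ !rmorphXn /= !mevalXU v0 mul0r addr0.
congr (_ * (_ * _ ^+ _)); rewrite mderivB mderivZ.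
case: b b2 => // b' _; case: a lt_ba => // a' _.
rewrite !mderiv_exp !mderivXU /= mulr0 scaler0 subr0 mulr1.
by rewrite mevalM -mpolyC_nat mevalC rmorphXn /= mevalXU.
Qed.

Lemma edge_form_le m : p@_m != 0 -> (b * m i1 + a * m i0 <= l * (a * b))%N.
Proof.
move=> pm; have [E0|] := eqVneq ((edge a b l c e)@_m) 0; last by move/edge_hom->.
by apply/ltnW/pform; rewrite mcoeffB E0 subr0.
Qed.

Lemma edge_form_coef1 : p@_(U_(i1) *+ (l * a)) = e.
Proof.
have -> : p@_(U_(i1) *+ (l * a)) = (edge a b l c e)@_(U_(i1) *+ (l * a)).
  apply/eqP; rewrite -subr_eq0 -mcoeffB; apply/negPn/negP => /pform.
  by rewrite !mulmnE !mnm1E /=; lia.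
rewrite mcoeffZ [(l * a)%N]mulnC mulmnA.
have h : (mlead ('X_i1 ^+ a - c *: 'X_i0 ^+ b : {mpoly K[2]}) <= (U_(i1) *+ a)%MM)%O.
  apply: le_trans (mleadB_le _ _) _; rewrite leUx; apply/andP; split.
    by apply: le_trans (mleadX_le _ _) _; rewrite mleadXm.
  apply: le_trans (mleadZ_le _ _) _; apply: le_trans (mleadX_le _ _) _.
  by rewrite mleadXm; apply/ltW/lt_mdeg_ltmc; rewrite !mdegMn !mdeg1; lia.
rewrite mcoeffXW // mcoeffB mcoeffZ !mcoeffXn eqxx.
case: eqP => [/(congr1 (fun m : 'X_{1..2} => m i0))|_]; first by rewrite !mulmnE !mnm1E /=; lia.
by rewrite mulr0 subr0 expr1n mulr1.
Qed.

Lemma edge_form_coef0 : p@_(U_(i0) *+ (l * b)) = e * (- c) ^+ l.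
Proof.
have -> : p@_(U_(i0) *+ (l * b)) = (edge a b l c e)@_(U_(i0) *+ (l * b)).
  apply/eqP; rewrite -subr_eq0 -mcoeffB; apply/negPn/negP => /pform.
  by rewrite !mulmnE !mnm1E /=; lia.
rewrite mcoeffZ; congr (_ * _); set z := _ - _.
(* The difference of the two [l]-th powers is divisible by ['X_i1 ^+ a], so it has no monomial in
   [x] alone. *)
have -> : z ^+ l = (z ^+ l - (- c *: 'X_i0 ^+ b) ^+ l) + (- c) ^+ l *: 'X_i0 ^+ (b * l).
  by rewrite exprZn -exprM subrK.
rewrite mcoeffD subrXX mcoeffZ mcoeffXn [(l * b)%N]mulnC eqxx mulr1 [X in X + _](_ : _ = 0) ?add0r //.
apply/eqP/negPn/negP => /msuppM_ex[m1 [m2 []]].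
rewrite /z scaleNr opprK subrK mcoeffXn => /(congr1 (fun m : 'X_{1..2} => m i1)).
case: (_ =P m1) => [<-|_]; last by rewrite eqxx.
by rewrite !(mnmDE, mulmnE) !mnm1E /=; lia.
Qed.

(* If [b lead G] and [a lead F] differ, a single extremal monomial of [p] gives the
   leading monomial of [q].  If they agree, the edge of [p] gives the leading term
   unless the leading coefficients of [F] and [G] lie on the curve
   [y^a = c x^b]; then the [l]-th derivative of [p] in [y] has an edge that does not
   vanish there, and [deriv_lead] bounds [lead q] from below. *)
Lemma lead_lower_bound :
  ((mlead F *+ (l * a))%MM <= mlead q)%O \/ (forall N, mlead q = (U_(i1) *+ N)%MM -> (l * a < N)%N).
Proof.
set mu := mlead F; set nu := mlead G.
have [F0 G0] : mu != 0%MM /\ nu != 0%MM by apply/andP/(jac_nonconst kap0 jac).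
case: (ltgtP (nu *+ b)%MM (mu *+ a)%MM) => [lt|gt|eq].
- left; apply: coef_neq0_le_mlead; rewrite /q.
  apply: (@comp_dominant _ F G _ kap0 jac _ (U_(i1) *+ (l * a))%MM).
  + by rewrite edge_form_coef1.
  + by rewrite !mulmnE !mnm1E mul1n mul0n mulm0n addm0.
  move=> k' /edge_form_le le ne; apply: weight_dominated lt le _ => //; first by lia.
  apply/implyP => /eqP k0; apply: contraNneq ne => k1; apply/eqP/mnmP.
  by elim/ord2P; rewrite mulmnE mnm1E ?k0 ?k1 ?mul1n.
- left; apply: le_trans (_ : ((nu *+ (l * b))%MM <= _)%O).
    by rewrite ![(l * _)%N]mulnC !mulmnA; apply/lemc_mul2r/ltW.
  apply: coef_neq0_le_mlead; rewrite /q.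
  apply: (@comp_dominant _ F G _ kap0 jac _ (U_(i0) *+ (l * b))%MM).
  + by rewrite edge_form_coef0 mulf_neq0 ?expf_neq0 ?oppr_eq0.
  + by rewrite !mulmnE !mnm1E mul1n mul0n mulm0n add0m.
  move=> k' /edge_form_le le ne; rewrite addmC.
  apply: weight_dominated gt _ _ => //; try lia.
  apply/implyP => /eqP k1; apply: contraNneq ne => k0; apply/eqP/mnmP.
  by elim/ord2P; rewrite mulmnE mnm1E ?k0 ?k1 ?mul1n.
have eqi i : (nu i * b = mu i * a)%N.
  by have := congr1 (fun m : 'X_{1..2} => m i) eq; rewrite !mulmnE.
(* Since [a] and [b] are coprime, [nu *+ b = mu *+ a] makes [mu] and [nu] the multiples by [b] and
   by [a] of a common monomial. *)
pose d : 'X_{1..2} := [multinom (mu i %/ b)%N | i < 2].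
have bmu i : (mu i = d i * b)%N.
  rewrite mnmE divnK // -(@Gauss_dvdl _ _ a) 1?coprime_sym //.
  by rewrite -eqi dvdn_mull.
have Emu : mu = (d *+ b)%MM by apply/mnmP => i; rewrite mulmnE bmu.
have Enu : nu = (d *+ a)%MM.
  by apply/mnmP => i; rewrite mulmnE; have := eqi i; rewrite bmu; nia.
have d0 : d != 0%MM by apply: contraNneq F0 => d0; apply/eqP/mnmP => i; rewrite bmu d0 mnm0E.
have hF : (mlead F <= (d *+ b)%MM)%O by rewrite -Emu.
have hG : (mlead G <= (d *+ a)%MM)%O by rewrite -Enu.
set f := F@_(d *+ b); set g := G@_(d *+ a).
have f0 : f != 0 by rewrite /f -Emu mleadc_eq0; apply: contraNneq F0; rewrite /mu => ->; rewrite mlead0.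
pose low := p - edge a b l c e.
have Ep : p = edge a b l c e + low by rewrite addrC subrK.
have [E0|E0] := eqVneq (f ^+ a - c * g ^+ b) 0; last first.
  left; rewrite Emu -mulmnA mulnCA [(b * a)%N]mulnC.
  apply: coef_neq0_le_mlead; rewrite /q Ep rmorphD /= mcoeffD.
  rewrite (comp_weight_low hF hG d0 pform) addr0 (comp_weight_hom hF hG edge_hom).
  rewrite [X in X != 0]meval_edge /= -/f -/g.
  by rewrite mulf_neq0 ?expf_neq0.
right => N Eq.
have : (iter l (mderiv i1) p \mPo t)@_(d *+ (l * (a * b) - l * b)) != 0.
  have shift m : (b * (m + U_(i1) *+ l)%MM i1 + a * (m + U_(i1) *+ l)%MM i0 = b * m i1 + a * m i0 + l * b)%N.
    by rewrite !mnmDE !mulmnE !mnm1E /= mul0n mul1n addn0 mulnDr addnAC (mulnC b l).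
  rewrite -mderivn_iter Ep linearD /= rmorphD /= mcoeffD !mderivn_iter.
  rewrite (@comp_weight_low _ F G d a b hF hG (iter l _ low)) //; last first.
    by move=> m /mcoeff_iter_deriv/pform; rewrite shift ltn_subRL addnC.
  rewrite addr0 (@comp_weight_hom _ F G d a b hF hG (iter l _ (edge a b l c e))); last first.
    by move=> m /mcoeff_iter_deriv/edge_hom; rewrite shift => <-; rewrite addnK.
  rewrite [X in X != 0]meval_iter_edge //= -/f.
  apply: mulf_neq0 => //; apply: mulf_neq0; first by rewrite pnatr_eq0 -lt0n fact_gt0.
  by apply/expf_neq0/mulf_neq0; [rewrite pnatr_eq0 -lt0n (ltn_trans _ lt_ba) // ltnW | exact: expf_neq0].
move/(deriv_lead kap0 jac); rewrite -/q Eq -/nu Enu => le.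
have D0 : (0 < mdeg d)%N by rewrite lt0n mdeg_eq0.
have := lemc_mdeg le; rewrite !(mdegD, mdegMn) !mdeg1 => led.
rewrite ltnNge; apply/negP => leN.
have [|EN E1] := edge_arith b2 lt_ba l0 D0 _ leN; first by rewrite mul1n in led.
(* The degrees of the two sides of [le] agree, so the order compares the exponents of [x], and there
   the left side is too large. This excludes even [N = l * a]. *)
have ED : mdeg (d *+ (l * (a * b) - l * b) + (U_(i0) + U_(i1)) *+ l)%MM
    = mdeg (U_(i1) *+ N + d *+ a *+ l)%MM.
  apply/eqP; rewrite eqn_leq; apply/andP; split; first exact: lemc_mdeg.
  by rewrite !(mdegD, mdegMn) !mdeg1 EN E1; apply: edge_arith1.
have := lemc_fst ED le; rewrite !(mnmDE, mulmnE) !mnm1E /= mul0n add0n addn0 mul1n.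
by rewrite leqNgt edge_arith0.
Qed.

(** In the equality case the bound reads [mlead F <= U_(i1)]. As [U_(i1)] is the least monomial
    other than 1 and the Jacobian keeps [F] from being constant, equality follows. *)
Theorem edge_form_lower_bound N : mlead q = (U_(i1) *+ N)%MM ->
  (l * a <= N)%N /\ (N = (l * a)%N -> mlead F = U_(i1)%MM).
Proof.
move=> Eq; have la0 : (0 < l * a)%N by rewrite muln_gt0 l0; lia.
have [F0 _] := andP (jac_nonconst kap0 jac).
have dF : (0 < mdeg (mlead F))%N by rewrite lt0n mdeg_eq0.
case: lead_lower_bound => [|/(_ N Eq)]; last by lia.
rewrite Eq => le; have := lemc_mdeg le; rewrite !mdegMn mdeg1 => led.
have laN : (l * a <= N)%N by rewrite mul1n in led; apply: leq_trans led; rewrite leq_pmull.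
split=> // EN; rewrite EN lemc_mul2rE // in le.
apply/le_anti; rewrite le andTb.
have /mdeg1P[i /eqP Ei] : mdeg (mlead F) == 1%N by rewrite EN in led; apply/eqP; nia.
move: le; rewrite Ei; elim/ord2P: i {Ei} => //.
by move/(lemc_fst (etrans (mdeg1 i0) (esym (mdeg1 i1)))); rewrite !mnm1E.
Qed.
End EdgeLowerBound.

(** * Weighted leading forms of a parametrized fiber *)

(* In [f : {poly {poly K}}] the outer variable ['X] stands for [x] and the inner
   one ['Y] for [y]. *)
Section Grading.
Variables (K : fieldType) (wx wy : nat).
Implicit Types f g : {poly {poly K}}.

(* Substituting [x t^wx] and [y t^wy] for [x] and [y] is a ring morphism, so that
   multiplicativity of weighted leading forms is that of [lead_coef] in [t]. *)
Definition gr_inner : {poly K} -> {poly {poly {poly K}}} :=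
  horner_eval ('Y%:P * 'X^wy) \o map_poly (polyC \o polyC \o polyC).
HB.instance Definition _ := GRing.RMorphism.on gr_inner.

Definition gr : {poly {poly K}} -> {poly {poly {poly K}}} :=
  horner_eval ('X%:P * 'X^wx) \o map_poly gr_inner.
HB.instance Definition _ := GRing.RMorphism.on gr.

Definition top_form f := lead_coef (gr f).
Definition wdeg f := (size (gr f)).-1.

Lemma gr_innerE c : gr_inner c = \sum_(j < size c) (c`_j *: 'X^j)%:P%:P * 'X^(wy * j).
Proof.
rewrite /gr_inner /= /horner_eval horner_coef size_map_inj_poly ?rmorph0 //; last first.
  by move=> x y /= /polyC_inj/polyC_inj/polyC_inj.
apply: eq_bigr => j _; rewrite coef_map /= exprMn -exprM mulrA; congr (_ * _).
by rewrite -!rmorphXn -!rmorphM /= mul_polyC.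
Qed.

Lemma grE f : gr f = \sum_(i < size f) \sum_(j < size f`_i)
   ((f`_i`_j *: 'X^j) *: 'X^i)%:P * 'X^(wx * i + wy * j).
Proof.
rewrite /gr /= /horner_eval (@horner_coef_wide _ (size f)) ?size_poly //.
apply: eq_bigr => i _; rewrite coef_map /= gr_innerE mulr_suml; apply: eq_bigr => j _.
rewrite exprMn -exprM exprD -!rmorphXn /= -[_ *: 'X^i]mul_polyC rmorphM /=; ring.
Qed.

Lemma coef_gr f k i j :
  ((gr f)`_k)`_i`_j = if (wx * i + wy * j == k)%N then f`_i`_j else 0.
Proof.
have E i' j' : ((((f`_i'`_j' *: 'X^j') *: 'X^i')%:P * 'X^(wx * i' + wy * j'))`_k)`_i`_j
    = if (wx * i' + wy * j' == k)%N then f`_i'`_j' *+ (i' == i) *+ (j' == j) else 0.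
  rewrite coefCM coefXn eq_sym; case: eqP => _; last by rewrite mulr0 !coef0.
  rewrite mulr1 coefZ coefXn eq_sym; case: eqP => _; last by rewrite mulr0 coef0 mul0rn.
  by rewrite mulr1 coefZ coefXn eq_sym mulr1n; case: eqP; rewrite ?mulr1 ?mulr0.
rewrite grE !coef_sum.
under eq_bigr => i' _ do (rewrite !coef_sum; under eq_bigr => j' _ do rewrite E).
have [lti|lei] := ltnP i (size f); last first.
  rewrite (nth_default 0 lei) coef0 if_same big1 // => i' _; rewrite big1 // => j' _.
  by rewrite (_ : (i' == i :> nat) = false) ?mulr0n ?mul0rn ?if_same //;
    apply/negbTE; rewrite neq_ltn (leq_trans (ltn_ord i') lei).
rewrite (bigD1 (Ordinal lti)) //= [X in _ + X]big1 ?addr0; last first.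
  move=> i' ne; rewrite big1 // => j' _; rewrite (_ : (i' == i :> nat) = false) ?mulr0n ?mul0rn ?if_same //.
  by apply: contraNF ne => /eqP h; apply/eqP/val_inj.
have [ltj|lej] := ltnP j (size f`_i); last first.
  rewrite (nth_default 0 lej) if_same big1 // => j' _.
  by rewrite (_ : (j' == j :> nat) = false) ?mulr0n ?if_same //;
    apply/negbTE; rewrite neq_ltn (leq_trans (ltn_ord j') lej).
rewrite (bigD1 (Ordinal ltj)) //= [X in _ + X]big1 ?addr0 ?eqxx ?mulr1n //.
move=> j' ne; rewrite (_ : (j' == j :> nat) = false) ?mulr0n ?if_same //.
by apply: contraNF ne => /eqP h; apply/eqP/val_inj.
Qed.

Lemma gr_eq0 f : (gr f == 0) = (f == 0).
Proof.
apply/eqP/eqP => [gr0|->]; last exact: rmorph0.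
apply/polyP => i; apply/polyP => j; rewrite !coef0.
by have := coef_gr f (wx * i + wy * j) i j; rewrite eqxx gr0 !coef0.
Qed.

Lemma wdegP f k : reflect (forall i j, f`_i`_j != 0 -> (wx * i + wy * j <= k)%N)
  (size (gr f) <= k.+1)%N.
Proof.
apply: (iffP idP) => [le i j nz|le].
  rewrite leqNgt; apply: contraNN nz => lt.
  have := coef_gr f (wx * i + wy * j) i j; rewrite eqxx => <-.
  by rewrite [(gr f)`_ _]nth_default ?coef0 // (leq_trans le).
apply/leq_sizeP => n len; apply/polyP => i; apply/polyP => j; rewrite coef_gr !coef0.
case: eqP => // En; apply/eqP; apply: contraTT len => /le; lia.
Qed.

Lemma coef_le_wdeg f i j : f`_i`_j != 0 -> (wx * i + wy * j <= wdeg f)%N.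
Proof. by apply/wdegP; rewrite leqSpred. Qed.

Lemma coef_top_form f i j :
  (top_form f)`_i`_j = if (wx * i + wy * j == wdeg f)%N then f`_i`_j else 0.
Proof. by rewrite /top_form lead_coefE coef_gr. Qed.

Lemma top_form_eq0 f : (top_form f == 0) = (f == 0).
Proof. by rewrite lead_coef_eq0 gr_eq0. Qed.

Lemma top_formM f g : top_form (f * g) = top_form f * top_form g.
Proof. by rewrite /top_form rmorphM lead_coefM. Qed.

Lemma top_formX f n : top_form (f ^+ n) = top_form f ^+ n.
Proof. by rewrite /top_form rmorphXn lead_coef_exp. Qed.

Lemma gr_homogP f k :
  (forall i j, f`_i`_j != 0 -> (wx * i + wy * j = k)%N) <-> gr f = f%:P * 'X^k.
Proof.
have E n i j : (((f%:P * 'X^k)`_n)`_i`_j) = if n == k then f`_i`_j else 0.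
  by rewrite coefCM coefXn; case: eqP => _; rewrite ?mulr1 // mulr0 !coef0.
split=> [h|h i j nz].
  apply/polyP => n; apply/polyP => i; apply/polyP => j; rewrite coef_gr E.
  have [->|/h ->] := eqVneq (f`_i`_j) 0; first by rewrite !if_same.
  by rewrite eq_sym.
have := coef_gr f (wx * i + wy * j) i j; rewrite eqxx h E.
by case: eqP => // _ nz0; rewrite -nz0 eqxx in nz.
Qed.

Lemma gr_inner_const c : gr c%:P = gr_inner c.
Proof. by rewrite /gr /= /horner_eval map_polyC hornerC. Qed.

Lemma grC c : gr c%:P%:P = c%:P%:P%:P.
Proof. by rewrite gr_inner_const /gr_inner /= /horner_eval map_polyC hornerC. Qed.

Lemma size_gr_const c : (size (gr c%:P) <= (wy * (size c).-1).+1)%N.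
Proof.
apply/wdegP => i j; rewrite coefC; case: (i =P 0%N) => [->|_]; last by rewrite coef0 eqxx.
rewrite muln0 add0n => nz; rewrite leq_mul2l; apply/orP; right.
by rewrite -ltnS (leq_trans _ (leqSpred _)) // ltnNge; apply: contraNN nz => /(nth_default 0)->.
Qed.

Lemma top_form_const c : (0 < wy)%N ->
  top_form c%:P = (lead_coef c *: 'X^((size c).-1))%:P.
Proof.
move=> wy0; have [->|c0] := eqVneq c 0.
  by rewrite lead_coef0 scale0r /top_form rmorph0 lead_coef0.
have W : wdeg c%:P = (wy * (size c).-1)%N.
  apply/eqP; rewrite eqn_leq; apply/andP; split.
    by rewrite -ltnS prednK ?size_gr_const // lt0n size_poly_eq0 gr_eq0 polyC_eq0.
  have := @coef_le_wdeg c%:P 0 (size c).-1; rewrite coefC /= muln0; apply.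
  by rewrite -lead_coefE lead_coef_eq0.
apply/polyP => i; apply/polyP => j; rewrite coef_top_form W !coefC.
case: (i =P 0%N) => [->|_]; last by rewrite coef0 if_same.
rewrite muln0 add0n eqn_pmul2l // coefZ coefXn.
by case: eqP => [->|_]; rewrite ?mulr1 ?mulr0 // lead_coefE.
Qed.
End Grading.

(** * Integral equations over [K[u]] *)

Section Integral.
Variable K : fieldType.
Implicit Types u v psi : {poly K}.

Lemma low_coef_sum n (f : {poly K}) : (size f <= n)%N -> f = \sum_(j < n) f`_j *: 'X^j.
Proof.
move=> le; rewrite -poly_def; apply/polyP => j; rewrite coef_poly; case: ltnP => // h.
by rewrite nth_default // (leq_trans le).
Qed.

(** Repeated Euclidean division by [u]: the remainder gives the constant terms of the [r j], and the
    quotient, whose degree is smaller by [n.+1], gives the rest. *)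
Lemma expand_in_powers u n (f : {poly K}) : size u = n.+2 ->
  exists r : 'I_n.+1 -> {poly K}, f = \sum_j (r j \Po u) * 'X^j /\
    forall j i, (r j)`_i != 0 -> (n.+1 * i + j <= (size f).-1)%N.
Proof.
move=> su; have u0 : u != 0 by rewrite -size_poly_gt0 su.
have [k] := ubnP (size f); elim: k f => // k IH f /ltnSE le_fk.
have [ltf|lef] := ltnP (size f) n.+2.
  exists (fun j => (f`_j)%:P); split=> [|j i].
    rewrite [LHS](low_coef_sum (n := n.+1)) //.
    by apply: eq_bigr => j _; rewrite comp_polyC mul_polyC.
  rewrite coefC; case: (i =P 0%N) => [->|_]; last by rewrite eqxx.
  rewrite muln0 add0n => nz; rewrite -ltnS (leq_trans _ (leqSpred _)) //.
  by rewrite ltnNge; apply: contraNN nz => /(nth_default 0)->.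
have f0 : f != 0 by rewrite -size_poly_gt0 (leq_trans _ lef).
have sq : size (f %/ u) = (size f - n.+1)%N by rewrite size_divp // su.
have [|r [Er hr]] := IH (f %/ u); first by rewrite sq; lia.
exists (fun j => r j * 'X + ((f %% u)`_j)%:P); split=> [|j i].
  rewrite [LHS](divp_eq f u) Er mulr_suml.
  rewrite [X in _ + X](low_coef_sum (n := n.+1)); last by rewrite -ltnS -su ltn_modp.
  rewrite -big_split /=; apply: eq_bigr => j _.
  by rewrite comp_polyD comp_polyM comp_polyX comp_polyC mulrDl mul_polyC mulrAC.
rewrite coefD coefMX coefC; case: (i =P 0%N) => [->|/eqP i0] /=.
  by move=> _; rewrite muln0 add0n; apply: leq_trans (ltnW (ltn_ord j)) _;
    rewrite -ltnS prednK ?(leq_trans _ lef) // ltnW.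
case: i i0 => // i _; rewrite addr0 /= => /hr; rewrite sq mulnS.
by move: (n.+1 * i)%N (size f) (nat_of_ord j) lef; clear; lia.
Qed.

(* [S] is the characteristic polynomial of the multiplication by [psi] on the free
   [K[u]]-module [K[t]] of basis [1, t, .., t^n]. *)
Lemma integral_equation u psi n D : size u = n.+2 -> (size psi <= D.+1)%N ->
  exists S : {poly {poly K}}, [/\ S \is monic, size S = n.+2,
    (map_poly (comp_poly u) S).[psi] = 0 &
    forall i j, S`_i`_j != 0 -> (D * i + n.+1 * j <= n.+1 * D)%N].
Proof.
move=> su sD.
have ex (i : 'I_n.+1) : exists r : 'I_n.+1 -> {poly K}, 'X^i * psi = \sum_j (r j \Po u) * 'X^j /\
    forall j k, (r j)`_k != 0 -> (n.+1 * k + j <= D + i)%N.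
  have [r [Er hr]] := expand_in_powers ('X^i * psi) su; exists r; split=> // j k /hr.
  have [->|p0] := eqVneq psi 0; first by rewrite mulr0 size_poly0 /=; lia.
  by rewrite mulrC size_Mmonic ?monicXn // size_polyXn; lia.
have [A HA] := fin_all_exists ex => {ex}.
pose M : 'M[{poly K}]_n.+1 := \matrix_(i, j) A i j.
exists (char_poly M); split; [exact: char_poly_monic|exact: size_char_poly|..].
  rewrite map_char_poly.
  (* Over [K[t]] the column [(1, t, .., t^n)] is an eigenvector for [psi]. Cayley-Hamilton, read at
     the entry 1, makes [psi] a root of the characteristic polynomial. *)
  pose M' := map_mx (comp_poly u) M; pose w : 'cV[{poly K}]_n.+1 := \col_i 'X^i.
  have Mw : M' *m w = psi *: w.
    apply/matrixP => i j; rewrite !mxE mulrC (HA i).1; apply: eq_bigr => k _.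
    by rewrite !mxE.
  have pw (p : {poly {poly K}}) : horner_mx M' p *m w = p.[psi] *: w.
    elim/poly_ind: p => [|p c IH]; first by rewrite rmorph0 mul0mx horner0 scale0r.
    rewrite rmorphD rmorphM /= horner_mx_X horner_mx_C mulmxDl -mulmxA Mw -scalemxAr IH.
    by rewrite mul_scalar_mx hornerMXaddC scalerDl scalerA mulrC.
  have := pw (char_poly M'); rewrite Cayley_Hamilton mul0mx => /matrixP /(_ ord0 ord0).
  by rewrite !mxE expr0 mulr1 => <-.
apply/wdegP; rewrite /char_poly /determinant rmorph_sum.
apply: leq_trans (size_sum _ _ _) _; apply/bigmax_leqP => s _.
rewrite rmorphM rmorph_sign size_Msign rmorph_prod /=.
(* The entry at [(i, j)] has weight at most [D + i - j]. Along a permutation the row and column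
   indices cancel in the sum, which leaves [D] for each row. *)
have szE i j : char_poly_mx M i j != 0 -> (size (gr D n.+1 (char_poly_mx M i j)) + j <= (D + i).+1)%N.
  move=> nz; have wt k l : (char_poly_mx M i j)`_k`_l != 0 -> (D * k + n.+1 * l + j <= D + i)%N.
    rewrite !mxE coefB coefMn coefX coefC coefB coefMn.
    case: k => [|[|k]] /=; rewrite ?coef0 ?mul0rn ?subr0 ?eqxx //.
      by rewrite sub0r oppr_eq0 => /(HA i).2; rewrite muln0 add0n.
    rewrite coefC; case: (l =P 0%N) => [->|_]; last by rewrite mul0rn eqxx.
    by case: (i =P j) => [->|_]; [rewrite muln1 muln0 addn0 | rewrite eqxx].
  have le_j : (j <= D + i)%N.
    have := wt (size (char_poly_mx M i j)).-1 (size (lead_coef (char_poly_mx M i j))).-1.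
    rewrite -!lead_coefE !lead_coef_eq0 => /(_ nz); apply: leq_trans; exact: leq_addl.
  rewrite -(subnK le_j) -addSn leq_add2r; apply/wdegP => k l /wt; rewrite leq_subRL //.
  by rewrite addnC.
have [->|nzp] := eqVneq (\prod_i gr D n.+1 (char_poly_mx M i (s i))) 0; first by rewrite size_poly0.
have nz i : char_poly_mx M i (s i) != 0.
  by move: nzp; rewrite prodf_seq_neq0 => /allP /(_ i (mem_index_enum i)); rewrite gr_eq0.
apply: leq_trans (size_prod_leq _ _) _; rewrite card_ord.
have : (\sum_(i < n.+1) size (gr D n.+1 (char_poly_mx M i (s i))) + \sum_(i < n.+1) i
   <= \sum_(i < n.+1) D.+1 + \sum_(i < n.+1) i)%N.
  rewrite [X in (_ + X <= _)%N](reindex_inj (@perm_inj _ s)) -!big_split /=; apply: leq_sum => i _.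
  by apply: leq_trans (szE _ _ (nz i)) _; rewrite addSn.
by rewrite leq_add2r sum_nat_const card_ord mulnS leq_subLR addnS ltnS.
Qed.
End Integral.

(** * Divisibility from vanishing on the fiber *)

Section Division.
Variable K : closedFieldType.

Lemma horner2E (f : {poly {poly K}}) x y : (map_poly (horner_eval y) f).[x] = f.[x, y].
Proof. by rewrite -{1}(hornerC x y) -/(horner_eval y x%:P) horner_map. Qed.

Lemma poly_vanish (p : {poly K}) : (forall x, p.[x] = 0) -> p = 0.
Proof.
move=> p0; apply/eqP; apply: contraT => /closed_nonrootP[x].
by rewrite /root p0 eqxx.
Qed.

(** Each of the linear factors of [f], counted with multiplicity, divides one copy of [g]. *)
Lemma closed_dvdp_exp (f g : {poly K}) : f != 0 ->
  (forall x, f.[x] = 0 -> g.[x] = 0) -> f %| g ^+ (size f).-1.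
Proof.
move=> f0 fg; have [s Es] := closed_field_poly_normal f.
have l0 : lead_coef f != 0 by rewrite lead_coef_eq0.
have -> : (size f).-1 = size s by rewrite Es size_scale // size_prod_XsubC.
have : all (root g) s.
  apply/allP => x xs; apply/rootP/fg/rootP.
  by rewrite Es rootZ // root_prod_XsubC.
rewrite {1}Es dvdpZl //; elim: s {Es} => [|z s IH] /=; first by rewrite big_nil dvd1p.
case/andP=> gz /IH; rewrite big_cons exprS; apply: dvdp_mul.
by rewrite dvdp_XsubCl.
Qed.

(* The remainder of [R ^+ d] by [f] vanishes at every value of the inner variable
   that keeps the degree of [f], by the Nullstellensatz in one variable. *)
Lemma pseudo_dvd (f R : {poly {poly K}}) : f != 0 ->
  (forall y x, f.[y, x] = 0 -> R.[y, x] = 0) ->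
  exists Q k d, lead_coef f ^+ k *: R ^+ d = Q * f.
Proof.
move=> f0 fR; pose d := (size f).-1.
exists (R ^+ d %/ f), (scalp (R ^+ d) f), d.
rewrite Pdiv.WeakIdomain.divp_eq; apply/eqP; rewrite -subr_eq0 addrAC subrr add0r.
set r := _ %% f; apply/eqP/polyP => i; rewrite coef0.
have l0 : lead_coef f != 0 by rewrite lead_coef_eq0.
(* The factor [lead_coef f] takes care of the values of the inner variable at which the degree of
   [f] drops. *)
suff : lead_coef f * r`_i = 0 by move/eqP; rewrite mulf_eq0 (negPf l0) => /eqP.
apply: poly_vanish => x; rewrite hornerM; have [->|lx] := eqVneq (lead_coef f).[x] 0.
  by rewrite mul0r.
pose e := map_poly (horner_eval x).
have sf : size (e f) = size f by rewrite /e size_poly_eq.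
suff -> : (r`_i).[x] = 0 by rewrite mulr0.
have -> : (r`_i).[x] = (e r)`_i by rewrite /e coef_map.
suff -> : e r = 0 by rewrite coef0.
have ef0 : e f != 0 by rewrite -size_poly_gt0 sf size_poly_gt0.
have dv : e f %| e R ^+ d.
  by rewrite /d -sf; apply: closed_dvdp_exp => // y; rewrite !horner2E; apply: fR.
have Ee : (lead_coef f).[x] ^+ scalp (R ^+ d) f *: e R ^+ d = e (R ^+ d %/ f) * e f + e r.
  rewrite -rmorphXn -rmorphM -rmorphD -Pdiv.WeakIdomain.divp_eq /e.
  by rewrite -!mul_polyC rmorphM /= map_polyC /= /horner_eval horner_exp.
have : e f %| e r.
  by rewrite -(dvdp_addr _ (dvdp_mulIr (e (R ^+ d %/ f)) _)) -Ee dvdpZr // expf_neq0.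
apply: contraTeq => er0; apply/negP => /(dvdp_leq er0).
rewrite sf leqNgt => /negP; apply; apply: leq_ltn_trans (size_poly _ _) _.
by rewrite ltn_modp.
Qed.
End Division.

(** * The zeros of the weighted leading form *)

Section Edge.
Variable K : closedFieldType.
Implicit Types f g : {poly {poly K}}.

Definition binomialXY (A B : nat) (c : K) : {poly {poly K}} := 'X^A - c%:P *: 'Y ^+ B.

Lemma horner_binomialXY A B c x y : (binomialXY A B c).[x, y] = x ^+ A - c * y ^+ B.
Proof. by rewrite /binomialXY !(hornerD, hornerN, hornerZ, hornerM, horner_exp, hornerC, hornerX). Qed.

Lemma gr_binomialXY (wx wy A B : nat) c : (wx * A = wy * B)%N ->
  gr wx wy (binomialXY A B c) = (binomialXY A B c)%:P * 'X^(wx * A).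
Proof.
move=> E; apply/gr_homogP => i j; rewrite /binomialXY -rmorphXn coefB coefXn coefZ coefC coefB.
case: (i =P A) => [->|_]; [case: (A =P 0%N) => [i0|_] | case: (i =P 0%N) => [i0|_]];
  rewrite ?(coef0, coef1, mulr0, sub0r, subr0) ?eqxx //=.
- rewrite coefCM coefXn i0; case: (j =P 0%N) => [->|_]; first by rewrite !muln0.
  by case: (j =P B) => [->|_]; [rewrite -E i0 muln0 | rewrite mulr0 subrr eqxx].
- by case: (j =P 0%N) => [->|_]; rewrite ?eqxx // muln0 addn0.
- rewrite coefCM coefXn i0; case: (j =P B) => [->|_]; first by rewrite muln0 E.
  by rewrite mulr0 oppr0 eqxx.
- by rewrite oppr0 eqxx.
Qed.

Lemma binomialXY_neq0 A B c : (0 < A)%N -> binomialXY A B c != 0.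
Proof.
move=> A0; apply/eqP => /polyP /(_ A); rewrite /binomialXY -rmorphXn coefB coefXn eqxx coefZ coefC coef0.
by rewrite gtn_eqF // mulr0 subr0 => /eqP; rewrite oner_eq0.
Qed.

Lemma horner_comp2 (S Z : {poly {poly K}}) x y : (S \Po Z).[x, y] = S.[Z.[x, y], y].
Proof.
elim/poly_ind: S => [|S d IH]; first by rewrite comp_poly0 !horner0.
rewrite comp_polyD comp_polyM comp_polyX comp_polyC.
by rewrite !(hornerD, hornerM, hornerC, hornerX) IH.
Qed.

Lemma horner_map_comp (S : {poly {poly K}}) (v psi : {poly K}) t :
  (map_poly (comp_poly v) S).[psi].[t] = S.[psi.[t], v.[t]].
Proof.
elim/poly_ind: S => [|S d IH]; first by rewrite rmorph0 !horner0.
rewrite rmorphD rmorphM /= map_polyX map_polyC /=.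
by rewrite !(hornerD, hornerM, hornerC, hornerX) IH horner_comp.
Qed.

Lemma horner2M f g x y : (f * g).[x, y] = f.[x, y] * g.[x, y].
Proof. by rewrite !hornerM. Qed.

Lemma horner2X f n x y : (f ^+ n).[x, y] = f.[x, y] ^+ n.
Proof. by rewrite !horner_exp. Qed.

Lemma weight_arith D m i s d : (i < m)%N -> (s <= (m * d).+1)%N ->
  (D * i + m * d <= m * D)%N -> (s + D.+1 * i <= D.+1 * m)%N.
Proof. by move=> lt le1 le2; rewrite !mulSn; lia. Qed.

(** The constant [c] cancels the two leading terms. This drop of degree is the source of the single
    root of the edge. *)
Lemma size_exp_cancel (u v : {poly K}) A B (c := lead_coef u ^+ A / lead_coef v ^+ B) :
  u != 0 -> v != 0 -> ((size u).-1 * A = (size v).-1 * B)%N ->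
  (size (u ^+ A - c *: v ^+ B)%R <= ((size u).-1 * A).-1.+1)%N.
Proof.
move=> u0 v0 E; have su : size (u ^+ A) = ((size u).-1 * A).+1.
  by rewrite -size_exp prednK // size_poly_gt0 expf_neq0.
have sv : size (v ^+ B) = ((size u).-1 * A).+1.
  by rewrite E -size_exp prednK // size_poly_gt0 expf_neq0.
have lu : (u ^+ A)`_((size u).-1 * A) = lead_coef u ^+ A.
  by rewrite -lead_coef_exp lead_coefE su.
have lv : (v ^+ B)`_((size u).-1 * A) = lead_coef v ^+ B.
  by rewrite -lead_coef_exp lead_coefE sv.
apply/leq_sizeP => j lej; rewrite coefB coefZ.
have [->|] := eqVneq j ((size u).-1 * A)%N.
  by rewrite lu lv divfK ?subrr // expf_neq0 // lead_coef_eq0.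
move=> ne; have lt : ((size u).-1 * A < j)%N by lia.
by rewrite !nth_default ?mulr0 ?subrr // ?su ?sv.
Qed.

(* [S(x^A - c y^B, y)], with [S] the integral equation of [u^A - c v^B] over
   [K[v]], vanishes on the fiber, so [f] divides one of its powers up to a
   polynomial in [y]; its weighted leading form is a power of [x^A - c y^B]. *)
Lemma top_form_zero f (u v : {poly K}) A B (n := (size u).-1) (m := (size v).-1)
    (c := lead_coef u ^+ A / lead_coef v ^+ B) :
    f != 0 -> (0 < n)%N -> (0 < m)%N -> (0 < A)%N -> (n * A = m * B)%N ->
    (forall x y, f.[x, y] = 0 -> exists t, x = u.[t] /\ y = v.[t]) ->
  forall x y, (top_form n m f).[x, y] = 0 -> y = 0 \/ x ^+ A = c * y ^+ B.
Proof.
move=> f0 n0 m0 A0 EAB fuv x0 y0 top0.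
have u0 : u != 0 by rewrite -size_poly_gt0; move: n0; rewrite /n; case: size.
have v0 : v != 0 by rewrite -size_poly_gt0; move: m0; rewrite /m; case: size.
pose psi := u ^+ A - c *: v ^+ B; pose D := (n * A).-1.
have sv : size v = m.-1.+2 by rewrite /m; move: m0; rewrite /m; case: size => [|[]].
have [S [Smon sS Spsi wS]] := integral_equation sv (size_exp_cancel u0 v0 EAB).
rewrite -/n -/D prednK // in sS wS.
pose Z := binomialXY A B c; pose R := S \Po Z.
have fR x y : f.[x, y] = 0 -> R.[x, y] = 0.
  move=> /fuv[t [-> ->]]; rewrite /R horner_comp2 horner_binomialXY.
  have := congr1 (horner^~ t) Spsi; rewrite horner0 horner_map_comp => <-.
  by rewrite /psi hornerD hornerN hornerZ !horner_exp.
have topR : top_form n m R = Z ^+ m.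
  (* The weight of [Z] is [n * A = D.+1], whereas the integral equation is balanced for an unknown
     of weight [D]. The term of index [i] thus has weight at most [m * D + i], below that of
     [Z ^+ m]. *)
  have -> : R = Z ^+ m + \sum_(i < m) (S`_i)%:P * Z ^+ i.
    rewrite /R comp_polyE sS big_ord_recr /= addrC; congr (_ + _).
      by move: Smon; rewrite monicE lead_coefE sS /= => /eqP->; rewrite scale1r.
    by apply: eq_bigr => i _; rewrite mul_polyC.
  have grZ i : gr n m (Z ^+ i) = (Z ^+ i)%:P * 'X^((n * A) * i).
    by rewrite rmorphXn /= (gr_binomialXY c EAB) exprMn -rmorphXn -exprM.
  have Zi0 i : Z ^+ i != 0.
    by rewrite expf_neq0 // binomialXY_neq0.
  rewrite /top_form rmorphD /= lead_coefDl grZ ?lead_coefM ?lead_coefC ?lead_coefXn ?mulr1 //.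
  rewrite size_Cmul // size_polyXn ltnS rmorph_sum.
  apply: leq_trans (size_sum _ _ _) _; apply/bigmax_leqP => i _.
  have [->|Si0] := eqVneq S`_i 0; first by rewrite mul0r rmorph0 size_poly0.
  rewrite rmorphM /= grZ; apply: leq_trans (size_polyMleq _ _) _.
  rewrite size_Cmul // size_polyXn addnS /=.
  have := wS i (size S`_i).-1; rewrite -lead_coefE lead_coef_eq0 => /(_ Si0).
  have := size_gr_const n m S`_i.
  have -> : (n * A = D.+1)%N by rewrite /D prednK // muln_gt0 n0.
  by apply: weight_arith; apply: ltn_ord.
have [Q [k [d E]]] := pseudo_dvd f0 fR.
(* Top forms multiply, and that of [lead_coef f] is a monomial in [y]; this monomial accounts for
   the alternative [y = 0]. *)
have := congr1 (top_form n m) E; rewrite -mul_polyC rmorphXn /= !top_formM !top_formX topR top_form_const //.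
move=> Etop; have /eqP : (top_form n m Q * top_form n m f).[x0, y0] = 0.
  by rewrite horner2M [X in _ * X]top0 mulr0.
rewrite -{}Etop [X in X == 0]horner2M [X in X * _]horner2X [X in _ * X]horner2X.
rewrite [X in _ * X ^+ _]horner2X mulf_eq0 !expf_eq0 => /orP[/andP[_]|/andP[_ /andP[_]]].
  rewrite hornerC hornerZ hornerXn mulf_eq0 !lead_coef_eq0 (negPf f0) expf_eq0 /=.
  by case/andP=> _ /eqP; left.
by rewrite horner_binomialXY subr_eq0 => /eqP; right.
Qed.
End Edge.

Section EdgeForm.
Variable K : closedFieldType.
Implicit Types G H : {poly {poly K}}.

Definition whomog (n m W : nat) G := forall i j, G`_i`_j != 0 -> (n * i + m * j = W)%N.

Lemma whomog_horner1 n m W G i : (0 < m)%N -> whomog n m W G ->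
  (G`_i).[1] = G`_i`_((W - n * i) %/ m).
Proof.
move=> m0 hG; set j0 := (_ %/ m)%N.
have Z j : j != j0 -> G`_i`_j = 0.
  move=> ne; apply/eqP; apply: contraNT ne => /hG E.
  by rewrite /j0 -E addKn mulKn.
rewrite horner_coef; have [lt|le] := ltnP j0 (size G`_i).
  rewrite (bigD1 (Ordinal lt)) //= expr1n mulr1 big1 ?addr0 // => j nej.
  by rewrite Z ?mul0r.
rewrite (nth_default 0 le) big1 // => j _; rewrite Z ?mul0r //.
by rewrite neq_ltn (leq_trans (ltn_ord j) le).
Qed.

(** For a given power of [x] the weight allows a single power of [y], so setting [y = 1] loses
    nothing. *)
Lemma whomog_inj n m W G H : (0 < m)%N -> whomog n m W G -> whomog n m W H ->
  map_poly (horner_eval 1) G = map_poly (horner_eval 1) H -> G = H.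
Proof.
move=> m0 hG hH E; apply/polyP => i; apply/polyP => j.
have [Ej|ne] := eqVneq j ((W - n * i) %/ m)%N.
  rewrite Ej -!whomog_horner1 //.
  by have := congr1 (fun p : {poly K} => p`_i) E; rewrite !coef_map.
have Z F : whomog n m W F -> F`_i`_j = 0.
  move=> hF; apply/eqP; apply: contraNT ne => /hF <-.
  by rewrite addKn mulKn.
by rewrite !Z.
Qed.

Lemma closed_root_all_eq (h : {poly K}) c : h != 0 ->
  (forall z, h.[z] = 0 -> z = c) -> h = lead_coef h *: ('X - c%:P) ^+ (size h).-1.
Proof.
move=> h0 hc; have [s Es] := closed_field_poly_normal h.
have l0 : lead_coef h != 0 by rewrite lead_coef_eq0.
have ss : (size h).-1 = size s by rewrite Es size_scale // size_prod_XsubC.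
rewrite {1}Es ss; congr (_ *: _).
have : all (pred1 c) s.
  by apply/allP => z zs; apply/eqP/hc/rootP; rewrite Es rootZ // root_prod_XsubC.
elim: s {Es ss} => [|z s IH] /=; first by rewrite big_nil expr0.
by case/andP=> /eqP-> /IH; rewrite big_cons exprS => ->.
Qed.

Lemma closed_expr_root A (z : K) : (0 < A)%N -> exists s, s ^+ A = z.
Proof.
move=> A0; have : size ('X^A - z%:P) != 1%N by rewrite size_XnsubC //; case: A A0.
case/closed_rootP=> s /rootP; rewrite hornerD hornerN hornerXn hornerC => /eqP.
by rewrite subr_eq0 => /eqP; exists s.
Qed.

Lemma map_binomialXY A B (c y : K) :
  map_poly (horner_eval y) (binomialXY A B c) = 'X^A - (c * y ^+ B)%:P.
Proof.
rewrite /binomialXY -rmorphXn /= -mul_polyC -polyCM rmorphB /= map_polyXn map_polyC /=.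
by rewrite /horner_eval hornerCM hornerXn.
Qed.

Lemma edge_of_zeros H (A B g W : nat) (c : K) : H != 0 -> (0 < A)%N -> (0 < B)%N -> (0 < g)%N ->
    coprime A B -> c != 0 -> whomog (B * g) (A * g) W H ->
    (forall x y, H.[x, y] = 0 -> x ^+ A = c * y ^+ B) ->
  exists l e, [/\ e != 0, W = (g * (l * (A * B)))%N & H = e%:P *: binomialXY A B c ^+ l].
Proof.
move=> H0 A0 B0 g0 cop c0 hH zero.
(* The curve [x^A = c y^B] meets the axes only at the origin, so neither [y] nor [x] divides [H];
   this provides a pure power of each variable in [H]. *)
have [i1 Hi1] : exists i, H`_i`_0 != 0.
  have P0 : map_poly (horner_eval 0) H != 0.
    apply/eqP => P0; have := zero 1 0; rewrite -horner2E P0 horner0 expr1n expr0n.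
    by rewrite gtn_eqF // mulr0 => /(_ erefl)/eqP; rewrite oner_eq0.
  exists (size (map_poly (horner_eval 0) H)).-1; move: P0; rewrite -lead_coef_eq0 lead_coefE.
  by rewrite coef_map /= /horner_eval horner_coef0.
have [j1 Hj1] : exists j, H`_0`_j != 0.
  exists (size H`_0).-1; rewrite -lead_coefE lead_coef_eq0.
  apply/eqP => P0; have := zero 0 1; rewrite polyC0 horner_coef0 P0 horner0 expr1n expr0n.
  by rewrite gtn_eqF // mulr1 => /(_ erefl)/esym/eqP; rewrite (negPf c0).
have Wi := hH _ _ Hi1; have Wj := hH _ _ Hj1; rewrite muln0 addn0 in Wi; rewrite muln0 add0n in Wj.
have Eij : (B * i1 = A * j1)%N.
  by apply/eqP; rewrite -(eqn_pmul2l g0); apply/eqP; rewrite !mulnA ![(g * _)%N]mulnC Wi Wj.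
have /dvdnP[l El] : (A %| i1)%N by rewrite -(Gauss_dvdr _ cop) Eij dvdn_mulr.
have EW : W = (g * (l * (A * B)))%N by rewrite -Wi El; lia.
exists l.
(* As [A] and [B] are coprime, the monomials of weight [W] are the [x^(A k) y^(B (l - k))], so that
   [H] becomes [h(x^A)] at [y = 1]. Every root of [h] is an [A]-th power, hence equals [c]. *)
pose h := \poly_(k < l.+1) H`_(A * k)`_(B * (l - k)).
have hl : h`_l != 0 by rewrite coef_poly ltnSn subnn muln0 mulnC -El.
have sh : size h = l.+1.
  by apply/eqP; rewrite eqn_leq size_poly ltnNge; apply: contraNN hl => /leq_sizeP ->.
have Eh : map_poly (horner_eval 1) H = h \Po 'X^A.
  apply/polyP => i; rewrite coef_map coef_comp_poly_Xn // /= /horner_eval.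
  rewrite (whomog_horner1 _ _ hH) ?muln_gt0 ?A0 //.
  have Zi j : H`_i`_j != 0 -> exists2 k, i = (A * k)%N & (k <= l)%N /\ j = (B * (l - k))%N.
    move=> /hH; rewrite EW => Eij'.
    have Eij2 : (B * i + A * j = l * (A * B))%N.
      by apply/eqP; rewrite -(eqn_pmul2l g0) -Eij'; apply/eqP; lia.
    have /dvdnP[k Ek] : (A %| i)%N.
      rewrite -(Gauss_dvdr _ cop) -(dvdn_addl _ (dvdn_mulr j (dvdnn A))) Eij2.
      by rewrite mulnCA dvdn_mulr.
    have Ej : (B * k + j = l * B)%N by apply/eqP; rewrite -(eqn_pmul2l A0); apply/eqP; lia.
    have lek : (k <= l)%N by rewrite -(leq_pmul2r B0) -Ej mulnC leq_addr.
    by exists k; [rewrite mulnC | split=> //; rewrite mulnBr [(B * l)%N]mulnC -Ej addKn].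
  case: ifPn => [/dvdnP[k Ei]|ndv]; last first.
    by apply/eqP; apply: contraNT ndv => /Zi[k -> _]; apply: dvdn_mulr.
  subst i; rewrite mulnK // coef_poly ltnS; case: leqP => [lek|ltk]; last first.
    apply/eqP; apply: contraTT ltk => /Zi[k' /eqP].
    by rewrite [(k * _)%N]mulnC eqn_pmul2l // => /eqP-> []; rewrite -leqNgt.
  rewrite [(k * _)%N]mulnC; congr (_`_ _).
  rewrite EW (_ : g * (l * (A * B)) - B * g * (A * k) = A * g * (B * (l - k)))%N ?mulKn ?muln_gt0 ?A0 //.
  by rewrite mulnBr mulnBr; lia.
have hz z : h.[z] = 0 -> z = c.
  have [s <-] := closed_expr_root z A0; move=> hs.
  have := zero s 1; rewrite -horner2E Eh horner_comp hornerXn hs expr1n mulr1; exact.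
have h0 : h != 0 by rewrite -size_poly_gt0 sh.
have := closed_root_all_eq h0 hz; rewrite sh /=; set e := lead_coef h => Ehe.
have e0 : e != 0 by rewrite lead_coef_eq0.
exists e; split=> //.
have hE : whomog (B * g) (A * g) W (e%:P *: binomialXY A B c ^+ l).
  apply/gr_homogP; rewrite -mul_polyC rmorphM /= grC rmorphXn /= gr_binomialXY; last by lia.
  rewrite exprMn -exprM -rmorphXn mulrA -rmorphM; congr (_ * 'X^_); lia.
apply: whomog_inj hH hE _; first by rewrite muln_gt0 A0.
rewrite Eh Ehe comp_polyZ rmorphXn /= comp_polyB comp_polyX comp_polyC.
rewrite -(mul_polyC e%:P) rmorphM rmorphXn /= map_polyC /= [horner_eval _ _]hornerC.
by rewrite map_binomialXY expr1n mulr1 mul_polyC.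
Qed.
End EdgeForm.

(** * The Newton polygon of a parametrized polynomial *)

Section Structure.
Variable K : closedFieldType.
Implicit Types f : {poly {poly K}}.

Definition param2 f (u v : {poly K}) :=
  forall x y, f.[x, y] = 0 <-> exists t, x = u.[t] /\ y = v.[t].

Definition parametrized f := exists u v, param2 f u v.

Definition line_type f := exists (e g : K) k, [/\ e != 0, (0 < k)%N &
  f = e%:P *: ('X - g%:P%:P) ^+ k].

Definition edge_type A B l c e f :=
  [/\ [/\ (0 < A)%N, (0 < B)%N, (0 < l)%N & coprime A B], c != 0, e != 0 &
   forall i j, (f - e%:P *: binomialXY A B c ^+ l)`_i`_j != 0 -> (B * i + A * j < l * (A * B))%N].

Lemma param2_swap f u v : param2 f u v -> param2 (swapXY f) v u.
Proof.
by move=> h x y; rewrite horner2_swapXY h; split=> -[t [? ?]]; exists t.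
Qed.

Lemma parametrized_swap f : parametrized f -> parametrized (swapXY f).
Proof. by case=> u [v /param2_swap h]; exists v, u. Qed.

(** For [x] other than the constant [g], the polynomial [f(x, y)] in [y] has no root and is
    therefore constant. So the coefficients of positive powers of [y] vanish, and [f] is a
    polynomial in [x] with the only root [g]. *)
Lemma line_of_const f u v : param2 f u v -> (size u <= 1)%N -> line_type f.
Proof.
move=> h /size1_polyC; set g := u`_0 => Eu; pose F := swapXY f.
have FS j : (0 < j)%N -> F`_j = 0.
  move=> j0; suff : F`_j * ('X - g%:P) = 0.
    by move/eqP; rewrite mulf_eq0 polyXsubC_eq0 orbF => /eqP.
  apply: poly_vanish => x; rewrite hornerM hornerXsubC.
  have [->|ne] := eqVneq x g; first by rewrite subrr mulr0.
  have : ~~ (size f.[x%:P] != 1%N).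
    apply/closed_rootP => -[y /rootP /h[t [Ex _]]].
    by rewrite Ex Eu hornerC eqxx in ne.
  rewrite negbK => /size_poly1P[d _ Ed].
  have : (f.[x%:P])`_j = 0 by rewrite Ed coefC gtn_eqF.
  by rewrite -[f]swapXYK horner_swapXY coef_map /= /horner_eval => ->; rewrite mul0r.
have EF : F = (F`_0)%:P.
  by apply/polyP => -[|j]; rewrite coefC //= FS.
set p := F`_0 in EF.
have Ep x y : f.[x, y] = p.[x] by rewrite -[f]swapXYK horner2_swapXY -/F EF hornerC.
have px x : p.[x] = 0 -> x = g.
  by rewrite -(Ep x 0) => /h[t [-> _]]; rewrite Eu hornerC.
have p0 : p != 0.
  apply/eqP => p0; have := px (g + 1); rewrite p0 horner0 => /(_ erefl)/eqP.
  by rewrite -subr_eq0 addrAC subrr add0r oner_eq0.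
have pg : p.[g] = 0 by rewrite -(Ep g v.[0]); apply/h; exists 0; rewrite Eu hornerC.
exists (lead_coef p), g, (size p).-1; split; first by rewrite lead_coef_eq0.
  by have := root_size_gt1 p0 (introT rootP pg); case: size => [|[]].
rewrite -[f]swapXYK -/F EF swapXY_polyC {1}(closed_root_all_eq p0 px).
rewrite -mul_polyC rmorphM rmorphXn /= map_polyC /= rmorphB /= map_polyX map_polyC.
by rewrite mul_polyC.
Qed.

(** The points of the curve with [x = 0] come from the finitely many roots of [u], whereas the fiber
    of 0 contains the whole line. *)
Lemma param2_neq0 f u v : param2 f u v -> (1 < size u)%N -> f != 0.
Proof.
move=> h su; apply/eqP => f0; have u0 : u != 0 by rewrite -size_poly_gt0 ltnW.
have [s Es] := closed_field_poly_normal u.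
have : \prod_(z <- [seq v.[z] | z <- s]) ('X - z%:P) = 0.
  apply: poly_vanish => y; apply/rootP; rewrite root_prod_XsubC.
  have [t [Et ->]] : exists t, 0 = u.[t] /\ y = v.[t] by apply/h; rewrite f0 !horner0.
  have : root u t by apply/rootP.
  by rewrite Es rootZ ?lead_coef_eq0 // root_prod_XsubC => /(map_f (horner v)).
by move/eqP; rewrite prodf_seq_eq0 => /hasP[z _]; rewrite polyXsubC_eq0.
Qed.

Lemma wdeg_swap n m f : wdeg m n (swapXY f) = wdeg n m f.
Proof.
have le n' m' f' : f' != 0 -> (wdeg m' n' (swapXY f') <= wdeg n' m' f')%N.
  move=> f0; rewrite -ltnS prednK ?size_poly_gt0 ?gr_eq0 ?swapXY_eq0 //.
  by apply/wdegP => i j; rewrite coef_swapXY addnC; apply: coef_le_wdeg.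
have [->|f0] := eqVneq f 0; first by rewrite rmorph0 /wdeg !rmorph0.
by apply/eqP; rewrite eqn_leq le // -{1}[f]swapXYK le // swapXY_eq0.
Qed.

Lemma top_form_swap n m f : top_form m n (swapXY f) = swapXY (top_form n m f).
Proof.
apply/polyP => i; apply/polyP => j.
by rewrite coef_swapXY !coef_top_form coef_swapXY wdeg_swap addnC.
Qed.

(* The third case says that the Newton polygon of [f] is a triangle whose
   slanted edge carries a single root. *)
Theorem param_structure f : parametrized f ->
  [\/ line_type f, line_type (swapXY f) | exists A B l c e, edge_type A B l c e f].
Proof.
case=> u [v h]; have [su|su] := leqP (size u) 1; first by constructor 1; apply: line_of_const h su.
have [sv|sv] := leqP (size v) 1; first by constructor 2; apply: line_of_const (param2_swap h) sv.
constructor 3.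
have f0 := param2_neq0 h su.
pose n := (size u).-1; pose m := (size v).-1; pose g := gcdn n m.
have n0 : (0 < n)%N by rewrite /n; lia.
have m0 : (0 < m)%N by rewrite /m; lia.
have g0 : (0 < g)%N by rewrite gcdn_gt0 n0.
pose A := (m %/ g)%N; pose B := (n %/ g)%N.
have En : n = (B * g)%N by rewrite divnK // dvdn_gcdl.
have Em : m = (A * g)%N by rewrite divnK // dvdn_gcdr.
have A0 : (0 < A)%N by rewrite divn_gt0 // dvdn_leq // dvdn_gcdr.
have B0 : (0 < B)%N by rewrite divn_gt0 // dvdn_leq // dvdn_gcdl.
have cop : coprime A B.
  by rewrite /coprime -(eqn_pmul2r g0) muln_gcdl -Em -En mul1n gcdnC.
pose c := lead_coef u ^+ A / lead_coef v ^+ B.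
have u0 : lead_coef u != 0 by rewrite lead_coef_eq0 -size_poly_gt0 ltnW.
have v0 : lead_coef v != 0 by rewrite lead_coef_eq0 -size_poly_gt0 ltnW.
have c0 : c != 0 by rewrite mulf_neq0 ?invr_eq0 ?expf_neq0.
pose H := top_form n m f.
have HW : whomog (B * g) (A * g) (wdeg n m f) H.
  by move=> i j; rewrite -En -Em coef_top_form; case: ifP => [/eqP //|_]; rewrite eqxx.
have zero x y : H.[x, y] = 0 -> x ^+ A = c * y ^+ B.
  move=> z; have EAB : (n * A = m * B)%N by rewrite En Em; lia.
  have fuv x' y' : f.[x', y'] = 0 -> exists t, x' = u.[t] /\ y' = v.[t] by move/h.
  (* If [y = 0], the same statement with the variables exchanged yields [x = 0] or the binomial
     equation with the inverse constant; either one gives the claim. *)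
  case: (top_form_zero f0 n0 m0 A0 EAB fuv z) => [y0|//].
  have fvu x' y' : (swapXY f).[x', y'] = 0 -> exists t, x' = v.[t] /\ y' = u.[t].
    by rewrite horner2_swapXY => /fuv[t [? ?]]; exists t.
  have sf0 : swapXY f != 0 by rewrite swapXY_eq0.
  have z' : (top_form m n (swapXY f)).[y, x] = 0 by rewrite top_form_swap horner2_swapXY.
  case: (top_form_zero sf0 m0 n0 B0 (esym EAB) fvu z') => [x0|].
    by rewrite x0 y0 !expr0n !gtn_eqF // mulr0.
  by rewrite /c => ->; rewrite !mulrA divfK ?mulfV ?mul1r ?expf_neq0.
have H0 : H != 0 by rewrite top_form_eq0.
have [l [e [e0 EW EH]]] := edge_of_zeros H0 A0 B0 g0 cop c0 HW zero.
(* With [l = 0] the weight of [f] is 0, so [f] is a nonzero constant and its fiber is empty. *)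
have l0 : (0 < l)%N.
  rewrite lt0n; apply: contraNneq f0 => l0; rewrite l0 mul0n muln0 in EW.
  have EfH : f = H.
    apply/polyP => i; apply/polyP => j; rewrite coef_top_form EW.
    case: eqP => // ne; apply/eqP; apply: contra_notT ne => /(@coef_le_wdeg _ n m).
    by rewrite EW leqn0 => /eqP.
  have : f.[u.[0], v.[0]] = 0 by apply/h; exists 0.
  rewrite EfH EH l0 expr0 hornerZ hornerM !hornerC mulr1 => /eqP.
  by rewrite (negPf e0).
exists A, B, l, c, e; split=> // i j; rewrite coefB coefB -EH coef_top_form.
case: ifP => [_|/eqP ne]; first by rewrite subrr eqxx.
rewrite subr0 => /(@coef_le_wdeg _ n m) le; rewrite -(ltn_pmul2l g0).
have -> : (g * (B * i + A * j) = n * i + m * j)%N by rewrite {1}En {1}Em; lia.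
by rewrite -EW ltn_neqAle le andbT; apply/eqP.
Qed.
End Structure.

(** * Tschirnhaus normalization *)

Section Shift.
Variable R : idomainType.
Implicit Types (f : {poly R}) (s : R).

(* The extra [0] makes the value [0] when [size f <= 1]. *)
Definition subleading f := nth 0 (0 :: f) (size f).-1.

Lemma subleadingE f n : size f = n.+2 -> subleading f = f`_n.
Proof. by rewrite /subleading => ->. Qed.

Lemma subleading_small f : (size f <= 1)%N -> subleading f = 0.
Proof. by rewrite /subleading; case: (size f) => [|[]]. Qed.

Lemma size_affine (a b : R) : a != 0 -> size (a *: 'X + b%:P) = 2.
Proof.
by move=> a0; rewrite size_polyDl size_scale ?size_polyX // size_polyC; case: (b != 0).
Qed.

Lemma lead_coef_affine (a b : R) : a != 0 -> lead_coef (a *: 'X + b%:P) = a.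
Proof.
move=> a0; rewrite lead_coefDl ?lead_coefZ ?lead_coefX ?mulr1 //.
by rewrite size_scale ?size_polyX // size_polyC; case: (b != 0).
Qed.

Lemma size_comp_affine f (a b : R) : a != 0 -> size (f \Po (a *: 'X + b%:P)) = size f.
Proof. by move=> a0; rewrite size_comp_poly2 ?size_affine. Qed.

Lemma coef_affine_exp (a b : R) n : ((a *: 'X + b%:P) ^+ n.+1)`_n = b * a ^+ n *+ n.+1.
Proof.
elim: n => [|n IH]; first by rewrite expr1 coefD coefZ coefX coefC mulr0 add0r mulr1.
rewrite exprSr mulrDr coefD coefMC -scalerAr coefZ coefMX IH /=.
have -> : ((a *: 'X + b%:P) ^+ n.+1)`_n.+1 = a ^+ n.+1.
  elim: n.+1 => [|k IHk]; first by rewrite expr0 coef1.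
  rewrite exprSr mulrDr coefD coefMC -scalerAr coefZ coefMX /= IHk.
  rewrite [X in _ + X * _]nth_default ?mul0r ?addr0 -?exprS //.
  apply: leq_trans (size_poly_exp_leq _ _) _.
  have : (size (a *: 'X + b%:P)%R <= 2)%N.
    rewrite (leq_trans (size_polyD _ _)) // geq_max size_polyC (leq_trans (leq_b1 _)) // andbT.
    by rewrite (leq_trans (size_scale_leq _ _)) ?size_polyX.
  by case: size => [|[|[|]]] //= _; rewrite ?mul0n // mul1n ltnS.
by rewrite mulrnAr mulrCA -exprS [in RHS]mulrS addrC [a ^+ _ * b]mulrC.
Qed.

(** Only the two highest terms of [f] reach this coefficient. For [a = 1] the formula is solved for
    [b] in [shift]; for general [a] it detects translations in an automorphism. *)
Lemma subleading_comp_affine f (a b : R) : a != 0 ->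
  subleading (f \Po (a *: 'X + b%:P)) =
    a ^+ (size f).-2 * (subleading f + lead_coef f * b *+ (size f).-1).
Proof.
move=> a0; case Ef : (size f) => [|[|n]].
- by rewrite !subleading_small ?size_comp_affine ?Ef // mulr0n addr0 mulr0.
- by rewrite !subleading_small ?size_comp_affine ?Ef // mulr0n addr0 mulr0.
rewrite (subleadingE Ef) (subleadingE (n := n)) ?size_comp_affine //.
rewrite comp_polyE Ef !big_ord_recr /= !coefD !coefZ coef_affine_exp coef_sum big1; last first.
  move=> i _; rewrite coefZ [X in _ * X]nth_default ?mulr0 //.
  have := size_exp (a *: 'X + b%:P) i; rewrite size_affine // mul1n.
  by move: (ltn_ord i) (size _); lia.
rewrite add0r lead_coefE Ef /=.
have -> : ((a *: 'X + b%:P) ^+ n)`_n = a ^+ n.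
  have := lead_coef_exp (a *: 'X + b%:P) n.
  by rewrite lead_coef_affine // lead_coefE size_exp size_affine // mul1n.
by rewrite mulrDr [a ^+ n * f`_n]mulrC !mulrnAr mulrA [a ^+ n * _]mulrC.
Qed.
End Shift.

Lemma bipoly_rmorph_eq (R A : nzRingType) (phi psi : {rmorphism {poly {poly R}} -> A}) :
  phi 'X = psi 'X -> phi 'Y = psi 'Y -> (forall c, phi c%:P%:P = psi c%:P%:P) -> phi =1 psi.
Proof.
move=> EX EY EC f; have EP (c : {poly R}) : phi c%:P = psi c%:P.
  elim/poly_ind: c => [|c d IH]; first by rewrite !rmorph0.
  by rewrite polyCD polyCM !rmorphD !rmorphM /= IH EY EC.
elim/poly_ind: f => [|f c IH]; first by rewrite !rmorph0.
by rewrite !rmorphD !rmorphM /= IH EX EP.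
Qed.

Lemma swap_binomialXY (K : closedFieldType) A B (c : K) : c != 0 ->
  swapXY (binomialXY A B c) = (- c)%:P%:P * binomialXY B A c^-1.
Proof.
move=> c0; rewrite /binomialXY -!mul_polyC.
have E1 : swapXY ('X^A) = 'Y ^+ A :> {poly {poly K}} by rewrite rmorphXn /= swapXY_X.
have E2 : swapXY (c%:P%:P * 'Y ^+ B) = c%:P%:P * 'X^B.
  by rewrite rmorphM rmorphXn /= swapXY_polyC map_polyC swapXY_Y.
rewrite rmorphB /= E1 E2 mulrBr mulrA -!polyCM mulNr divff //.
by rewrite !polyCN !mulNr mul1r opprK addrC.
Qed.

(** * Coefficients controlled by the edge *)

Section EdgeFacts.
Variable K : numClosedFieldType.
Implicit Types f : {poly {poly K}}.

Lemma edge_swap A B l c e f : edge_type A B l c e f ->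
  edge_type B A l c^-1 (e * (- c) ^+ l) (swapXY f).
Proof.
case=> [[A0 B0 l0 cop] c0 e0 h]; split.
- by rewrite coprime_sym.
- by rewrite invr_eq0.
- by rewrite mulf_neq0 ?expf_neq0 ?oppr_eq0.
move=> i j; rewrite addnC [(B * A)%N]mulnC => nz; apply: (h j i); move: nz.
have -> : (e * (- c) ^+ l)%:P *: binomialXY B A c^-1 ^+ l = swapXY (e%:P *: binomialXY A B c ^+ l).
  rewrite -!mul_polyC [RHS]rmorphM [X in _ = _ * X]rmorphXn /= swap_binomialXY // exprMn.
  by rewrite swapXY_polyC map_polyC /= mulrA -!polyC_exp -!polyCM.
by rewrite -rmorphB coef_swapXY.
Qed.

End EdgeFacts.

Section EdgeCoef.
Variable K : numClosedFieldType.
Variables (A B l : nat) (c e : K) (f : {poly {poly K}}).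
Hypothesis ef : edge_type A B l c e f.
Let E := e%:P *: binomialXY A B c ^+ l.

Lemma edge_whomog : whomog B A (l * (A * B)) E.
Proof.
apply/gr_homogP; rewrite /E -mul_polyC rmorphM rmorphXn /= grC gr_binomialXY; last exact: mulnC.
rewrite exprMn -exprM -rmorphXn mulrA -rmorphM; congr (_ * 'X^_).
by rewrite mulnC [(B * A)%N]mulnC.
Qed.

Lemma edge_weight i j : f`_i`_j != 0 -> (B * i + A * j <= l * (A * B))%N.
Proof.
move=> nz; case: ef => _ _ _ h; have [E0|/edge_whomog->//] := eqVneq (E`_i`_j) 0.
by apply/ltnW/h; rewrite !coefB [X in _ - X]E0 subr0.
Qed.

Lemma edge_coef_top i j : (B * i + A * j = l * (A * B))%N -> f`_i`_j = E`_i`_j.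
Proof.
move=> Ew; case: ef => _ _ _ h; apply/eqP; rewrite -subr_eq0 -!coefB.
by apply: contraTT isT => /h; rewrite Ew ltnn.
Qed.

Lemma edge_coef_lead : f`_(l * A)`_0 = e.
Proof.
case: ef => [[A0 B0 l0 _] _ _ _]; rewrite edge_coef_top; last by lia.
have EM : map_poly (horner_eval 0) E = e *: 'X^(l * A).
  rewrite /E -mul_polyC rmorphM rmorphXn /= map_binomialXY expr0n gtn_eqF // mulr0 subr0.
  by rewrite map_polyC /= [horner_eval _ _]hornerC mul_polyC -exprM mulnC.
have := congr1 (fun p : {poly K} => p`_(l * A)) EM.
by rewrite /= coef_map /= /horner_eval horner_coef0 => ->; rewrite coefZ coefXn eqxx mulr1.
Qed.

Lemma edge_size : size f = (l * A).+1.
Proof.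
case: ef => [[A0 B0 l0 _] _ e0 _]; apply/eqP; rewrite eqn_leq; apply/andP; split.
  apply/leq_sizeP => i lei; apply/polyP => j; rewrite coef0.
  apply/eqP; apply: contraTT lei => /edge_weight le; rewrite -ltnNge ltnS -(leq_pmul2l B0).
  by apply: leq_trans (leq_addr _ _) (leq_trans le _); rewrite mulnA mulnC.
rewrite ltnNge; apply: contraNN e0 => le.
by rewrite -edge_coef_lead [f`_ _]nth_default ?coef0.
Qed.

Lemma edge_lead_coef : lead_coef f = e%:P.
Proof.
case: ef => [[A0 B0 l0 _] _ e0 _]; rewrite lead_coefE edge_size /=.
apply/polyP => -[|j]; rewrite coefC /= ?edge_coef_lead //.
apply/eqP; apply: contraT => /edge_weight; nia.
Qed.

(** Giving up one power of [x] frees the weight [B], at a price of [A] for each power of [y]. In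
    particular the subleading coefficient is constant if [B < A]. *)
Lemma edge_subleading j : (subleading f)`_j != 0 -> (A * j <= B)%N.
Proof.
case: ef => [[A0 B0 l0 _] _ e0 _].
have [n En] : exists n, (l * A)%N = n.+1 by exists (l * A).-1; rewrite prednK // muln_gt0 l0.
rewrite (subleadingE (n := n)) ?edge_size ?En // => /edge_weight.
by rewrite mulnA En mulSn [(n * B)%N]mulnC addnC leq_add2r.
Qed.

(** The power [(x - c y^B)^l] contributes [- l c e] at [x^(l-1) y^B]. This is why normalization
    excludes the exponent 1. *)
Lemma edge_subleading_neq0 : A = 1%N -> subleading f != 0.
Proof.
move=> A1; have := edge_size; case: ef => [[A0 B0 l0 _] c0 e0 _].
rewrite A1 muln1; case El : l l0 => [|n] // _ sf; rewrite (subleadingE sf).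
apply/eqP => /(congr1 (fun p : {poly K} => p`_B)); rewrite coef0 edge_coef_top; last first.
  by rewrite A1 El; lia.
have -> : E = e%:P *: (1 *: 'X + (- (c *: 'X^B))%:P) ^+ n.+1.
  rewrite /E A1 El /binomialXY expr1 scale1r -rmorphXn /=; congr (_ *: (_ + _) ^+ _).
  by rewrite polyCN -!mul_polyC polyCM.
rewrite coefZ coef_affine_exp expr1n mulr1 coefCM coefMn coefN coefZ coefXn eqxx mulr1 => /eqP.
by rewrite mulf_eq0 (negPf e0) mulrn_eq0 /= oppr_eq0 (negPf c0).
Qed.
End EdgeCoef.

Lemma swap_comp_const (K : fieldType) (f : {poly {poly K}}) (d : K) :
  swapXY (f \Po (1 *: 'X + d%:P%:P)) = map_poly (comp_poly ('X + d%:P)) (swapXY f).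
Proof.
apply: (@bipoly_rmorph_eq _ _ (swapXY \o comp_poly (1 *: 'X + d%:P%:P))
  (map_poly (comp_poly ('X + d%:P)) \o swapXY)) => [||x] /=.
- by rewrite comp_polyX scale1r rmorphD /= swapXY_X swapXY_polyC map_polyC /= map_polyC /= comp_polyX polyCD.
- by rewrite comp_polyC swapXY_Y map_polyX.
- by rewrite comp_polyC !swapXY_polyC !map_polyC /= comp_polyC.
Qed.

Lemma subleading_map (R S : idomainType) (phi : {rmorphism R -> S}) (f : {poly R}) :
  injective phi -> subleading (map_poly phi f) = phi (subleading f).
Proof.
move=> inj; case Ef : (size f) => [|[|n]].
- by rewrite !subleading_small ?rmorph0 ?size_map_inj_poly ?rmorph0 ?Ef.
- by rewrite !subleading_small ?rmorph0 ?size_map_inj_poly ?rmorph0 ?Ef.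
by rewrite !(subleadingE (n := n)) ?size_map_inj_poly ?rmorph0 // coef_map.
Qed.

Lemma comp_shift_inj (K : fieldType) (d : K) : injective (comp_poly ('X + d%:P)).
Proof.
move=> p q E; rewrite -(comp_polyXr p) -(comp_polyXr q) -(subrK d%:P 'X).
have -> r : r \Po ('X - d%:P + d%:P) = (r \Po ('X + d%:P)) \Po ('X - d%:P) :> {poly K}.
  by rewrite -comp_polyA comp_polyD comp_polyX comp_polyC.
have -> r : r \Po ('X - d%:P + d%:P) = (r \Po ('X + d%:P)) \Po ('X - d%:P) :> {poly K}.
  by rewrite -comp_polyA comp_polyD comp_polyX comp_polyC.
by rewrite E.
Qed.

Lemma swap_line (K : fieldType) (e g : K) k :
  swapXY (e%:P *: ('X - g%:P%:P) ^+ k) = (e *: ('X - g%:P) ^+ k)%:P.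
Proof.
rewrite -[RHS]swapXY_map_polyC; congr (swapXY _).
by rewrite map_polyZ rmorphXn /= rmorphB /= map_polyX map_polyC.
Qed.

Section Tschirnhaus.
Variable K : numClosedFieldType.
Implicit Types f : {poly {poly K}}.

(** The solution of the equation in [shiftE]. By [param_lead] the leading coefficient of a
    parametrized [f] of positive degree in [x] is constant, so its coefficient of index 0 is all of
    it. In degree 0 the convention on [subleading] makes the shift 0. *)
Definition shift f : {poly K} :=
  - ((size f).-1%:R * (lead_coef f)`_0)^-1 *: subleading f.

Definition tsch f : {poly {poly K}} := f \Po (1 *: 'X + (shift f)%:P).

(** The exchange lets the iteration of one function alternate between the two variables. *)
Definition tstep f := swapXY (tsch f).

Definition normalized f := subleading f = 0 /\ subleading (swapXY f) = 0.

Lemma param_comp f (s : {poly K}) : parametrized f -> parametrized (f \Po (1 *: 'X + s%:P)).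
Proof.
case=> u [v h]; exists (u - (s \Po v)), v => x y.
rewrite horner_comp2 scale1r !hornerD !hornerX !hornerC h.
split=> -[t [Ex Ey]]; exists t; split=> //.
  by rewrite hornerD hornerN horner_comp -Ey -Ex addrK.
by rewrite Ex hornerD hornerN horner_comp Ey subrK.
Qed.

Lemma param_tsch f : parametrized f -> parametrized (tsch f).
Proof. exact: param_comp. Qed.

Lemma param_tstep f : parametrized f -> parametrized (tstep f).
Proof. by move/param_tsch/parametrized_swap. Qed.

Lemma size_tsch f : size (tsch f) = size f.
Proof. by rewrite /tsch size_comp_affine ?oner_eq0. Qed.

Lemma size_line (e g : K) k : e != 0 -> size (e%:P *: ('X - g%:P%:P) ^+ k) = k.+1.
Proof. by move=> e0; rewrite size_scale ?polyC_eq0 // size_exp_XsubC. Qed.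

Lemma lead_line (e g : K) k : lead_coef (e%:P *: ('X - g%:P%:P) ^+ k) = e%:P.
Proof. by rewrite lead_coefZ lead_coef_exp lead_coefXsubC expr1n mulr1. Qed.

Lemma param_lead f : parametrized f -> (1 < size f)%N -> exists2 e, e != 0 & lead_coef f = e%:P.
Proof.
case/param_structure => [[e [g [k [e0 _ ->]]]] _|[e [g [k [e0 _ Ef]]]]|[A [B [l [c [e ef]]]]] _].
- by exists e; rewrite ?lead_line.
- by rewrite -[f]swapXYK Ef swap_line size_polyC ltnNge leq_b1.
- by exists e; [case: ef | rewrite (edge_lead_coef ef)].
Qed.

Lemma shiftE f (e : K) : e != 0 -> lead_coef f = e%:P -> (1 < size f)%N ->
  subleading f + lead_coef f * shift f *+ (size f).-1 = 0.
Proof.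
move=> e0 le sf; have N0 : ((size f).-1%:R : K) != 0 by rewrite pnatr_eq0; lia.
rewrite /shift le coefC /= mul_polyC scalerA -scaler_nat scalerA.
by rewrite mulrA mulrN divff ?mulf_neq0 // scaleN1r subrr.
Qed.

Lemma subleading_tsch f : parametrized f -> subleading (tsch f) = 0.
Proof.
move=> pf; have [le|lt] := leqP (size f) 1; first by rewrite subleading_small ?size_tsch.
have [e e0 Le] := param_lead pf lt.
by rewrite /tsch subleading_comp_affine ?oner_eq0 // (shiftE e0 Le lt) mulr0.
Qed.

(** The shift is 0, so surplus iterations are harmless. *)
Lemma normalized_tstep f : normalized f -> tstep f = swapXY f /\ normalized (tstep f).
Proof.
case=> h1 h2; have -> : tstep f = swapXY f.
  by rewrite /tstep /tsch /shift h1 scaler0 addr0 scale1r comp_polyXr.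
by split=> //; split=> //; rewrite swapXYK.
Qed.

End Tschirnhaus.

Lemma size_arith x y z B i W : (x <= (W - B * i).+1)%N -> (z <= B.+1)%N ->
  (y <= (z.-1 * i).+1)%N -> (B * i <= W)%N -> ((x + y).-1 <= W.+1)%N.
Proof.
move=> le1 le2 le3 le4; have : (z.-1 * i <= B * i)%N by rewrite leq_mul2r; lia.
lia.
Qed.

(** * Termination of the alternating substitutions *)

Section Convergence.
Variable K : numClosedFieldType.
Implicit Types f : {poly {poly K}}.

Definition bisize f := (size f + size (swapXY f))%N.

Lemma tsch_line f : line_type f -> exists e k, [/\ e != 0, (0 < k)%N & tsch f = (e *: 'X^k)^:P].
Proof.
case=> e [g [k [e0 k0 Ef]]]; exists e, k; split=> //.
have sf : size f = k.+1 by rewrite Ef size_line.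
have lf : lead_coef f = e%:P by rewrite Ef lead_line.
have sX : size (e%:P *: 'X^k : {poly {poly K}}) = k.+1 by rewrite size_scale ?polyC_eq0 // size_polyXn.
have Ef' : f = (e%:P *: 'X^k) \Po (1 *: 'X + (- g)%:P%:P).
  by rewrite Ef comp_polyZ rmorphXn /= comp_polyX scale1r !polyCN.
have sub0 : subleading (e%:P *: 'X^k : {poly {poly K}}) = 0.
  case: k k0 sX {Ef sf Ef'} => // k _ sX; rewrite (subleadingE sX) coefZ coefXn.
  by rewrite ltn_eqF // mulr0.
have sub : subleading f = (- g * e *+ k)%:P.
  rewrite Ef' subleading_comp_affine ?oner_eq0 // sub0 add0r expr1n mul1r sX /=.
  by rewrite lead_coefZ lead_coefXn mulr1 -polyCM -polyCMn mulrC.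
have Es : shift f = g%:P.
  rewrite /shift sub sf lf coefC /= -mul_polyC -polyCM; congr _%:P.
  have N0 : k%:R * e != 0 by rewrite mulf_neq0 // pnatr_eq0 -lt0n.
  by rewrite -[- g * e *+ k]mulr_natl !mulNr !mulrN opprK [g * e]mulrC [_%:R * (e * g)]mulrA mulKf.
rewrite /tsch Es Ef comp_polyZ rmorphXn /= comp_polyB comp_polyX comp_polyC scale1r addrK.
by rewrite map_polyZ /= map_polyXn.
Qed.

Lemma normalized_line f : line_type f -> normalized (tstep f).
Proof.
move/tsch_line => [e [k [e0 k0 E]]]; rewrite /normalized /tstep E swapXY_map_polyC; split.
  by rewrite subleading_small // size_polyC leq_b1.
rewrite swapXY_polyC subleading_map; last exact: polyC_inj.
case: k k0 {E} => // k _; rewrite (subleadingE (n := k)) ?size_scale ?size_polyXn //.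
by rewrite coefZ coefXn ltn_eqF // mulr0.
Qed.

(** By [edge_subleading] the shift is a constant, and translating [x] by a constant maps the
    subleading coefficient in [y], which is 0, to 0. *)
Lemma normalized_edge_gt A B l c e f : parametrized f -> edge_type A B l c e f ->
  (B < A)%N -> subleading (swapXY f) = 0 -> normalized (tstep f).
Proof.
move=> pf ef lt Q; rewrite /normalized /tstep swapXYK subleading_tsch //; split=> //.
have [d Ed] : exists d, shift f = d%:P.
  exists (shift f)`_0; apply/polyP => -[|j]; rewrite coefC //=.
  apply/eqP; rewrite /shift coefZ mulf_eq0; apply/orP; right.
  by apply: contraT => /(edge_subleading ef); nia.
by rewrite /tsch Ed swap_comp_const subleading_map ?Q ?rmorph0 //; apply: comp_shift_inj.
Qed.

(** By [edge_subleading] the shift has weight at most [B], the weight of [x], so the substitution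
    does not raise weights. *)
Lemma sizeY_tsch A B l c e f : edge_type A B l c e f -> (size (swapXY (tsch f)) <= (l * B).+1)%N.
Proof.
move=> ef; have [[A0 B0 l0 _] _ _ _] := ef.
suff h : (size (gr B A (tsch f)) <= (l * (A * B)).+1)%N.
  apply/leq_sizeP => j lj; apply/polyP => i; rewrite coef_swapXY coef0.
  apply/eqP; apply: contraTT lj => /(elimT (wdegP B A _ _) h) le; rewrite -ltnNge ltnS.
  by rewrite -(leq_pmul2l A0) (leq_trans (leq_addl _ _) (leq_trans le _)) // mulnCA.
have gs : (size (gr B A (1 *: 'X + (shift f)%:P)) <= B.+1)%N.
  apply/wdegP => i j; rewrite scale1r coefD coefX coefC.
  case: i => [|[|i]] /=; rewrite ?add0r ?addr0 ?coef0 ?eqxx //.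
    rewrite /shift coefZ muln0 add0n => nz; apply: (edge_subleading ef).
    by apply: contraNneq nz => ->; rewrite mulr0.
  by rewrite coef1; case: j => [|j]; rewrite ?eqxx // muln1 muln0 addn0.
rewrite /tsch comp_polyE rmorph_sum; apply: leq_trans (size_sum _ _ _) _.
apply/bigmax_leqP => i _; rewrite -mul_polyC rmorphM rmorphXn /=.
have [->|nz] := eqVneq f`_i 0; first by rewrite rmorph0 mul0r size_poly0.
have [j Hj] : exists j, f`_i`_j != 0.
  by exists (size f`_i).-1; rewrite -lead_coefE lead_coef_eq0.
have le := edge_weight ef Hj.
have gi : (size (gr B A (f`_i)%:P) <= (l * (A * B) - B * i).+1)%N.
  apply/wdegP => i' j'; rewrite coefC; case: i' => [|i']; rewrite ?coef0 ?eqxx //=.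
  by move/(edge_weight ef); lia.
apply: leq_trans (size_polyMleq _ _) _.
exact: size_arith gi gs (size_poly_exp_leq _ _) (leq_trans (leq_addr _ _) le).
Qed.

Lemma size_swapped_line f : line_type (swapXY f) -> (size f <= 1)%N.
Proof.
by case=> e [g [k [_ _ Ef]]]; rewrite -[f]swapXYK Ef swap_line size_polyC leq_b1.
Qed.

Lemma edge_uniq A B l A' B' l' : (0 < l)%N -> (0 < l')%N -> (0 < A)%N -> (0 < A')%N ->
    coprime A B -> coprime A' B' -> (l' * A' = l * A)%N -> (l' * B' = l * B)%N -> A' = A /\ B' = B.
Proof.
move=> l0 l'0 A0 A'0 cop cop' EA EB.
have E : (A' * B = A * B')%N.
  apply/eqP; rewrite -(eqn_pmul2l l0) -(eqn_pmul2l l'0); apply/eqP.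
  have -> : (l' * (l * (A' * B)) = (l' * A') * (l * B))%N by ring.
  by rewrite EA -EB; ring.
have dA : A' = A.
  apply/eqP; rewrite eqn_dvd -(Gauss_dvdl _ cop') -E dvdn_mulr //.
  by rewrite -(Gauss_dvdl _ cop) E dvdn_mulr.
by split=> //; apply/eqP; rewrite -(eqn_pmul2l A0) -E dA.
Qed.

(* With an edge of type [(A, B)] and [A > B] the shift is constant and one step
   normalizes; with [A < B] the step lowers the degree in [y], or else the next
   edge has the same type and swapping leads to the first case. *)
Lemma tstep_progress f : parametrized f -> subleading (swapXY f) = 0 ->
  exists2 j, (0 < j <= 2)%N &
    normalized (iter j (@tstep K) f) \/ (bisize (iter j (@tstep K) f) < bisize f)%N.
Proof.
move=> pf Q; case: (param_structure pf) => [lf|/size_swapped_line sf|[A [B [l [c [e ef]]]]]].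
- by exists 1%N => //; left; apply: normalized_line.
- exists 1%N => //; left; apply: (normalized_tstep _).2; split=> //.
  exact: subleading_small.
have [[A0 B0 l0 cop] c0 e0 _] := ef; case: (ltngtP A B) => [lt|gt|eqAB].
- have pg := param_tsch pf; have sg := subleading_tsch pf.
  have ssg : size (tsch f) = (l * A).+1 by rewrite size_tsch (edge_size ef).
  case: (param_structure pg) => [[e' [g [k [_ _ Eg]]]]|/size_swapped_line|[A' [B' [l' [c' [e' eg]]]]]].
  + exists 1%N => //; left; split; rewrite /= /tstep ?swapXYK //.
    by rewrite Eg swap_line subleading_small // size_polyC leq_b1.
  + by rewrite ssg ltnNge muln_gt0 l0 A0.
  have [[A'0 B'0 l'0 cop'] _ _ _] := eg.
  have EA : (l' * A' = l * A)%N by have := edge_size eg; rewrite ssg => -[->].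
  have := sizeY_tsch ef; rewrite (edge_size (edge_swap eg)) ltnS leq_eqVlt => /orP[/eqP EB|ltB].
    have [EA' EB'] := edge_uniq l0 l'0 A0 A'0 cop cop' EA EB.
    exists 2%N => //; left; apply: (normalized_edge_gt (param_tstep pf) (edge_swap eg)).
      by rewrite EA' EB'.
    by rewrite swapXYK.
  exists 1%N => //; right; rewrite /bisize /= /tstep swapXYK addnC size_tsch ltn_add2l.
  by rewrite (edge_size (edge_swap eg)) (edge_size (edge_swap ef)).
- by exists 1%N => //; left; apply: (normalized_edge_gt pf ef).
have B1 : B = 1%N by move: cop; rewrite eqAB /coprime gcdnn => /eqP.
by have := edge_subleading_neq0 (edge_swap ef) B1; rewrite Q eqxx.
Qed.

Lemma param_iter_tstep j f : parametrized f -> parametrized (iter j (@tstep K) f).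
Proof. by move=> pf; elim: j => //= j; apply: param_tstep. Qed.

Lemma normalized_iter j f : normalized f -> normalized (iter j (@tstep K) f).
Proof. by move=> nf; elim: j => //= j /normalized_tstep[]. Qed.

(** Each round takes at most two steps and lowers [bisize] unless it normalizes. The condition on
    [swapXY f] is reestablished by every step. *)
Lemma converge n f k : parametrized f -> subleading (swapXY f) = 0 ->
  (bisize f <= n)%N -> (2 * n <= k)%N -> normalized (iter k (@tstep K) f).
Proof.
elim: n f k => [|n IH] f k pf Q le1 le2.
  apply: normalized_iter; split=> //; rewrite subleading_small //.
  by move: le1; rewrite /bisize leqn0 addn_eq0 => /andP[/eqP-> _].
have [j /andP[j0 j2] h] := tstep_progress pf Q.
have jk : (j <= k)%N by apply: leq_trans j2 _; lia.
rewrite -(subnK jk).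
rewrite iterD; case: h => [h|lt]; first exact: normalized_iter.
apply: IH; [exact: param_iter_tstep| |by rewrite -ltnS (leq_trans lt)|by clear -le2 j2; lia].
case: j j0 {j2 lt jk} => // j _; rewrite /= /tstep swapXYK subleading_tsch //.
exact: param_iter_tstep.
Qed.

Lemma bisize_tstep f : parametrized f -> (bisize (tstep f) <= bisize f)%N.
Proof.
move=> pf; rewrite /bisize /tstep swapXYK addnC size_tsch leq_add2l.
case: (param_structure pf) => [lf|/size_swapped_line sf|[A [B [l [c [e ef]]]]]].
- have [e [k [_ _ ->]]] := tsch_line lf; rewrite swapXY_map_polyC.
  rewrite (leq_trans (size_polyC_leq1 _)) // size_poly_gt0 swapXY_eq0.
  by case: lf => e' [g [k' [e'0 _ ->]]]; rewrite -size_poly_gt0 size_line.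
- by rewrite /tsch /shift subleading_small // scaler0 addr0 scale1r comp_polyXr.
by rewrite (edge_size (edge_swap ef)) (sizeY_tsch ef).
Qed.

(** The additional step establishes the condition on [swapXY f] in [converge], without increasing
    [bisize]. *)
Theorem normalized_iter_tstep f k : parametrized f -> (2 * bisize f < k)%N ->
  normalized (iter k (@tstep K) f).
Proof.
case: k => // k pf le; rewrite iterSr; apply: (converge (n := bisize f)) => //.
- exact: param_tstep.
- by rewrite /tstep swapXYK subleading_tsch.
- exact: bisize_tstep.
Qed.

End Convergence.

(** * Automorphisms between normalized polynomials *)

Section Bridge.
Variable K : fieldType.
Implicit Types (f : {poly {poly K}}) (p q : {mpoly K[2]}).

Definition mon (i j : nat) : 'X_{1..2} := [multinom nth 0%N [:: i; j] k | k < 2].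

Lemma mon_eq i j m : (mon i j == m) = (i == m i0) && (j == m i1).
Proof.
apply/eqP/andP => [<-|[/eqP-> /eqP->]]; first by rewrite !mnmE.
by apply/mnmP; elim/ord2P; rewrite mnmE.
Qed.

Lemma monE (m : 'X_{1..2}) : mon (m i0) (m i1) = m.
Proof. by apply/eqP; rewrite mon_eq !eqxx. Qed.

Lemma mpolyX_mon i j : 'X_[mon i j] = 'X_i0 ^+ i * 'X_i1 ^+ j :> {mpoly K[2]}.
Proof. by rewrite mpolyXE_id big_ord2 !mnmE. Qed.

Definition mpoly_of_inner : {poly K} -> {mpoly K[2]} :=
  horner_eval 'X_i1 \o map_poly (@mpolyC 2 K).
HB.instance Definition _ := GRing.RMorphism.on mpoly_of_inner.

Definition mpoly_of : {poly {poly K}} -> {mpoly K[2]} :=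
  horner_eval 'X_i0 \o map_poly mpoly_of_inner.
HB.instance Definition _ := GRing.RMorphism.on mpoly_of.

Lemma mpoly_ofX : mpoly_of 'X = 'X_i0.
Proof. by rewrite /mpoly_of /= /horner_eval map_polyX hornerX. Qed.

Lemma mpoly_of_const c : mpoly_of c%:P = mpoly_of_inner c.
Proof. by rewrite /mpoly_of /= /horner_eval map_polyC hornerC. Qed.

Lemma mpoly_ofY : mpoly_of 'Y = 'X_i1.
Proof. by rewrite mpoly_of_const /mpoly_of_inner /= /horner_eval map_polyX hornerX. Qed.

Lemma mpoly_ofC c : mpoly_of c%:P%:P = c%:MP.
Proof. by rewrite mpoly_of_const /mpoly_of_inner /= /horner_eval map_polyC hornerC. Qed.

Lemma mpoly_ofE f : mpoly_of f = \sum_(i < size f) \sum_(j < size f`_i) f`_i`_j *: 'X_[mon i j].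
Proof.
rewrite /mpoly_of /= /horner_eval (@horner_coef_wide _ (size f)) ?size_poly //.
apply: eq_bigr => i _; rewrite coef_map /= /mpoly_of_inner /= /horner_eval.
rewrite (@horner_coef_wide _ (size f`_i)) ?size_poly //.
rewrite mulr_suml; apply: eq_bigr => j _.
by rewrite coef_map /= mpolyX_mon -mul_mpolyC -mulrA [_ ^+ j * _]mulrC.
Qed.

Lemma mcoeff_mpoly_of f m : (mpoly_of f)@_m = f`_(m i0)`_(m i1).
Proof.
set i := m i0; set j := m i1.
have E i' j' : (f`_i'`_j' *: 'X_[mon i' j'])@_m = f`_i'`_j' *+ (i' == i) *+ (j' == j).
  by rewrite mcoeffZ mcoeffX mon_eq -mulnb natrM mulrA !mulr_natr.
rewrite mpoly_ofE raddf_sum /=.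
under eq_bigr => i' _ do (rewrite raddf_sum /=; under eq_bigr => j' _ do rewrite E).
have [lti|lei] := ltnP i (size f); last first.
  rewrite (nth_default 0 lei) coef0 big1 // => i' _; rewrite big1 // => j' _.
  by rewrite (_ : (i' == i :> nat) = false) ?mulr0n ?mul0rn //;
    apply/negbTE; rewrite neq_ltn (leq_trans (ltn_ord i') lei).
rewrite (bigD1 (Ordinal lti)) //= [X in _ + X]big1 ?addr0; last first.
  move=> i' ne; rewrite big1 // => j' _; rewrite (_ : (i' == i :> nat) = false) ?mulr0n ?mul0rn //.
  by apply: contraNF ne => /eqP h; apply/eqP/val_inj.
have [ltj|lej] := ltnP j (size f`_i); last first.
  rewrite (nth_default 0 lej) big1 // => j' _.
  by rewrite (_ : (j' == j :> nat) = false) ?mulr0n //;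
    apply/negbTE; rewrite neq_ltn (leq_trans (ltn_ord j') lej).
rewrite (bigD1 (Ordinal ltj)) //= [X in _ + X]big1 ?addr0 ?eqxx ?mulr1n //.
move=> j' ne; rewrite (_ : (j' == j :> nat) = false) ?mulr0n //.
by apply: contraNF ne => /eqP h; apply/eqP/val_inj.
Qed.

Lemma mpoly_of_inj : injective mpoly_of.
Proof.
move=> f g E; apply/polyP => i; apply/polyP => j.
have := congr1 (mcoeff (mon i j)) E; rewrite !mcoeff_mpoly_of.
by have /andP[/eqP<- /eqP<-] : (i == mon i j i0) && (j == mon i j i1) by rewrite -mon_eq.
Qed.

Definition bipoly_of p : {poly {poly K}} :=
  \poly_(i < msize p) \poly_(j < msize p) p@_(mon i j).

Lemma coef_bipoly_of p i j : (bipoly_of p)`_i`_j = p@_(mon i j).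
Proof.
have out : (msize p <= i + j)%N -> p@_(mon i j) = 0.
  move=> le; apply: memN_msupp_eq0; apply: msize_mdeg_ge.
  by rewrite mdeg2 !mnmE.
rewrite coef_poly; case: ltnP => lei; last by rewrite coef0 out // (leq_trans lei) ?leq_addr.
by rewrite coef_poly; case: ltnP => // lej; rewrite out // (leq_trans lej) ?leq_addl.
Qed.

Lemma bipoly_ofK : cancel bipoly_of mpoly_of.
Proof. by move=> p; apply/mpolyP => m; rewrite mcoeff_mpoly_of coef_bipoly_of monE. Qed.

Lemma size_bipoly_of p : (size (bipoly_of p) <= msize p)%N.
Proof. exact: size_poly. Qed.

Lemma sizeY_bipoly_of p : (size (swapXY (bipoly_of p)) <= msize p)%N.
Proof.
rewrite -sizeYE; apply/bigmax_leqP => i _.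
by rewrite coef_poly; case: ifP => _; rewrite ?size_poly ?size_poly0.
Qed.

Lemma meval_mpoly_of f a b : (mpoly_of f).@[tnth [tuple a; b]] = f.[a, b].
Proof.
apply: (@bipoly_rmorph_eq _ _ (meval (tnth [tuple a; b]) \o mpoly_of)
  (horner_eval b \o horner_eval a%:P)) => [||c] /=; rewrite /horner_eval.
- by rewrite mpoly_ofX mevalXU hornerX hornerC.
- by rewrite mpoly_ofY mevalXU hornerC hornerX.
- by rewrite mpoly_ofC mevalC !hornerC.
Qed.

Lemma mpoly_of_comp f (a : K) (s : {poly K}) :
  mpoly_of (f \Po (a%:P *: 'X + s%:P)) =
    mpoly_of f \mPo [tuple a *: 'X_i0 + mpoly_of s%:P; 'X_i1].
Proof.
apply: (@bipoly_rmorph_eq _ _ (mpoly_of \o comp_poly (a%:P *: 'X + s%:P))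
  (comp_mpoly [tuple a *: 'X_i0 + mpoly_of s%:P; 'X_i1] \o mpoly_of)) => [||c] /=.
- rewrite comp_polyX mpoly_ofX comp_mpolyXU rmorphD -mul_polyC rmorphM /=.
  by rewrite mpoly_ofX mpoly_ofC mul_mpolyC.
- by rewrite comp_polyC mpoly_ofY comp_mpolyXU.
- by rewrite comp_polyC mpoly_ofC comp_mpolyC.
Qed.

Lemma mpoly_of_swap f : mpoly_of (swapXY f) = mpoly_of f \mPo [tuple 'X_i1; 'X_i0].
Proof.
apply: (@bipoly_rmorph_eq _ _ (mpoly_of \o @swapXY K)
  (comp_mpoly [tuple 'X_i1; 'X_i0] \o mpoly_of)) => [||c] /=.
- by rewrite swapXY_X mpoly_ofX comp_mpolyXU mpoly_ofY.
- by rewrite swapXY_Y mpoly_ofY comp_mpolyXU mpoly_ofX.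
- by rewrite swapXY_polyC map_polyC /= mpoly_ofC comp_mpolyC.
Qed.

End Bridge.

(** * Automorphisms as substitutions *)

Section Automorphisms.
Variable K : fieldType.
Implicit Types (p q F G : {mpoly K[2]}).

Lemma lrmorph_comp (phi : {lrmorphism {mpoly K[2]} -> {mpoly K[2]}}) p :
  phi p = p \mPo [tuple phi 'X_i0; phi 'X_i1].
Proof.
elim/mpoly_ring_ind: p => [c|i|p q IHp IHq|p q IHp IHq].
- by rewrite comp_mpolyC -[c%:MP]mulr1 mul_mpolyC linearZ rmorph1 /= -mul_mpolyC mulr1.
- by rewrite comp_mpolyXU; elim/ord2P: i.
- by rewrite !rmorphD /= IHp IHq.
- by rewrite !rmorphM /= IHp IHq.
Qed.

Lemma comp_mpoly2A p (s t : 2.-tuple {mpoly K[2]}) :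
  (p \mPo s) \mPo t = p \mPo [tuple tnth s i0 \mPo t; tnth s i1 \mPo t].
Proof.
elim/mpoly_ring_ind: p => [c|i|p q IHp IHq|p q IHp IHq].
- by rewrite !comp_mpolyC.
- by rewrite !comp_mpolyXU; elim/ord2P: i; rewrite /= (tnth_nth 0).
- by rewrite !rmorphD /= IHp IHq.
- by rewrite !rmorphM /= IHp IHq.
Qed.

Lemma comp_mpoly2_id p : p \mPo [tuple 'X_i0; 'X_i1] = p.
Proof.
elim/mpoly_ring_ind: p => [c|i|p q IHp IHq|p q IHp IHq].
- by rewrite !comp_mpolyC.
- by rewrite !comp_mpolyXU; elim/ord2P: i.
- by rewrite !rmorphD /= IHp IHq.
- by rewrite !rmorphM /= IHp IHq.
Qed.

Lemma automorphic_comp p (s t : 2.-tuple {mpoly K[2]}) :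
    (forall i, tnth s i \mPo t = 'X_i) -> (forall i, tnth t i \mPo s = 'X_i) ->
  automorphic p (p \mPo s).
Proof.
move=> st ts; exists (comp_mpoly s : {lrmorphism _ -> _}); split=> //.
by exists (comp_mpoly t) => q /=; rewrite comp_mpoly2A ?st ?ts comp_mpoly2_id.
Qed.

Lemma automorphic_refl p : automorphic p p.
Proof. by exists idfun; split=> //; exists idfun. Qed.

Lemma automorphic_trans p q r : automorphic p q -> automorphic q r -> automorphic p r.
Proof.
case=> phi [bphi <-] [psi [bpsi <-]]; exists (psi \o phi : {lrmorphism _ -> _}).
by split=> //; apply: bij_comp.
Qed.

Lemma automorphic_sym p q : automorphic p q -> automorphic q p.
Proof.
case=> phi [[g gK Kg] <-]; pose s := [tuple g 'X_i0; g 'X_i1].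
have phis r : phi (r \mPo s) = r.
  have -> : phi (r \mPo s) = (phi \o comp_mpoly s : {lrmorphism _ -> _}) r by [].
  by rewrite lrmorph_comp /= !comp_mpolyXU !Kg comp_mpoly2_id.
have sphi r : phi r \mPo s = r by apply: (can_inj gK); rewrite phis.
exists (comp_mpoly s : {lrmorphism _ -> _}); split; last exact: sphi.
by exists phi.
Qed.

Lemma mpoly_mul1_const p q : p * q = 1 -> exists2 c, c != 0 & p = c%:MP.
Proof.
move=> E; have p0 : p != 0 by apply: contra_eq_neq E => ->; rewrite mul0r eq_sym oner_eq0.
have q0 : q != 0 by apply: contra_eq_neq E => ->; rewrite mulr0 eq_sym oner_eq0.
have : mlead p = 0%MM.
  have := congr1 (@mlead 2 K) E; rewrite mleadM // mlead1 => /eqP.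
  by rewrite mnmD_eq0 => /andP[/eqP].
move=> l0; exists (p@_0); first by rewrite -l0 mleadc_eq0.
apply/mpolyP => m; rewrite mcoeffC; case: eqP => [->|/eqP m0]; rewrite ?mulr1 // mulr0.
by apply: mcoeff_gt_mlead; rewrite l0 lt0x.
Qed.

(** The chain rule, applied to the components of the inverse, exhibits an inverse of the Jacobian;
    units of the polynomial ring are constants. *)
Lemma automorphic_jacobian p q : automorphic p q -> exists G F kap,
  [/\ kap != 0, bracket F G = kap%:MP & q = p \mPo [tuple G; F]].
Proof.
case=> phi [[g gK Kg] <-]; set G := phi 'X_i0; set F := phi 'X_i1.
suff [kap k0 Ek] : exists2 kap, kap != 0 & bracket F G = kap%:MP.
  by exists G, F, kap; split=> //; rewrite lrmorph_comp.
apply: (@mpoly_mul1_const _ (bracket (g 'X_i1) (g 'X_i0) \mPo [tuple G; F])).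
have : bracket (phi (g 'X_i1)) (phi (g 'X_i0)) = 1.
  by rewrite !Kg /bracket !mderivXU /= mul1r mul0r subr0.
move: (g 'X_i1) (g 'X_i0) => a b.
rewrite (lrmorph_comp phi a) (lrmorph_comp phi b) -/G -/F => <-; rewrite bracket_comp.
rewrite (bracketC (b \mPo _) F) (bracketC (b \mPo _) G) !bracket_comp.
rewrite !bracketff (bracketC F G) {2}/bracket rmorphB !rmorphM /=; ring.
Qed.
End Automorphisms.

(** * Scalings of the variables *)

Section Torus.
Variable K : fieldType.
Implicit Types f g : {poly {poly K}}.

Lemma coef_comp_scale (R : comNzRingType) (p : {poly R}) (a : R) i :
  (p \Po (a *: 'X + 0%:P))`_i = a ^+ i * p`_i.
Proof.
rewrite addr0 comp_polyE coef_sum.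
under eq_bigr => j _ do rewrite exprZn !coefZ coefXn.
have [lt|le] := ltnP i (size p); last first.
  rewrite [in RHS]nth_default // mulr0 big1 // => j _.
  by rewrite (_ : i == j = false) ?mulr0 //;
    apply/negbTE; rewrite neq_ltn (leq_trans (ltn_ord j) le) orbT.
rewrite (bigD1 (Ordinal lt)) //= eqxx mulr1 big1 ?addr0 1?mulrC // => j ne.
by rewrite (_ : i == j = false) ?mulr0 //; apply: contraNF ne => /eqP h; apply/eqP/val_inj.
Qed.

Lemma swap_comp_affine f (a d : K) :
  swapXY (f \Po (a%:P *: 'X + d%:P%:P)) = map_poly (comp_poly (a *: 'X + d%:P)) (swapXY f).
Proof.
apply: (@bipoly_rmorph_eq _ _ (swapXY \o comp_poly (a%:P *: 'X + d%:P%:P))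
  (map_poly (comp_poly (a *: 'X + d%:P)) \o swapXY)) => [||x] /=.
- rewrite comp_polyX rmorphD -mul_polyC rmorphM /= swapXY_X !swapXY_polyC !map_polyC /=.
  by rewrite comp_polyX -mul_polyC polyCD polyCM.
- by rewrite comp_polyC swapXY_Y map_polyX.
- by rewrite comp_polyC !swapXY_polyC !map_polyC /= comp_polyC.
Qed.

Lemma comp_affine_inj (a d : K) : a != 0 -> injective (comp_poly (a *: 'X + d%:P)).
Proof.
move=> a0; apply: (can_inj (g := comp_poly (a^-1 *: 'X - (a^-1 * d)%:P))) => p.
rewrite -comp_polyA comp_polyD comp_polyZ comp_polyX comp_polyC scalerBr scalerA mulfV // scale1r.
by rewrite -mul_polyC -polyCM mulVKf // subrK comp_polyXr.
Qed.

(** [a] scales [y] and [b] scales [x]. The building blocks are those of [tstep], affine compositions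
    and exchanges, which programs have to compute anyway. *)
Definition tscale (a b : K) f : {poly {poly K}} :=
  swapXY (swapXY f \Po (a%:P *: 'X + 0%:P)) \Po (b%:P *: 'X + 0%:P).

Lemma coef_tscale a b f i j : (tscale a b f)`_i`_j = f`_i`_j * b ^+ i * a ^+ j.
Proof.
rewrite /tscale coef_comp_scale -polyC_exp coefCM coef_swapXY coef_comp_scale -polyC_exp coefCM.
by rewrite coef_swapXY mulrA mulrC mulrA.
Qed.

Definition torus f g := exists a b, [/\ a != 0, b != 0 & g = tscale a b f].

Lemma torus_swap f g : torus f g -> torus (swapXY f) (swapXY g).
Proof.
case=> a [b [a0 b0 ->]]; exists b, a; split=> //.
by apply/polyP => i; apply/polyP => j; rewrite coef_swapXY !coef_tscale coef_swapXY mulrAC.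
Qed.

Lemma automorphic_swap f : automorphic (mpoly_of f) (mpoly_of (swapXY f)).
Proof.
rewrite mpoly_of_swap; apply: (@automorphic_comp _ _ _ [tuple 'X_i1; 'X_i0]);
  elim/ord2P; by rewrite comp_mpolyXU.
Qed.

Lemma automorphic_comp_affine f (a : K) (s : {poly K}) : a != 0 ->
  automorphic (mpoly_of f) (mpoly_of (f \Po (a%:P *: 'X + s%:P))).
Proof.
move=> a0; rewrite mpoly_of_comp.
have inner (u : {mpoly K[2]}) : mpoly_of s%:P \mPo [tuple u; 'X_i1] = mpoly_of s%:P.
  rewrite mpoly_of_const /mpoly_of_inner /= /horner_eval -horner_map /= comp_mpolyXU /=.
  by rewrite -map_poly_comp; congr _.[_]; apply: eq_map_poly => x; rewrite /= comp_mpolyC.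
apply: (@automorphic_comp _ _ _ [tuple a^-1 *: ('X_i0 - mpoly_of s%:P); 'X_i1]); elim/ord2P => /=.
- rewrite comp_mpolyD comp_mpolyZ comp_mpolyXU /= inner scalerA mulfV // scale1r subrK //.
- by rewrite comp_mpolyXU.
- by rewrite comp_mpolyZ comp_mpolyB comp_mpolyXU /= inner addrK scalerA mulVf // scale1r.
- by rewrite comp_mpolyXU.
Qed.

Lemma torus_automorphic f g : torus f g -> automorphic (mpoly_of f) (mpoly_of g).
Proof.
case=> a [b [a0 b0 ->]]; rewrite /tscale.
apply: automorphic_trans (automorphic_comp_affine _ _ b0).
apply: automorphic_trans (automorphic_swap _).
apply: automorphic_trans (automorphic_comp_affine _ _ a0).
exact: automorphic_swap.
Qed.
End Torus.

Lemma mlead_max n (R : nzRingType) (p : {mpoly R[n]}) m :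
  p@_m != 0 -> (forall k, p@_k != 0 -> (k <= m)%O) -> mlead p = m.
Proof.
move=> pm le; apply/le_anti; rewrite coef_neq0_le_mlead // andbT; apply: le.
by rewrite mleadc_eq0; apply: contraNneq pm => ->; rewrite mcoeff0.
Qed.

Section Uniqueness.
Variable K : numClosedFieldType.
Implicit Types f g : {poly {poly K}}.

(* For both types the leading monomial in the degree-lexicographic order is a power
   of the inner variable ['X_i1]. *)
Definition inner_line f k := exists2 e, e != 0 & f = (e *: 'X^k)%:P.

Definition inner_edge f (a b l : nat) := [/\ (1 < b)%N, (b < a)%N &
  exists c e, edge_type a b l c e (swapXY f)].

Lemma inner_line_lead f k : inner_line f k -> mlead (mpoly_of f) = (U_(i1) *+ k)%MM.
Proof.
case=> e e0 ->; apply: mlead_max => [|m]; rewrite mcoeff_mpoly_of coefC.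
  by rewrite !mulmnE !mnm1E /= ?mul0n ?mul1n coefZ coefXn eqxx mulr1.
case: (m i0 =P 0%N) => [m0|_]; last by rewrite coef0 eqxx.
rewrite coefZ coefXn; case: (m i1 =P k) => [m1 _|_]; last by rewrite mulr0 eqxx.
rewrite (_ : m = (U_(i1) *+ k)%MM) //.
by apply/mnmP; elim/ord2P; rewrite mulmnE mnm1E /= ?m0 ?m1 ?mul0n ?mul1n.
Qed.

Lemma inner_edge_lead f a b l : inner_edge f a b l -> mlead (mpoly_of f) = (U_(i1) *+ (l * a))%MM.
Proof.
case=> b2 lt_ba [c [e ef]]; have [[a0 b0 l0 _] _ e0 _] := ef.
apply: mlead_max => [|m]; rewrite mcoeff_mpoly_of.
  by rewrite !mulmnE !mnm1E /= ?mul0n ?mul1n -coef_swapXY (edge_coef_lead ef).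
rewrite -coef_swapXY => /(edge_weight ef) le.
have [m0|m0] := posnP (m i0).
  have le1 : (m i1 <= l * a)%N.
    by rewrite -(leq_pmul2l b0) [(b * (l * a))%N]mulnC -mulnA; move: le; rewrite m0 muln0 addn0.
  rewrite (_ : m = (U_(i1) *+ m i1)%MM); first exact: lemc_mulmn.
  by apply/mnmP; elim/ord2P; rewrite mulmnE mnm1E /= ?m0 ?mul0n ?mul1n.
apply/ltW/lt_mdeg_ltmc; rewrite mdegMn mdeg1 mul1n mdeg2 -(ltn_pmul2l b0).
apply: leq_trans (_ : b * m i1 + a * m i0 <= _)%N; last by rewrite [(b * (l * a))%N]mulnC -mulnA.
by rewrite mulnDr addnC ltn_add2l ltn_pmul2r.
Qed.

Lemma inner_edge_form f a b l : inner_edge f a b l ->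
  exists c e, [/\ c != 0, e != 0 & edge_form a b l c e (mpoly_of f)].
Proof.
case=> b2 lt_ba [c [e ef]]; have [_ c0 e0 h] := ef.
exists c, e; split=> // m.
have -> : edge a b l c e = mpoly_of (swapXY (e%:P *: binomialXY a b c ^+ l)).
  pose phi : {rmorphism {poly {poly K}} -> {mpoly K[2]}} := @mpoly_of K \o @swapXY K.
  have phiX : phi 'X = 'X_i1 by rewrite /phi /= swapXY_X mpoly_ofY.
  have phiY : phi 'Y = 'X_i0 by rewrite /phi /= swapXY_Y mpoly_ofX.
  have phiC d : phi d%:P%:P = d%:MP by rewrite /phi /= swapXY_polyC map_polyC mpoly_ofC.
  rewrite -[mpoly_of (swapXY _)]/(phi _) /edge /binomialXY -!mul_polyC -!mul_mpolyC.
  by rewrite (rmorphM phi) (rmorphXn phi) (rmorphB phi) (rmorphM phi) !(rmorphXn phi) !phiC phiX phiY.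
move: h; move: (e%:P *: _) => E h; rewrite mcoeffB !mcoeff_mpoly_of [(swapXY E)`_ _`_ _]coef_swapXY.
by move=> nz; apply: (h (m i1) (m i0)); rewrite !coefB coef_swapXY.
Qed.

(** [U_(i1)] and 1 are the two smallest monomials, since [x] lies above [y]. *)
Lemma mlead_inner_affine (F : {mpoly K[2]}) : mlead F = U_(i1)%MM ->
  F = F@_U_(i1) *: 'X_i1 + (F@_0)%:MP.
Proof.
move=> lF; apply/mpolyP => m; rewrite mcoeffD mcoeffZ mcoeffX mcoeffC.
have [->|m0] := eqVneq m 0%MM.
  by rewrite mnm1_eq0 mulr0 add0r mulr1.
have [<-|m1] := eqVneq U_(i1)%MM m; first by rewrite mulr1 mulr0 addr0.
rewrite !mulr0 addr0; apply: mcoeff_gt_mlead; rewrite lF ltNge.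
apply: contraNN m1 => le; have := lemc_mdeg le; rewrite mdeg1 => d1.
have /mdeg1P[i /eqP Ei] : mdeg m == 1%N.
  by rewrite eqn_leq d1 lt0n mdeg_eq0.
move: le; rewrite Ei; elim/ord2P: i {Ei} => //.
by move/(lemc_fst (etrans (mdeg1 i0) (esym (mdeg1 i1)))); rewrite !mnm1E.
Qed.

(** The equation says [al G_x = kap]; in characteristic 0 it integrates to
    [G = (kap / al) x + h(y)]. *)
Lemma jacobian_mate (G : {mpoly K[2]}) (al ga kap : K) : kap != 0 ->
  bracket (al *: 'X_i1 + ga%:MP) G = kap%:MP ->
  al != 0 /\ exists be h, be != 0 /\ G = mpoly_of (be%:P *: 'X + h%:P).
Proof.
move=> k0; rewrite /bracket !mderivD !mderivZ !mderivC !mderivXU /= scaler0 !addr0 mul0r subr0.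
rewrite -scalerAl mul1r => E.
have al0 : al != 0.
  by apply: contraNneq k0 => al0; move: E; rewrite al0 scale0r => /esym/eqP; rewrite mpolyC_eq0.
split=> //; pose g := bipoly_of G; exists (kap / al), g`_0; split.
  by rewrite mulf_neq0 ?invr_eq0.
have E' m : G@_(m + U_(i0)) *+ (m i0).+1 = kap / al *+ (m == 0%MM).
  rewrite -mcoeff_deriv; apply: (mulfI al0); rewrite -mcoeffZ E mcoeffC mulr_natr mulrnAr mulrCA divff //.
  by rewrite mulr1.
rewrite -[LHS]bipoly_ofK; congr mpoly_of; apply/polyP => -[|i]; rewrite coefD coefZ coefX coefC /=.
  by rewrite mulr0 add0r.
rewrite addr0; apply/polyP => j; rewrite coef_bipoly_of.
have Em : mon i.+1 j = (mon i j + U_(i0))%MM.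
  by apply/mnmP; elim/ord2P; rewrite mnmDE !mnmE /= ?addn1 ?addn0.
have := E' (mon i j); rewrite -Em mon_eq !mnm0E !mnmE /=.
case: i {Em} => [|i] /=; rewrite ?mulr1n ?mulr1 ?mulr0 ?coef0 ?coefC.
  by move=> ->; case: (j =P 0%N).
by move/eqP; rewrite mulrn_eq0 => /eqP.
Qed.

End Uniqueness.

(** * Normalized polynomials up to automorphism *)

Section Classification.
Variable K : numClosedFieldType.
Implicit Types f g : {poly {poly K}}.

Definition inner f := (exists2 k, (0 < k)%N & inner_line f k) \/ (exists a b l, inner_edge f a b l).

Lemma normalized_swap f : normalized f -> normalized (swapXY f).
Proof. by case=> h1 h2; split; rewrite ?swapXYK. Qed.

Lemma normalized_line_inner f : subleading f = 0 -> line_type f ->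
  exists2 k, (0 < k)%N & inner_line (swapXY f) k.
Proof.
move=> sub0 /tsch_line[e [k [e0 k0 E]]]; exists k => //; exists e => //.
by rewrite -swapXY_map_polyC -E /tsch /shift sub0 scaler0 addr0 scale1r comp_polyXr.
Qed.

(** An exponent 1 contradicts [edge_subleading_neq0], and coprime exponents greater than 1 are
    distinct; the exchange puts the longer leg along [y]. *)
Lemma normalized_inner f : parametrized f -> normalized f -> inner f \/ inner (swapXY f).
Proof.
move=> pf [s1 s2]; case: (param_structure pf) => [lf|lf|[A [B [l [c [e ef]]]]]].
- by right; left; apply: normalized_line_inner.
- by left; left; rewrite -[f]swapXYK; apply: normalized_line_inner.
have [[A0 B0 l0 cop] _ _ _] := ef.
have A1 : A != 1%N by apply/eqP => /(edge_subleading_neq0 ef); rewrite s1 eqxx.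
have B1 : B != 1%N by apply/eqP => /(edge_subleading_neq0 (edge_swap ef)); rewrite s2 eqxx.
case: (ltngtP A B) => [lt|gt|eqAB].
- left; right; exists B, A, l; split=> //; first by rewrite ltn_neqAle eq_sym A1.
  by exists c^-1, (e * (- c) ^+ l); apply: edge_swap.
- right; right; exists A, B, l; split=> //; first by rewrite ltn_neqAle eq_sym B1.
  by exists c, e; rewrite swapXYK.
by move: cop B1; rewrite eqAB /coprime gcdnn => ->.
Qed.

Lemma mpoly_of_inner_line (e : K) k : mpoly_of (e *: 'X^k)%:P = e *: 'X_i1 ^+ k.
Proof.
rewrite -mul_polyC polyCM rmorphM /= mpoly_ofC mul_mpolyC; congr (_ *: _).
by rewrite polyC_exp rmorphXn /= mpoly_ofY.
Qed.

(** Here [g = e F^k], so its degree is a positive multiple of [k]. *)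
Lemma automorphic_line_lead f g k n : inner_line f k -> mlead (mpoly_of g) = (U_(i1) *+ n)%MM ->
  (0 < n)%N -> automorphic (mpoly_of f) (mpoly_of g) -> (k <= n)%N.
Proof.
case=> e e0 ->; rewrite mpoly_of_inner_line => lg n0 /automorphic_jacobian[G [F [kap [_ _ Eg]]]].
move: lg; rewrite Eg comp_mpolyZ rmorphXn /= comp_mpolyXU /=.
have [->|F0] := eqVneq F 0.
  rewrite mleadZ // expr0n; case: k {Eg} => [|k] //=; rewrite mlead0 => /(congr1 (@mdeg 2)).
  by rewrite mdeg0 mdegMn mdeg1 mul1n => E; rewrite -E in n0.
rewrite mleadZ // mleadX // => /(congr1 (@mdeg 2)); rewrite !mdegMn mdeg1 mul1n => E.
rewrite -E leq_pmull // lt0n; apply: contraTneq n0 => F1.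
by rewrite -E F1.
Qed.

Lemma inner_lead f : inner f -> exists2 n, (0 < n)%N & mlead (mpoly_of f) = (U_(i1) *+ n)%MM.
Proof.
case=> [[k k0 /inner_line_lead lf]|[a [b [l ef]]]]; first by exists k.
exists (l * a)%N; last exact: inner_edge_lead ef.
by case: ef => b2 lt_ba [c [e [[? ? ?]]]]; rewrite muln_gt0; lia.
Qed.

Lemma inner_lead_le f g n m : inner f -> inner g ->
    mlead (mpoly_of f) = (U_(i1) *+ n)%MM -> mlead (mpoly_of g) = (U_(i1) *+ m)%MM ->
  automorphic (mpoly_of f) (mpoly_of g) -> (n <= m)%N.
Proof.
have U j k : (U_(i1) *+ j = U_(i1) *+ k :> 'X_{1..2})%MM -> j = k.
  by move/(congr1 (@mdeg 2)); rewrite !mdegMn mdeg1 !mul1n.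
move=> inf ing lf lg aut; have [m' m0] := inner_lead ing; rewrite lg => /U Em; subst m'.
case: inf => [[k k0 lf']|[a [b [l ef]]]].
  move: (inner_line_lead lf'); rewrite lf => /U ->.
  exact: (automorphic_line_lead lf' lg m0 aut).
move: (inner_edge_lead ef); rewrite lf => /U ->.
have [G [F [kap [kap0 jac Eg]]]] := automorphic_jacobian aut.
have [c' [e' [c0 e0 form]]] := inner_edge_form ef.
case: (ef) => b2 lt_ba [c [e [[_ _ l0 cop] _ _ _]]].
rewrite Eg in lg.
exact: (edge_form_lower_bound e0 b2 lt_ba l0 cop form c0 kap0 jac lg).1.
Qed.

Lemma torus_lines f g k : (0 < k)%N -> inner_line f k -> inner_line g k -> torus f g.
Proof.
move=> k0 [e e0 Ef] [e' e'0 Eg].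
have [a Ea] := closed_expr_root (e' / e) k0.
have a0 : a != 0.
  have : a ^+ k != 0 by rewrite Ea mulf_neq0 ?invr_eq0.
  by rewrite expf_eq0 k0.
exists a, 1; split; rewrite ?oner_eq0 //.
apply/polyP => i; apply/polyP => j; rewrite coef_tscale expr1n mulr1 Ef Eg !coefC.
case: i => [|i] /=; rewrite ?coef0 ?mul0r // !coefZ !coefXn.
by case: (j =P k) => [->|_]; rewrite ?mulr0 ?mul0r // !mulr1 Ea mulrC divfK.
Qed.

Lemma size_inner_edge f a b l : inner_edge f a b l ->
  [/\ size f = (l * b).+1, size (swapXY f) = (l * a).+1, (0 < l * b)%N, (0 < l * a)%N &
   exists e e', [/\ e != 0, e' != 0, lead_coef f = e%:P & lead_coef (swapXY f) = e'%:P]].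
Proof.
case=> b2 lt_ba [c [e ef]]; have ef' := edge_swap ef; rewrite swapXYK in ef'.
have [[a0 b0 l0 _] _ e0 _] := ef; have [_ _ e0' _] := ef'.
rewrite (edge_size ef) (edge_size ef') !muln_gt0 l0 a0 b0; split=> //.
by exists (e * (- c) ^+ l), e; rewrite (edge_lead_coef ef) (edge_lead_coef ef').
Qed.

Lemma comp_mpoly_pair (P a b : {mpoly K[2]}) (t : 2.-tuple {mpoly K[2]}) :
  (P \mPo [tuple a; b]) \mPo t = P \mPo [tuple a \mPo t; b \mPo t].
Proof. exact: comp_mpoly2A. Qed.

Lemma comp_affine_chain (P H : {mpoly K[2]}) (al ga be : K) :
  (((P \mPo [tuple 'X_i1; 'X_i0]) \mPo [tuple al *: 'X_i0 + ga%:MP; 'X_i1]) \mPo [tuple 'X_i1; 'X_i0])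
    \mPo [tuple be *: 'X_i0 + H; 'X_i1] = P \mPo [tuple be *: 'X_i0 + H; al *: 'X_i1 + ga%:MP].
Proof.
rewrite (comp_mpoly_pair P) !comp_mpolyXU /= (comp_mpoly_pair P).
rewrite comp_mpolyXU /= comp_mpolyD comp_mpolyZ comp_mpolyC comp_mpolyXU /= (comp_mpoly_pair P).
by rewrite comp_mpolyXU /= comp_mpolyD comp_mpolyZ comp_mpolyC comp_mpolyXU.
Qed.

Lemma torus_sym f g : torus f g -> torus g f.
Proof.
case=> a [b [a0 b0 ->]]; exists a^-1, b^-1; rewrite !invr_eq0; split=> //.
apply/polyP => i; apply/polyP => j; rewrite !coef_tscale -!mulrA mulrCA.
rewrite !exprVn [a ^+ j * _]mulrCA divff ?expf_neq0 // mulr1 mulrC.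
by rewrite -mulrA mulVf ?mulr1 ?expf_neq0.
Qed.

Theorem inner_edge_unique f g a b l : inner_edge f a b l -> inner g ->
    normalized f -> normalized g -> automorphic (mpoly_of f) (mpoly_of g) -> torus f g.
Proof.
move=> ef ing nf ng aut.
have lf := inner_edge_lead ef; have [m m0 lg] := inner_lead ing.
have inf : inner f by right; exists a, b, l.
have Em : m = (l * a)%N.
  apply/eqP; rewrite eqn_leq (inner_lead_le inf ing lf lg aut).
  by rewrite (inner_lead_le ing inf lg lf (automorphic_sym aut)).
have [G [F [kap [kap0 jac Eg]]]] := automorphic_jacobian aut.
have [c' [e' [c0 e0 form]]] := inner_edge_form ef.
have lF : mlead F = U_(i1)%MM.
  case: (ef) => b2 lt_ba [c [e [[_ _ l0 cop] _ _ _]]].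
  have lq := lg; rewrite Eg in lq.
  exact: (edge_form_lower_bound e0 b2 lt_ba l0 cop form c0 kap0 jac lq).2.
have EF := mlead_inner_affine lF; move: EF; set al := F@__; set ga := F@__ => EF.
rewrite EF in jac; have [al0 [be [h [be0 EG]]]] := jacobian_mate kap0 jac.
pose f1 := swapXY (swapXY f \Po (al%:P *: 'X + ga%:P%:P)).
have Ef1 : f1 = map_poly (comp_poly (al *: 'X + ga%:P)) f by rewrite /f1 swap_comp_affine swapXYK.
(* The substitution is split into an affine change of [y] and then [x -> be x + h(y)], so that
   [subleading_comp_affine] applies to each variable in turn. It makes [subleading g] a nonzero
   multiple of [h] and, once [h = 0], the one in [y] a nonzero multiple of [ga]. *)
have Egf : g = f1 \Po (be%:P *: 'X + h%:P).
  apply: mpoly_of_inj; rewrite mpoly_of_comp /f1 mpoly_of_swap mpoly_of_comp mpoly_of_swap Eg mpoly_ofC.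
  move: (mpoly_of f) => P; rewrite (comp_affine_chain P) -EF EG rmorphD -mul_polyC.
  by rewrite [X in X + _]rmorphM /= mpoly_ofC mpoly_ofX mul_mpolyC.
have [sf ssf lb0 la0 [e1 [e2 [e10 e20 L1 L2]]]] := size_inner_edge ef.
have N0 k : (0 < k)%N -> forall x : {poly K}, x *+ k = 0 -> x = 0.
  by move=> k0 x /eqP; rewrite -scaler_nat scaler_eq0 pnatr_eq0 eqn0Ngt k0 => /eqP.
have h0 : h = 0.
  have : subleading g = 0 by case: ng.
  rewrite Egf subleading_comp_affine ?polyC_eq0 // Ef1 subleading_map; last exact: comp_affine_inj.
  have [-> _] := nf.
  rewrite rmorph0 add0r lead_coef_map_inj ?rmorph0 //; last exact: comp_affine_inj.
  rewrite size_map_inj_poly ?rmorph0 //; last exact: comp_affine_inj.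
  rewrite L1 sf /= comp_polyC => /eqP.
  rewrite mulf_eq0 expf_eq0 polyC_eq0 (negPf be0) andbF /= => /eqP/(N0 _ lb0)/eqP.
  by rewrite mulf_eq0 polyC_eq0 (negPf e10) => /eqP.
have ga0 : ga = 0.
  have : subleading (swapXY g) = 0 by case: ng.
  rewrite Egf h0 -[0]polyC0 swap_comp_affine subleading_map; last exact: comp_affine_inj.
  rewrite /f1 swapXYK subleading_comp_affine ?polyC_eq0 //; have [_ ->] := nf.
  rewrite add0r L2 ssf /= -polyCM => E.
  have {E} /eqP : al%:P ^+ (l * a).-1 * ((e2 * ga)%:P *+ (l * a)) = 0.
    by apply: (comp_affine_inj (d := 0) be0); rewrite comp_poly0; exact: E.
  rewrite mulf_eq0 expf_eq0 polyC_eq0 (negPf al0) andbF /= => /eqP/(N0 _ la0)/eqP.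
  by rewrite polyC_eq0 mulf_eq0 (negPf e20) => /eqP.
by exists al, be; split=> //; rewrite Egf /f1 h0 ga0.
Qed.

Lemma inner_unique f g : inner f -> inner g -> normalized f -> normalized g ->
  automorphic (mpoly_of f) (mpoly_of g) -> torus f g.
Proof.
move=> inf ing nf ng aut; case: (inf) => [[k k0 lf]|[a [b [l ef]]]]; last exact: inner_edge_unique ef _ _ _ _.
case: (ing) => [[k' k'0 lg]|[a [b [l eg]]]].
  have Ek : k = k'.
    apply/eqP; rewrite eqn_leq.
    rewrite (automorphic_line_lead lf (inner_line_lead lg) k'0 aut).
    exact: automorphic_line_lead lg (inner_line_lead lf) k0 (automorphic_sym aut).
  by rewrite -Ek in lg; apply: torus_lines k0 lf lg.
exact/torus_sym/(inner_edge_unique eg inf ng nf (automorphic_sym aut)).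
Qed.

(** The exchange is itself an automorphism, so [f] and [g] can be put in [inner] position
    separately; an exchange remains in the conclusion when just one of them was exchanged. *)
Theorem automorphic_normalized f g : parametrized f -> parametrized g ->
    normalized f -> normalized g ->
  automorphic (mpoly_of f) (mpoly_of g) <-> torus f g \/ torus f (swapXY g).
Proof.
move=> pf pg nf ng; split=> [aut|[/torus_automorphic//|/torus_automorphic aut]]; last first.
  exact: automorphic_trans aut (automorphic_sym (automorphic_swap g)).
have [nf' ng'] := (normalized_swap nf, normalized_swap ng).
have autf := automorphic_trans (automorphic_sym (automorphic_swap f)) aut.
have autg h (a : automorphic (mpoly_of h) (mpoly_of g)) := automorphic_trans a (automorphic_swap g).
case: (normalized_inner pf nf) => inf; case: (normalized_inner pg ng) => ing.
- by left; apply: inner_unique.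
- by right; apply: inner_unique (autg _ _).
- by right; rewrite -[f]swapXYK; apply/torus_swap/inner_unique.
- by left; rewrite -[f]swapXYK -[g]swapXYK; apply/torus_swap/inner_unique/autg.
Qed.

End Classification.

(** * Programs for polynomial arithmetic *)

Section Computable.
Variable K : fieldType.

Class encoding (X : Type) := enc : X -> data K.

#[export] Instance enc_atom : encoding K := @Atom K.
#[export] Instance enc_bool : encoding bool := @data_of_bool K.
#[export] Instance enc_pair X Y `{encoding X} `{encoding Y} : encoding (X * Y) :=
  fun xy => Node (enc xy.1) (enc xy.2).
#[export] Instance enc_seq X `{encoding X} : encoding (seq X) :=
  fun s => data_of_seq [seq enc x | x <- s].
#[export] Instance enc_poly (A : nzRingType) `{encoding A} : encoding {poly A} :=
  fun p => enc (polyseq p).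

(** One program serves every choice of [roots], so these functions combine freely with those that
    call root extraction. *)
Definition computable X Y `{encoding X} `{encoding Y} (f : X -> Y) :=
  exists P, forall roots x, eval roots P (enc x) (enc (f x)).

Lemma eq_computable X Y `{encoding X} `{encoding Y} (f g : X -> Y) :
  f =1 g -> computable f -> computable g.
Proof. by move=> E [P HP]; exists P => r x; rewrite -E. Qed.

Section Combinators.
Context {X Y Z E : Type} `{encoding X} `{encoding Y} `{encoding Z} `{encoding E}.

Lemma computable_id : computable (fun x : X => x).
Proof. by exists (Prim PId) => r x; apply: EvalPrim. Qed.

Lemma computable_comp (f : X -> Y) (g : Y -> Z) :
  computable g -> computable f -> computable (fun x => g (f x)).
Proof. by case=> [Q HQ] [P HP]; exists (Seq P Q) => r x; apply: EvalSeq. Qed.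

Lemma computable_pair (f : X -> Y) (g : X -> Z) :
  computable f -> computable g -> computable (fun x => (f x, g x)).
Proof. by case=> [P HP] [Q HQ]; exists (Pair P Q) => r x; apply: EvalPair. Qed.

Lemma computable_fst : computable (fun p : X * Y => p.1).
Proof. by exists (Prim PHead) => r [x y]; apply: EvalPrim. Qed.

Lemma computable_snd : computable (fun p : X * Y => p.2).
Proof. by exists (Prim PTail) => r [x y]; apply: EvalPrim. Qed.

Lemma computable_if (b : X -> bool) (f g : X -> Y) :
  computable b -> computable f -> computable g -> computable (fun x => if b x then f x else g x).
Proof.
case=> [T HT] [P HP] [Q HQ]; exists (If T P Q) => r x; have := HT r x.
case Eb : (b x) => HT'; last by apply: EvalIfFalse HT' _ (HQ r x).
exact: EvalIfTrue HT' _ (HP r x).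
Qed.

Lemma computable_nil : computable (fun _ : X => [::] : seq Y).
Proof. by exists (Prim PLeaf) => r x; apply: EvalPrim. Qed.

Lemma computable_cons (f : X -> Y) (g : X -> seq Y) :
  computable f -> computable g -> computable (fun x => f x :: g x).
Proof. by case=> [P HP] [Q HQ]; exists (Pair P Q) => r x; apply: EvalPair. Qed.

Lemma computable_false : computable (fun _ : X => false).
Proof. by exists (Prim PLeaf) => r x; apply: EvalPrim. Qed.

Lemma computable_true : computable (fun _ : X => true).
Proof. by exists (Prim POne) => r x; apply: EvalPrim. Qed.

Lemma computable_behead : computable (fun s : seq X => behead s).
Proof. by exists (Prim PTail) => r [|x s]; apply: EvalPrim. Qed.

Lemma computable_head (x0 : X) :
  computable (fun _ : seq X => x0) -> computable (fun s : seq X => head x0 s).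
Proof.
case=> P HP; exists (If (Prim PIsLeaf) P (Prim PHead)) => r [|x s].
  by apply: EvalIfTrue (EvalPrim _ _ _) _ (HP _ _).
by apply: EvalIfFalse (EvalPrim _ _ _) _ (EvalPrim _ _ _).
Qed.

(* The state of the loop is the triple of the accumulator, of the remaining list and
   of the parameters. *)
Lemma computable_foldl (g : (Y * X) * E -> Y) (i : E -> Y) (l : E -> seq X) :
  computable g -> computable i -> computable l ->
  computable (fun e => foldl (fun y x => g ((y, x), e)) (i e) (l e)).
Proof.
case=> [G HG] [I HI] [L HL].
pose Hd := Seq (Prim PTail) (Seq (Prim PHead) (Prim PHead)).
pose Tl := Seq (Prim PTail) (Seq (Prim PHead) (Prim PTail)).
pose Env := Seq (Prim PTail) (Prim PTail).
pose T := If (Seq (Prim PTail) (Seq (Prim PHead) (Prim PIsLeaf))) (Prim PLeaf) (Prim POne).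
pose body := Pair (Seq (Pair (Pair (Prim PHead) Hd) Env) G) (Pair Tl Env).
exists (Seq (Pair I (Pair L (Prim PId))) (Seq (While T body) (Prim PHead))) => r e.
have pr o d d' : d' = run_primitive r o d -> eval r (Prim o) d d' by move->; apply: EvalPrim.
apply: (EvalSeq (EvalPair (HI r e) (EvalPair (HL r e) (pr PId (enc e) (enc e) erefl)))).
have loop (y : Y) (s : seq X) : eval r (While T body) (Node (enc y) (Node (enc s) (enc e)))
    (Node (enc (foldl (fun y x => g ((y, x), e)) y s)) (Node Leaf (enc e))); last first.
  by apply: (EvalSeq (loop _ _)); apply: pr.
elim: s y => [|x s IH] y.
  apply: (@EvalWhileFalse _ _ _ _ _ Leaf) => //.
  apply: (@EvalIfTrue _ _ _ _ _ _ (Atom 1)) => //; last exact: pr.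
  by apply: EvalSeq (EvalPrim _ _ _) _; apply: EvalSeq (EvalPrim _ _ _) _; apply: pr.
apply: (@EvalWhileTrue _ _ _ _ _ (Atom 1)) (IH _) => //.
  apply: (@EvalIfFalse _ _ _ _ _ _ Leaf) => //; last exact: pr.
  by apply: EvalSeq (EvalPrim _ _ _) _; apply: EvalSeq (EvalPrim _ _ _) _; apply: pr.
apply: EvalPair.
  apply: EvalSeq; last exact: HG.
  apply: EvalPair; first apply: EvalPair.
  - exact: pr.
  - by do 2!(apply: EvalSeq; first exact: EvalPrim); apply: pr.
  - by apply: EvalSeq; [exact: EvalPrim | apply: pr].
apply: EvalPair; last by apply: EvalSeq; [exact: EvalPrim | apply: pr].
by do 2!(apply: EvalSeq; first exact: EvalPrim); apply: pr.
Qed.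

End Combinators.

Lemma computable2 X A B C `{encoding X} `{encoding A} `{encoding B} `{encoding C}
    (F : A -> B -> C) (a : X -> A) (b : X -> B) :
  computable (fun p => F p.1 p.2) -> computable a -> computable b ->
  computable (fun x => F (a x) (b x)).
Proof. by move=> cF ca cb; apply: (computable_comp cF (computable_pair ca cb)). Qed.

Lemma computable_rev X `{encoding X} : computable (fun s : seq X => rev s).
Proof.
pose g (t : (seq X * X) * seq X) := t.1.2 :: t.1.1.
apply: (eq_computable (f := fun s => foldl (fun y x => g ((y, x), s)) [::] s)).
  by move=> s; rewrite /g /rev; elim: s [::] => //= x s IH t; rewrite IH.
apply: (computable_foldl (g := g)); [|exact: computable_nil|exact: computable_id].
apply: computable_cons; apply: computable_comp (@computable_fst _ _ _ _).
  exact: computable_snd.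
exact: computable_fst.
Qed.

Lemma computable_foldr X Y E `{encoding X} `{encoding Y} `{encoding E}
    (g : (Y * X) * E -> Y) (i : E -> Y) (l : E -> seq X) :
  computable g -> computable i -> computable l ->
  computable (fun e => foldr (fun x y => g ((y, x), e)) (i e) (l e)).
Proof.
move=> cg ci cl.
apply: (eq_computable (f := fun e => foldl (fun y x => g ((y, x), e)) (i e) (rev (l e)))).
  by move=> e; rewrite foldl_rev.
apply: computable_foldl => //; exact: (computable_comp (@computable_rev X _) cl).
Qed.

End Computable.

Section Projections.
Context {K : fieldType} {E X Y : Type} `{encoding K E} `{encoding K X} `{encoding K Y}.

Lemma computable_fst_of (f : E -> X * Y) : computable f -> computable (fun e => (f e).1).
Proof. exact: computable_comp (@computable_fst _ _ _ _ _). Qed.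

Lemma computable_behead_of (f : E -> seq X) : computable f -> computable (fun e => behead (f e)).
Proof. exact: computable_comp (@computable_behead _ _ _). Qed.

Lemma computable_head_of (x0 : X) (f : E -> seq X) :
  computable (fun _ : seq X => x0) -> computable f -> computable (fun e => head x0 (f e)).
Proof. by move=> c0; apply: computable_comp; apply: computable_head. Qed.

Lemma computable_snd_of (f : E -> X * Y) : computable f -> computable (fun e => (f e).2).
Proof. exact: computable_comp (@computable_snd _ _ _ _ _). Qed.
End Projections.

Lemma computable_foldR (K : fieldType) E X Y `{encoding K E} `{encoding K X} `{encoding K Y}
    (G : E -> X -> Y -> Y) (i : E -> Y) (l : E -> seq X) :
  computable (fun t : (Y * X) * E => G t.2 t.1.2 t.1.1) -> computable i -> computable l ->
  computable (fun e => foldr (G e) (i e) (l e)).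
Proof. exact: (computable_foldr (g := fun t : (Y * X) * E => G t.2 t.1.2 t.1.1)). Qed.

Lemma computable_foldL (K : fieldType) E X Y `{encoding K E} `{encoding K X} `{encoding K Y}
    (G : E -> Y -> X -> Y) (i : E -> Y) (l : E -> seq X) :
  computable (fun t : (Y * X) * E => G t.2 t.1.1 t.1.2) -> computable i -> computable l ->
  computable (fun e => foldl (G e) (i e) (l e)).
Proof. exact: (computable_foldl (g := fun t : (Y * X) * E => G t.2 t.1.1 t.1.2)). Qed.

Ltac projections := lazymatch goal with
  | |- computable fst => exact: computable_fst
  | |- computable snd => exact: computable_snd
  | |- computable (fun e => e) => exact: computable_id
  | |- computable (fun e => (@?f e).1) => apply: (computable_fst_of (f := f)); projections
  | |- computable (fun e => (@?f e).2) => apply: (computable_snd_of (f := f)); projections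
  end.

(** This interface passes from [A] to [{poly A}]; applied twice to [K], it covers bivariate
    polynomials. *)
Record computable_ring {K : fieldType} (A : comNzRingType) `{encoding K A} : Prop := ComputableRing {
  computable_0 : forall X `{encoding K X}, computable (fun _ : X => 0 : A);
  computable_1 : forall X `{encoding K X}, computable (fun _ : X => 1 : A);
  computable_add : computable (fun p : A * A => p.1 + p.2);
  computable_opp : computable (fun a : A => - a);
  computable_mul : computable (fun p : A * A => p.1 * p.2);
  computable_eq0 : computable (fun a : A => a == 0) }.

Arguments computable_ring {K} A {_}.

Section RingOps.
Context {K : fieldType} {A : comNzRingType} `{encoding K A}.
Hypothesis cA : computable_ring A.
Context {E : Type} `{encoding K E}.
Implicit Types a b : E -> A.

Lemma computableD a b : computable a -> computable b -> computable (fun e => a e + b e).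
Proof. exact: (computable2 (F := +%R) (computable_add cA)). Qed.

Lemma computableM a b : computable a -> computable b -> computable (fun e => a e * b e).
Proof. exact: (computable2 (F := *%R) (computable_mul cA)). Qed.

Lemma computableN a : computable a -> computable (fun e => - a e).
Proof. exact: (computable_comp (computable_opp cA)). Qed.

Lemma computable_is0 a : computable a -> computable (fun e => a e == 0).
Proof. exact: (computable_comp (computable_eq0 cA)). Qed.

Lemma computable_eq a b : computable a -> computable b -> computable (fun e => a e == b e).
Proof.
move=> ca cb; apply: (eq_computable (f := fun e => a e - b e == 0)) => [e|].
  exact: subr_eq0.
by apply: computable_is0; apply: computableD => //; apply: computableN.
Qed.

End RingOps.

(** * Arithmetic on coefficient lists *)

Section PolyOps.
Context {K : fieldType} {A : comNzRingType} `{encoding K A}.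
Hypothesis cA : computable_ring A.

Lemma computable_polyseq : computable (fun p : {poly A} => p : seq A).
Proof. by exists (Prim PId) => r p; apply: EvalPrim. Qed.

Section Closure.
Context {E : Type} `{encoding K E}.
Implicit Types (a : E -> A) (p q : E -> {poly A}).

Lemma computable_poly0 : computable (fun _ : E => 0 : {poly A}).
Proof.
exists (Prim PLeaf) => r x; have -> : enc (0 : {poly A}) = Leaf by rewrite /enc /enc_poly polyseq0.
exact: EvalPrim.
Qed.

(** Coefficient lists have a nonzero last entry, so putting 0 in front of the zero polynomial must
    give [Leaf]; hence the zero test of [A]. The operations below build their results with this one
    and so remain normalized. *)
Lemma computable_cons_poly a p :
  computable a -> computable p -> computable (fun e => cons_poly (a e) (p e)).
Proof.
apply: (computable2 (F := @cons_poly A)).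
have [Z HZ] := computable_eq0 cA.
exists (If (Seq (Prim PTail) (Prim PIsLeaf))
  (If (Seq (Prim PHead) Z) (Prim PLeaf) (Prim PId)) (Prim PId)) => r [x s] /=.
have E1 : enc (x, s) = Node (enc x) (enc (s : seq A)) by [].
have E2 : enc (cons_poly x s) = if nilp s && (x == 0) then Leaf else Node (enc x) (enc (s : seq A)).
  rewrite /enc /enc_poly polyseq_cons; case: (altP nilP) => [->|_] //=.
  by rewrite polyseqC; case: eqP.
have test : eval r (Seq (Prim PTail) (Prim PIsLeaf)) (enc (x, s)) (enc (nilp s)).
  apply: EvalSeq (EvalPrim _ _ _) _; rewrite E1 /=.
  have -> : enc (nilp s) = run_primitive r PIsLeaf (enc (s : seq A)) by case: (s : seq A).
  exact: EvalPrim.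
have id_eval : eval r (Prim PId) (enc (x, s)) (Node (enc x) (enc (s : seq A))) by exact: EvalPrim.
rewrite E2; case En : (nilp s) test => test; last by apply: EvalIfFalse test _ _.
apply: EvalIfTrue test _ _ => //=.
have test0 : eval r (Seq (Prim PHead) Z) (enc (x, s)) (enc (x == 0)).
  by apply: EvalSeq (EvalPrim _ _ _) _; apply: HZ.
case Ex : (x == 0) test0 => test0; last by apply: EvalIfFalse test0 _ _.
by apply: EvalIfTrue test0 _ (EvalPrim _ _ _).
Qed.

Lemma computable_polyC a : computable a -> computable (fun e => (a e)%:P).
Proof.
move=> ca; apply: (eq_computable (f := fun e => cons_poly (a e) 0)) => [e|].
  by rewrite cons_poly_def mul0r add0r.
exact: computable_cons_poly ca computable_poly0.
Qed.

End Closure.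

Section Folds.
Context {E : Type} `{encoding K E}.
Implicit Types (a : E -> A) (p q : E -> {poly A}).

Lemma computable_fold_cons B `{encoding K B} (c : E -> B -> A) (p0 : E -> {poly A}) (s : E -> seq B) :
  computable (fun t : B * E => c t.2 t.1) -> computable p0 -> computable s ->
  computable (fun e => foldr (fun x y => cons_poly (c e x) y) (p0 e) (s e)).
Proof.
move=> cc; apply: (computable_foldR (G := fun e x y => cons_poly (c e x) y)) => /=.
apply: computable_cons_poly; last by projections.
by apply: (computable2 (F := fun x e => c e x) (a := fun t => t.1.2) (b := fun t => t.2)) => //; projections.
Qed.

Lemma computable_Poly s : computable s -> computable (fun e : E => Poly (s e)).
Proof.
move=> cs; apply: (computable_fold_cons (c := fun _ x => x)) => //; first by projections.
exact: computable_poly0.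
Qed.

Lemma fold_cons_poly B (c : B -> A) (s : seq B) :
  foldr (fun x y => cons_poly (c x) y) 0 s = Poly (map c s).
Proof. by elim: s => //= x s ->. Qed.

Lemma computable_scale a p : computable a -> computable p -> computable (fun e => a e *: p e).
Proof.
move=> ca cp.
apply: (eq_computable (f := fun e => foldr (fun x y => cons_poly (a e * x) y) 0 (p e))) => [e|].
  by rewrite fold_cons_poly; apply/polyP => i; rewrite coef_Poly coefZ; have [lt|le] := ltnP i (size (p e));
    [rewrite (nth_map 0) | rewrite !nth_default ?size_map ?mulr0].
apply: (computable_fold_cons (c := fun e x => a e * x)); last exact: (computable_comp computable_polyseq cp).
  by apply: (computableM cA); first apply: (computable_comp ca (f := fun t => t.2)); projections.
exact: computable_poly0.
Qed.

Lemma computable_poly_opp p : computable p -> computable (fun e => - p e).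
Proof.
move=> cp; apply: (eq_computable (f := fun e => -1 *: p e)) => [e|]; first by rewrite scaleN1r.
by apply: computable_scale => //; apply: (computableN cA); apply: (computable_1 cA).
Qed.

Lemma computable_poly_is0 p : computable p -> computable (fun e => p e == 0).
Proof.
have cz : computable (fun q : {poly A} => q == 0).
  exists (Prim PIsLeaf) => r q.
  have -> : enc (q == 0) = run_primitive r PIsLeaf (enc q); last exact: EvalPrim.
  by rewrite -nil_poly /enc /enc_poly; case: (q : seq A).
exact: (computable_comp cz).
Qed.

End Folds.

(** Addition by folds over one list: the first fold consumes the other list and stacks the sums in
    reverse, and a second fold puts them back in front of what is left of that list. *)
Let add_state (st : seq A * seq A) (x : A) := (behead st.1, (x + head 0 st.1) :: st.2).

Lemma fold_add_state (s t out : seq A) : let st := foldl add_state (t, out) s in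
  foldl (fun p x => cons_poly x p) (Poly st.1) st.2
  = foldl (fun p x => cons_poly x p) (Poly s + Poly t) out.
Proof.
elim: s t out => [|x s IH] t out /=; first by rewrite add0r.
rewrite IH /= !cons_poly_def; congr (foldl _ _ _).
case: t => [|y t] /=; first by rewrite !addr0.
by rewrite cons_poly_def polyCD mulrDl; ring.
Qed.

Section Add.
Context {E : Type} `{encoding K E}.
Implicit Types (a : E -> A) (p q : E -> {poly A}).

Lemma computable_poly_add p q : computable p -> computable q -> computable (fun e => p e + q e).
Proof.
move=> cp cq; pose st e := foldl add_state (q e : seq A, [::]) (p e).
apply: (eq_computable (f := fun e => foldl (fun y x => cons_poly x y) (Poly (st e).1) (st e).2)) => [e|].
  by rewrite /st fold_add_state !polyseqK.
have cst : computable st.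
  apply: (computable_foldL (G := fun=> add_state)); first 1 last.
  - apply: computable_pair; first exact: (computable_comp computable_polyseq cq).
    exact: computable_nil.
  - exact: (computable_comp computable_polyseq cp).
  apply: computable_pair; first by apply: (computable_behead_of (f := fun t => t.1.1.1)); projections.
  apply: computable_cons; last by projections.
  apply: (computableD cA); first by projections.
  apply: (computable_head_of (f := fun t => t.1.1.1)); first exact: (computable_0 cA).
  by projections.
apply: (computable_foldL (G := fun _ y x => cons_poly x y)).
- by apply: computable_cons_poly; projections.
- by apply: computable_Poly; apply: computable_fst_of.
- exact: computable_snd_of.
Qed.
End Add.

Section Mul.
Context {E : Type} `{encoding K E}.
Implicit Types (a : E -> A) (p q : E -> {poly A}).
Lemma computable_poly_mul p q : computable p -> computable q -> computable (fun e => p e * q e).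
Proof.
move=> cp cq.
apply: (eq_computable (f := fun e => foldr (fun x y => x *: q e + cons_poly 0 y) 0 (p e))) => [e|].
  rewrite -[in RHS](polyseqK (p e)); elim: (polyseq (p e)) => [|x s IH] /=; first by rewrite mul0r.
  by rewrite IH !cons_poly_def polyC0 addr0 mulrDl mul_polyC addrC mulrAC.
apply: (computable_foldR (G := fun e x y => x *: q e + cons_poly 0 y)); first 1 last.
- exact: computable_poly0.
- exact: (computable_comp computable_polyseq cp).
apply: computable_poly_add.
  by apply: computable_scale; [projections | apply: (computable_comp cq (f := fun t => t.2)); projections].
apply: computable_cons_poly; last by projections.
exact: (computable_0 cA).
Qed.
End Mul.

Lemma poly_computable_ring : computable_ring {poly A}.
Proof.
split.
- by move=> X HX; apply: computable_poly0.
- by move=> X HX; apply: computable_polyC; apply: (computable_1 cA).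
- by apply: computable_poly_add; projections.
- by apply: computable_poly_opp; projections.
- by apply: computable_poly_mul; projections.
- by apply: computable_poly_is0; projections.
Qed.

End PolyOps.

Section Base.
Variable K : fieldType.

Lemma atom_computable_ring : computable_ring K.
Proof.
split.
- by move=> X HX; exists (Prim PZero) => r x; apply: EvalPrim.
- by move=> X HX; exists (Prim POne) => r x; apply: EvalPrim.
- by exists (Prim PAdd) => r x; apply: EvalPrim.
- by exists (Prim POpp) => r x; apply: EvalPrim.
- by exists (Prim PMul) => r x; apply: EvalPrim.
exists (Seq (Pair (Prim PId) (Prim PZero)) (Prim PEqAtom)) => r x.
exact: EvalSeq (EvalPair (EvalPrim _ _ _) (EvalPrim _ _ _)) (EvalPrim _ _ _).
Qed.

Lemma computable_inv E `{encoding K E} (a : E -> K) :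
  computable a -> computable (fun e => (a e)^-1).
Proof.
have ci : computable (fun x : K => x^-1) by exists (Prim PInv) => r x; apply: EvalPrim.
exact: (computable_comp ci).
Qed.

End Base.

Section PolyFunctions.
Context {K : fieldType} {A : comNzRingType} `{encoding K A}.
Hypothesis cA : computable_ring A.
Context {E : Type} `{encoding K E}.
Implicit Types (f : E -> {poly A}).

Lemma computable_polyseq_of f : computable f -> computable (fun e => f e : seq A).
Proof. exact: (computable_comp computable_polyseq). Qed.

Lemma computable_coef0 f : computable f -> computable (fun e => (f e)`_0).
Proof.
move=> cf; apply: (eq_computable (f := fun e => head 0 (f e : seq A))) => [e|]; first by rewrite nth0.
by apply: (computable_head_of (f := fun e => f e : seq A));
  [apply: (computable_0 cA) | apply: computable_polyseq_of].
Qed.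

Lemma computable_lead_coef f : computable f -> computable (fun e => lead_coef (f e)).
Proof.
move=> cf; apply: (eq_computable (f := fun e => foldl (fun _ x => x) 0 (f e : seq A))) => [e|].
  by rewrite lead_coefE nth_last; elim: (polyseq (f e)) (0 : A) => //=.
apply: (computable_foldL (G := fun _ _ x => x)) (computable_polyseq_of cf); first by projections.
exact: (computable_0 cA).
Qed.

(** The degree enters [shift] only as an element of [K], so it is counted by adding 1 in the
    field. *)
Lemma computable_degree f : computable f -> computable (fun e => (size (f e)).-1%:R : K).
Proof.
move=> cf; pose F e : K := foldl (fun y _ => y + 1) 0 (behead (f e : seq A)).
apply: (eq_computable (f := F)) => [e|].
  rewrite /F -size_behead; have aux (s : seq A) (a : K) : foldl (fun y _ => y + 1) a s = a + (size s)%:R.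
    by elim: s a => [|x s IH] a /=; rewrite ?addr0 // IH -addrA [1 + _]addrC natr1.
  by rewrite aux add0r.
apply: (computable_foldL (G := fun _ y _ => y + 1)).
- apply: (computableD (atom_computable_ring K)); first by projections.
  exact: (computable_1 (atom_computable_ring K)).
- exact: (computable_0 (atom_computable_ring K)).
- by apply: computable_behead_of; apply: computable_polyseq_of.
Qed.

(** Horner's rule, with the multiplication by the variable done by [cons_poly]. *)
Lemma computable_comp_affine f (a b : E -> A) : computable f -> computable a -> computable b ->
  computable (fun e => f e \Po (a e *: 'X + (b e)%:P)).
Proof.
move=> cf ca cb; pose G e x y : {poly A} := cons_poly x (a e *: y) + b e *: y.
apply: (eq_computable (f := fun e => foldr (G e) 0 (f e : seq A))) => [e|].
  rewrite -[in RHS](polyseqK (f e)); elim: (polyseq (f e)) => [|x s IH] /=; first by rewrite comp_poly0.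
  rewrite IH /G !cons_poly_def comp_polyD comp_polyM comp_polyX comp_polyC.
  by rewrite -!mul_polyC; ring.
apply: (computable_foldR (G := G)) (computable_polyseq_of cf); last exact: computable_poly0.
apply: (computable_poly_add cA).
  apply: (computable_cons_poly cA); first by projections.
  by apply: (computable_scale cA); [apply: (computable_comp ca (f := fun t => t.2)) |]; projections.
by apply: (computable_scale cA); [apply: (computable_comp cb (f := fun t => t.2)) |]; projections.
Qed.

End PolyFunctions.

Section Subleading.
Context {K : fieldType} {A : idomainType} `{encoding K A}.
Hypothesis cA : computable_ring A.
Context {E : Type} `{encoding K E}.

(** The state is a window on the last two coefficients read; its initial zeros agree with the extra
    0 in [subleading]. *)
Lemma subleading_foldl (g : {poly A}) :
  subleading g = (foldl (fun st x => (st.2, x)) (0, 0) (g : seq A)).1.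
Proof.
have aux (s : seq A) a b : (foldl (fun st x => (st.2, x)) (a, b) s).1 = nth 0 [:: a, b & s] (size s).
  by elim: s a b => //= x s IH a b; rewrite IH.
by rewrite aux /subleading; case: (size g).
Qed.

Lemma computable_subleading (f : E -> {poly A}) : computable f -> computable (fun e => subleading (f e)).
Proof.
move=> cf; pose F e := (foldl (fun st x => (st.2, x)) (0, 0) (f e : seq A)).1.
apply: (eq_computable (f := F)) => [e|].
  by rewrite subleading_foldl.
apply: computable_fst_of.
apply: (computable_foldL (G := fun _ st x => (st.2, x))) (computable_polyseq_of cf).
  by apply: computable_pair; projections.
by apply: computable_pair; apply: (computable_0 cA).
Qed.

End Subleading.

Section Bipoly.
Context {K : fieldType} {E : Type} `{encoding K E}.
Let cK := atom_computable_ring K.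
Let cP := poly_computable_ring cK.
Let cPP := poly_computable_ring cP.

(** A recursion in the style of Horner: a coefficient [c(y)] becomes [c(x)], and multiplication by
    [x] becomes multiplication by [y]. *)
Lemma computable_swapXY (f : E -> {poly {poly K}}) : computable f -> computable (fun e => swapXY (f e)).
Proof.
move=> cf.
pose lift (c : {poly K}) : {poly {poly K}} :=
  foldr (fun x y => cons_poly x%:P y) 0 (c : seq K).
pose mulY (g : {poly {poly K}}) : {poly {poly K}} :=
  foldr (fun c y => cons_poly (cons_poly 0 c) y) 0 (g : seq {poly K}).
have liftE c : lift c = c^:P.
  by rewrite /lift (fold_cons_poly (fun x : K => x%:P)) -map_Poly_id0 ?polyseqK.
have mulYE g : mulY g = 'Y * g.
  rewrite /mulY (fold_cons_poly (cons_poly 0)) -map_Poly_id0 ?polyseqK; last first.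
    by rewrite cons_poly_def mul0r add0r.
  apply/polyP => i; rewrite coef_map_id0; last by rewrite cons_poly_def mul0r add0r.
  by rewrite coefCM cons_poly_def polyC0 addr0 mulrC.
apply: (eq_computable (f := fun e => foldr (fun c acc => lift c + mulY acc) 0 (f e : seq {poly K}))) => [e|].
  rewrite -[in RHS](polyseqK (f e)); elim: (polyseq (f e)) => [|c s IH] /=; first by rewrite raddf0.
  rewrite IH liftE mulYE cons_poly_def rmorphD rmorphM /= swapXY_X swapXY_polyC.
  by rewrite addrC mulrC.
apply: (computable_foldR (G := fun _ c acc => lift c + mulY acc)) (computable_polyseq_of cf);
  last exact: computable_poly0.
apply: (computable_poly_add cP).
  apply: (computable_fold_cons cP (c := fun _ x => x%:P)).
  - by apply: (computable_polyC cK); projections.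
  - exact: computable_poly0.
  - by apply: computable_polyseq_of; projections.
apply: (computable_fold_cons cP (c := fun _ c => cons_poly 0 c)).
- by apply: (computable_cons_poly cK); [apply: (computable_0 cK) | projections].
- exact: computable_poly0.
- by apply: computable_polyseq_of; projections.
Qed.

Lemma computable_tscale (a b : E -> K) (f : E -> {poly {poly K}}) :
  computable a -> computable b -> computable f -> computable (fun e => tscale (a e) (b e) (f e)).
Proof.
move=> ca cb cf; rewrite /tscale.
apply: (computable_comp_affine cP); [|by apply: (computable_polyC cK)|by apply: (computable_0 cP)].
apply: computable_swapXY.
apply: (computable_comp_affine cP); [|by apply: (computable_polyC cK)|by apply: (computable_0 cP)].
exact: computable_swapXY.
Qed.

End Bipoly.

Section Step.
Context {K : numClosedFieldType} {E : Type} `{encoding K E}.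
Let cK := atom_computable_ring K.
Let cP := poly_computable_ring cK.

Lemma computable_tstep (f : E -> {poly {poly K}}) :
  computable f -> computable (fun e => tstep (f e)).
Proof.
move=> cf; apply: computable_swapXY.
apply: (computable_comp_affine cP) => //; first exact: (computable_1 cP).
rewrite /shift; apply: (computable_scale cK); last exact: (computable_subleading cP).
apply: (computableN cK); apply: computable_inv; apply: (computableM cK); first exact: computable_degree.
by apply: (computable_coef0 cK); apply: (computable_lead_coef cP).
Qed.

End Step.

(** * The decision procedure *)

Section RootExtraction.
Context {K : fieldType}.

Definition computable_with_roots X Y `{encoding K X} `{encoding K Y}
    (F : ({poly K} -> seq K) -> X -> Y) :=
  exists P, forall roots x, eval roots P (enc x) (enc (F roots x)).

Context {X Y Z : Type} `{encoding K X} `{encoding K Y} `{encoding K Z}.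

Lemma computable_without_roots (f : X -> Y) :
  computable f -> computable_with_roots (fun _ => f).
Proof. by []. Qed.

Lemma computable_with_roots_comp (F : ({poly K} -> seq K) -> X -> Y) (G : ({poly K} -> seq K) -> Y -> Z) :
  computable_with_roots G -> computable_with_roots F ->
  computable_with_roots (fun r x => G r (F r x)).
Proof. by case=> [Q HQ] [P HP]; exists (Seq P Q) => r x; apply: EvalSeq. Qed.

Lemma computable_with_roots_pair (F : ({poly K} -> seq K) -> X -> Y) (G : ({poly K} -> seq K) -> X -> Z) :
  computable_with_roots F -> computable_with_roots G ->
  computable_with_roots (fun r x => (F r x, G r x)).
Proof. by case=> [P HP] [Q HQ]; exists (Pair P Q) => r x; apply: EvalPair. Qed.

Lemma computable_roots : computable_with_roots (fun r (c : {poly K}) => r c).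
Proof.
exists (Prim PRoots) => r c.
have -> : enc (r c) = run_primitive r PRoots (enc c); last exact: EvalPrim.
rewrite /= (_ : atoms_of_data (enc c) = c) ?polyseqK //.
rewrite /enc /enc_poly /enc /enc_seq /atoms_of_data.
by elim: (polyseq c) => //= x s ->.
Qed.

End RootExtraction.

(** * Finite search for a scaling *)

Section Search.
Context {K : fieldType}.
Let cK := atom_computable_ring K.
Let cP := poly_computable_ring cK.
Let cPP := poly_computable_ring cP.

Lemma computable_has E X `{encoding K E} `{encoding K X} (b : E -> X -> bool) (s : E -> seq X) :
  computable (fun t : X * E => b t.2 t.1) -> computable s -> computable (fun e => has (b e) (s e)).
Proof.
move=> cb cs; apply: (eq_computable (f := fun e => foldr (fun x y => if b e x then true else y) false (s e))).
  by move=> e; elim: (s e) => //= x l ->; case: (b e x).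
apply: (computable_foldR (G := fun e x y => if b e x then true else y)) => //; last exact: computable_false.
apply: computable_if; [|exact: computable_true|by projections].
by apply: (computable2 (F := fun x e => b e x) (a := fun t => t.1.2) (b := fun t => t.2)) => //; projections.
Qed.

Implicit Types f g : {poly {poly K}}.

(** Every candidate is verified exactly, so a spurious one does no harm, such as those that [roots]
    may list for the zero polynomial. *)
Definition scale_test f g (a b : K) :=
  if a == 0 then false else if b == 0 then false else g == tscale a b f.

Definition torus_test f g (As Bs : seq K) := has (fun a => has (scale_test f g a) Bs) As.

Lemma computable_torus_test :
  computable (fun t : ({poly {poly K}} * {poly {poly K}}) * (seq K * seq K) =>
    torus_test t.1.1 t.1.2 t.2.1 t.2.2).
Proof.
apply: (computable_has (b := fun t a => has (scale_test t.1.1 t.1.2 a) t.2.2)); last by projections.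
apply: (computable_has (b := fun t b => scale_test t.2.1.1 t.2.1.2 t.1 b)); last by projections.
apply: computable_if; [|exact: computable_false|].
  by apply: (computable_is0 cK); projections.
apply: computable_if; [|exact: computable_false|].
  by apply: (computable_is0 cK); projections.
apply: (computable_eq cPP); first by projections.
by apply: computable_tscale; projections.
Qed.

(* A scaling [g = tscale a b f] multiplies the leading coefficient of [f] by
   [b ^ (size f).-1], so that [b] is a root of this binomial. *)
Definition scaling_equation f g : {poly K} :=
  (lead_coef f)`_0 *: 'X^((size f).-1) - ((lead_coef g)`_0)%:P.

Lemma computable_scaling_equation E `{encoding K E} (f g : E -> {poly {poly K}}) :
  computable f -> computable g -> computable (fun e => scaling_equation (f e) (g e)).
Proof.
move=> cf cg; apply: (computable_poly_add cK).
  apply: (computable_scale cK); first by apply: (computable_coef0 cK); apply: (computable_lead_coef cP).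
  pose F e : {poly K} := foldr (fun _ y => cons_poly 0 y) 1 (behead (f e : seq {poly K})).
  apply: (eq_computable (f := F)) => [e|].
    rewrite /F -size_behead; elim: (behead _) => //= _ s ->.
    by rewrite cons_poly_def addr0 exprSr.
  apply: (computable_foldR (G := fun _ _ y => cons_poly 0 y)).
  - by apply: (computable_cons_poly cK); [apply: (computable_0 cK) | projections].
  - exact: (computable_1 cP).
  - by apply: computable_behead_of; apply: computable_polyseq_of.
apply: (computable_poly_opp cK); apply: (computable_polyC cK).
by apply: (computable_coef0 cK); apply: (computable_lead_coef cP).
Qed.

(** The additional candidate 1 serves the case in which [f] is constant in a variable: the equation
    for its factor then has degree 0 or vanishes, and all factors act alike. *)
Definition torus_decide (r : {poly K} -> seq K) (fg : {poly {poly K}} * {poly {poly K}}) :=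
  torus_test fg.1 fg.2 (1 :: r (scaling_equation (swapXY fg.1) (swapXY fg.2)))
    (1 :: r (scaling_equation fg.1 fg.2)).

Lemma computable_torus_decide : computable_with_roots torus_decide.
Proof.
apply: (computable_with_roots_comp (computable_without_roots computable_torus_test)
  (F := fun r fg => (fg, (1 :: r (scaling_equation (swapXY fg.1) (swapXY fg.2)),
     1 :: r (scaling_equation fg.1 fg.2))))).
have cons1 : computable_with_roots (fun _ (s : seq K) => 1 :: s).
  apply: computable_without_roots; apply: computable_cons; last exact: computable_id.
  exact: (computable_1 cK).
apply: computable_with_roots_pair; first exact/computable_without_roots/computable_id.
apply: computable_with_roots_pair; apply: (computable_with_roots_comp cons1);
  apply: (computable_with_roots_comp computable_roots); apply: computable_without_roots.
  by apply: computable_scaling_equation; apply: computable_swapXY; projections.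
by apply: computable_scaling_equation; projections.
Qed.

End Search.

Section Decision.
Variable K : numClosedFieldType.
Implicit Types (f g : {poly {poly K}}) (r : {poly K} -> seq K).

Lemma root_extraction_mem r (c : {poly K}) z : root_extraction r -> c != 0 -> root c z -> z \in r c.
Proof.
move=> rr c0; rewrite {1}(rr c c0) rootZ ?lead_coef_eq0 //.
by rewrite root_prod_XsubC.
Qed.

Lemma tscale_root r f a b : root_extraction r -> parametrized f -> (1 < size f)%N -> a != 0 -> b != 0 ->
  b \in r (scaling_equation f (tscale a b f)).
Proof.
move=> rr pf f1 a0 b0; have [e e0 lf] := param_lead pf f1.
have fM : f`_(size f).-1 = e%:P by rewrite -lead_coefE.
have Eg : lead_coef (tscale a b f) = (e * b ^+ (size f).-1)%:P.
  have gM : (tscale a b f)`_(size f).-1 = (e * b ^+ (size f).-1)%:P.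
    apply/polyP => j; rewrite coef_tscale fM !coefC; case: ifP => [/eqP->|]; rewrite ?mulr1 ?mul0r //.
  rewrite lead_coefE -gM; congr (_`_(_).-1); apply/eqP; rewrite eqn_leq; apply/andP; split.
    by apply/leq_sizeP => i le; apply/polyP => j; rewrite coef_tscale (nth_default 0 le) !coef0 !mul0r.
  rewrite leqNgt; apply/negP => lt; have /eqP := gM; rewrite nth_default; last by move: f1 lt; case: (size f).
  by rewrite eq_sym polyC_eq0 mulf_eq0 (negbTE e0) expf_eq0 (negbTE b0) andbF.
rewrite /scaling_equation lf Eg !coefC /=; apply: root_extraction_mem => //.
  apply: contraTneq isT => /(congr1 (fun p : {poly K} => p`_(size f).-1)).
  rewrite coefB coefZ coefXn coefC eqxx coef0.
  by move: f1; case: (size f) => [|[|n]] //= _ /eqP; rewrite subr0 mulr1 (negbTE e0).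
by rewrite /root hornerD hornerN hornerZ hornerXn hornerC subrr.
Qed.

Lemma tscale_outer_const f a b : (size f <= 1)%N -> tscale a b f = tscale a 1 f.
Proof.
move=> le; apply/polyP => i; apply/polyP => j; rewrite !coef_tscale.
case: i => [|i]; first by rewrite !expr0.
by rewrite (nth_default _ (leq_trans le _)) // coef0 !mul0r.
Qed.

Lemma swap_tscale f a b : swapXY (tscale a b f) = tscale b a (swapXY f).
Proof. by apply/polyP => i; apply/polyP => j; rewrite coef_swapXY !coef_tscale coef_swapXY mulrAC. Qed.

Lemma torus_decideP r f g : root_extraction r -> parametrized f ->
  torus_decide r (f, g) <-> torus f g.
Proof.
move=> rr pf; split=> [/hasP[a _ /hasP[b _]]|].
  rewrite /scale_test; case: eqP => // /eqP a0; case: eqP => // /eqP b0 /eqP Eg.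
  by exists a, b.
case=> a [b [a0 b0 Eg]].
suff [a' [b' [ain bin a'0 b'0 Eg']]] : exists a' b', [/\ a' \in 1 :: r (scaling_equation (swapXY f) (swapXY g)),
    b' \in 1 :: r (scaling_equation f g), a' != 0, b' != 0 & g = tscale a' b' f].
  apply/hasP; exists a' => //; apply/hasP; exists b' => //.
  by rewrite /scale_test /= (negbTE a'0) (negbTE b'0) Eg'.
have [b' [bin b'0 {}Eg]] : exists b',
    [/\ b' \in 1 :: r (scaling_equation f g), b' != 0 & g = tscale a b' f].
  case: (leqP (size f) 1) => [le|lt]; last by exists b; rewrite inE Eg tscale_root ?orbT.
  by exists 1; rewrite mem_head oner_eq0 Eg tscale_outer_const.
have [a' [ain a'0 {}Eg]] : exists a',
    [/\ a' \in 1 :: r (scaling_equation (swapXY f) (swapXY g)), a' != 0 & g = tscale a' b' f].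
  case: (leqP (size (swapXY f)) 1) => [le|lt]; last first.
    by exists a; rewrite inE Eg swap_tscale tscale_root ?orbT //; apply: parametrized_swap.
  exists 1; rewrite mem_head oner_eq0; split=> //; apply: (can_inj (@swapXYK _)).
  by rewrite Eg !swap_tscale tscale_outer_const.
by exists a', b'.
Qed.

(* The table has at least as many rows as [f] has degree in either variable, so
   [normalized_iter_tstep] applies. *)
Definition normal_form (T : seq (seq K)) : {poly {poly K}} :=
  foldl (fun f _ => iter 4 (@tstep K) f) (tstep (Poly [seq Poly s | s <- T])) T.

Lemma normal_formE T : normal_form T = iter (4 * size T).+1 (@tstep K) (Poly [seq Poly s | s <- T]).
Proof.
rewrite /normal_form iterSr; elim: T (tstep _) => // s T IH f.
by rewrite [LHS]IH mulnS addnC iterD.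
Qed.

Lemma computable_normal_form E `{encoding K E} (T : E -> seq (seq K)) :
  computable T -> computable (fun e => normal_form (T e)).
Proof.
have cK := atom_computable_ring K; have cP := poly_computable_ring cK.
move=> cT; apply: (computable_foldL (G := fun _ f _ => iter 4 (@tstep K) f)) => //.
  by do 4!apply: computable_tstep; projections.
apply: computable_tstep.
apply: (eq_computable (f := fun e => foldr (fun s y => cons_poly (Poly s) y) 0 (T e))) => [e|].
  exact: (fold_cons_poly (fun s : seq K => Poly s)).
apply: (computable_fold_cons cP (c := fun _ s => Poly s)) => //; last exact: computable_poly0.
by apply: (computable_Poly cK); projections.
Qed.

Definition coef_table (p : {mpoly K[2]}) : seq (seq K) :=
  [seq [seq p@_(mon i j) | j <- iota 0 (msize p)] | i <- iota 0 (msize p)].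

Lemma enc_coef_table p : enc (coef_table p) = data_of_poly p.
Proof. by rewrite /enc /enc_seq /coef_table -map_comp. Qed.

Lemma Poly_coef_table p : Poly [seq Poly s | s <- coef_table p] = bipoly_of p.
Proof.
apply/polyP => i; rewrite coef_Poly coef_poly -map_comp.
case: ltnP => [lt|le]; last by rewrite nth_default // size_map size_iota.
rewrite (nth_map 0%N) ?size_iota // nth_iota //= add0n; apply/polyP => j; rewrite coef_Poly coef_poly.
case: ltnP => [lt'|le]; last by rewrite nth_default // size_map size_iota.
by rewrite (nth_map 0%N) ?size_iota // nth_iota.
Qed.

Lemma normal_form_spec p : polynomially_parametrized p -> let f := normal_form (coef_table p) in
  [/\ parametrized f, normalized f & automorphic p (mpoly_of f)].
Proof.
move=> [u [v puv]]; have pf : parametrized (bipoly_of p).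
  by exists u, v => x y; rewrite -puv -meval_mpoly_of bipoly_ofK.
rewrite /= normal_formE Poly_coef_table size_map size_iota; split.
- by elim: (_.+1) => //= k IH; apply: param_tstep.
- apply: normalized_iter_tstep => //.
  (* Twice this bound is [4 * msize p], whence the four steps per row in [normal_form]; its initial
     step makes the inequality strict. *)
  have : (bisize (bipoly_of p) <= msize p + msize p)%N.
    exact: leq_add (size_bipoly_of p) (sizeY_bipoly_of p).
  by move: (bisize _) (msize p) => m n; lia.
- rewrite -{1}(bipoly_ofK p); elim: (_.+1) => /= [|k IH]; first exact: automorphic_refl.
  apply: automorphic_trans IH _; apply: automorphic_trans (automorphic_swap _).
  by rewrite /tsch -polyC1; apply: automorphic_comp_affine; rewrite oner_eq0.
Qed.

Definition decide r (t : {poly {poly K}} * {poly {poly K}}) :=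
  if torus_decide r t then true else torus_decide r (t.1, swapXY t.2).

Lemma computable_decide : computable_with_roots decide.
Proof.
pose or_ (b : bool * bool) := if b.1 then true else b.2.
have c_or : computable_with_roots (K := K) (fun _ => or_).
  by apply/computable_without_roots/computable_if; [|exact: computable_true|]; projections.
apply: (computable_with_roots_comp c_or (F := fun r t => (torus_decide r t, torus_decide r (t.1, swapXY t.2)))).
apply: computable_with_roots_pair; first exact: computable_torus_decide.
apply: (computable_with_roots_comp computable_torus_decide (F := fun _ t => (t.1, swapXY t.2))).
apply/computable_without_roots/computable_pair; first by projections.
by apply: computable_swapXY; projections.
Qed.

(** The program sees the coefficient tables alone; the parametrizations serve to prove that the
    fixed number of steps normalizes. Each input is automorphic to its normal form, so the question
    passes to the normal forms. *)
Theorem equivalence_decidable : exists P : program,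
  forall r, root_extraction r -> forall p q : {mpoly K[2]},
    polynomially_parametrized p -> polynomially_parametrized q ->
    exists b : bool,
      eval r P (Node (data_of_poly p) (data_of_poly q)) (data_of_bool _ b) /\ (b <-> automorphic p q).
Proof.
have [P HP] : computable_with_roots (fun r (t : seq (seq K) * seq (seq K)) =>
    decide r (normal_form t.1, normal_form t.2)).
  apply: (computable_with_roots_comp computable_decide (F := fun _ t => (normal_form t.1, normal_form t.2))).
  by apply/computable_without_roots/computable_pair; apply: computable_normal_form; projections.
exists P => r rr p q pp pq; have := HP r (coef_table p, coef_table q).
rewrite /enc /enc_pair !enc_coef_table /=.
have [pf nf af] := normal_form_spec pp; have [pg ng ag] := normal_form_spec pq.
set f := normal_form (coef_table p) in pf nf af *; set g := normal_form (coef_table q) in pg ng ag *.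
move=> ev; exists (decide r (f, g)); split=> //.
have -> : decide r (f, g) <-> torus f g \/ torus f (swapXY g).
  rewrite /decide /=; rewrite -(torus_decideP g rr pf) -(torus_decideP (swapXY g) rr pf).
  by case: ifP => _; split=> //; [left | right | case].
rewrite -(automorphic_normalized pf pg nf ng); split=> h.
  exact: automorphic_trans (automorphic_trans af h) (automorphic_sym ag).
exact: automorphic_trans (automorphic_trans (automorphic_sym af) h) ag.
Qed.

End Decision.

Local Open Scope complex_scope.

Theorem proposition1p2 (R : realType) :
  exists P : program,
    forall (roots : {poly R[i]} -> seq R[i]), root_extraction roots ->
    forall p q : {mpoly R[i][2]},
      polynomially_parametrized p -> polynomially_parametrized q ->
      exists b : bool,
        eval roots P (Node (data_of_poly p) (data_of_poly q)) (data_of_bool _ b)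
        /\ (b <-> automorphic p q).
Proof. exact: (@equivalence_decidable R[i]). Qed.
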